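(* Let $\phi_t$ be a flow of automorphisms of the principal $G$-bundle $Q\to X$ which is chain transitive on the base $X$, let $\mathcal M^+\subset\mathbb F Q$ be the attractor chain component and $\Theta(\phi)=\{\alpha\in\Sigma:\alpha(H_\phi)=0\}$. Let $\mu>0$ be a contraction exponent of the linear flow $\Phi_t$ on the vector bundle $\mathcal V_{\Theta(\phi)}$. Then every $\mathfrak a$-Lyapunov exponent $\lambda\in\Lambda_{\mathrm{Ly}}(\mathcal M^+)$ satisfies $$\alpha(\lambda)\ge\mu,\qquad \alpha\in\Pi^+\setminus\langle\Theta(\phi)\rangle.$$
   Context: Lie groups. $G$ is a noncompact semi-simple Lie group with finite center and Lie algebra $\mathfrak g$. Fix a Cartan involution $\theta$ with Cartan decomposition $\mathfrak g=\mathfrak k\oplus\mathfrak s$, and the inner product $B_\theta(X,Y)=-\langle X,\theta Y\rangle$ on $\mathfrak g$ ($\langle\cdot,\cdot\rangle$ the Killing form). Fix a maximal abelian subspace $\mathfrak a\subset\mathfrak s$ and an (open) Weyl chamber $\mathfrak a^+\subset\mathfrak a$; $\Pi^+$ and $\Sigma$ are the sets of positive and of simple roots, $\mathfrak g_\alpha$ the root spaces, $\mathfrak n^{+}=\sum_{\alpha\in\Pi^+}\mathfrak g_\alpha$. For $\Theta\subset\Sigma$, $\langle\Theta\rangle$ is the set of roots that are linear combinations of elements of $\Theta$. Put $K=\exp\mathfrak k$, $A=\exp\mathfrak a$, $N=\exp\mathfrak n^+$, so $G=KAN$ (Iwasawa decomposition). $M$ and $M^*$ are the centralizer and normalizer of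 $A$ in $K$; the Weyl group $\mathcal W=M^*/M$ acts on $\mathfrak a$ by $\mathrm{Ad}$, and the same letter denotes an element of $\mathcal W$ and a representative in $M^*$. $P=MAN$, $\mathbb F=G/P$ with origin $b_0$. For $H\in\mathrm{cl}\,\mathfrak a^+$ let $Z_H=\{g\in G:\mathrm{Ad}(g)H=H\}$, $K_H=Z_H\cap K$. For $Y=\mathrm{Ad}(g)H$, $g\in G$, put $\mathrm{fix}(Y,w)=gK_H w b_0\subset\mathbb F$. Bundle, flow, cocycle. $\pi:Q\to X$ is a (locally trivial) principal bundle with structure group $G$ acting on the right, $X$ compact Hausdorff. $\phi_t$, $t\in\mathbb T$ ($\mathbb T=\mathbb R$ or $\mathbb Z$), is a continuous flow on $Q$ with $\phi_t(q\cdot g)=\phi_t(q)\cdot g$; it induces flows on $X$ and on the flag bundle $\mathbb F Q=Q\times_G\mathbb F$ by $\phi_t(q\cdot b)=\phi_t(q)\cdot b$. Let $R\subset Q$ be a $K$-reduction (a principal subbundle with structure group $K$; one exists). Each $q\in Q$ is uniquely $q=r\cdot hn$ with $r\in R$, $h\in A$, $n\in N$; put $\mathsf a(q)=\log h\in\mathfrak a$. The $\mathfrak a$-cocycle over $\mathbb F Q$ is $\mathsf a(t,\xi)=\mathsf a(\phi_t(r))$ for $\xi=r\cdot b_0$, $r\in R$ (well defined). The Lyapunov exponent is $\lambda(\xi)=\lim_{t\to+\infty}\frac1t\mathsf a(t,\xi)$ when the limit exists, and $\Lambda_{\mathrm{Ly}}(Y)=\{\lambda(\xi):\xi\in Y,\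 \lambda(\xi)\text{ exists}\}$; these do not depend on the choice of $R$. Chain components. For a flow on a compact Hausdorff space $E$, an open covering $\mathcal U$ and $T>0$, a $(\mathcal U,T)$-chain from $x$ to $y$ consists of points $x=x_0,\dots,x_N=y$ ($N\ge1$) and times $t_0,\dots,t_{N-1}\ge T$ such that $t_i\cdot x_i$ and $x_{i+1}$ lie in a common element of $\mathcal U$ for each $i$. A set $Y$ is chain transitive if for all $x,y\in Y$ and all $\mathcal U,T$ there is a $(\mathcal U,T)$-chain from $x$ to $y$; a chain component is a maximal chain transitive set. Known theorem (Braga Barros–San Martin, Patrão–San Martin): if $X$ is chain transitive there exist $H_\phi\in\mathrm{cl}\,\mathfrak a^+$ (the block form) and a continuous map $f_\phi:Q\to\mathrm{Ad}(G)H_\phi$ with $f_\phi(\phi_t(q))=f_\phi(q)$ and $f_\phi(q\cdot g)=\mathrm{Ad}(g^{-1})f_\phi(q)$, such that the chain components of the flow on $\mathbb F Q$ are exactly the sets $\mathcal M(w)$, $w\in\mathcal W$, given fiberwise by $\mathcal M(w)_{\pi(q)}=q\cdot\mathrm{fix}(f_\phi(q),w)$; $\mathcal M^+=\mathcal M(1)$ is the unique attractor and $\mathcal M(w_0)$ ($w_0$ the longest element of $\mathcal W$) the unique repeller among them. Fix such $H_\phi,f_\phi$. The linear flow. Write $\Theta=\Theta(\phi)$, $Z_\Theta=Z_{H_\phi}$. The block reduction $Q_\phi=f_\phi^{-1}(H_\phi)$ is a $\phi_t$-invariant principal subbundle of $Q$ with structure group $Z_\Theta$; $R_\phi\subset Q_\phi$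 denotes a reduction of it to $K_{H_\phi}$. Let $\mathfrak n_\Theta^-=\sum_{\alpha\in\Pi^+\setminus\langle\Theta\rangle}\mathfrak g_{-\alpha}$, on which $Z_\Theta$ acts by $\mathrm{Ad}$. $\mathcal V_\Theta=Q_\phi\times_{Z_\Theta}\mathfrak n_\Theta^-\to X$ is the associated vector bundle, with linear flow $\Phi_t(q\cdot X)=\phi_t(q)\cdot X$ ($q\in Q_\phi$, $X\in\mathfrak n_\Theta^-$) and metric $(r\cdot X,r\cdot Y)=B_\theta(X,Y)$, $r\in R_\phi$. A contraction exponent of $\Phi_t$ is a number $\mu>0$ for which there is $C>0$ with $\|\Phi_t\|_x\le Ce^{-\mu t}$ for all $t\ge0$, $x\in X$, where $\|\Phi_t\|_x$ is the operator norm of $\Phi_t$ on the fiber over $x$ (this does not depend on the chosen metric). *)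

(* Defs.v *)
From HB Require Import structures.
From mathcomp Require Import all_boot all_order all_algebra.
From mathcomp Require Import all_classical all_reals all_analysis.
From mathcomp Require Import generic_quotient.
Import Order.TTheory GRing.Theory Num.Theory.
Import numFieldNormedType.Exports.

Set Implicit Arguments.
Unset Strict Implicit.
Unset Printing Implicit Defensive.

Local Open Scope classical_set_scope.
Local Open Scope ring_scope.
Local Open Scope quotient_scope.

(* For an open set U, [Ck k U f] says that f is of class C^k on U. *)
Fixpoint Ck (R : realType) (V W : normedModType R) (k : nat) (U : set V)
    (f : V -> W) : Prop :=
  match k with
  | 0%N => forall x, U x -> {for x, continuous f}
  | k'.+1 => (forall x, U x -> differentiable f x) /\
             (forall v : V, Ck k' U (fun x => 'D_v f x))
  end.

Definition smooth_on (R : realType) (V W : normedModType R) (U : set V)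
    (f : V -> W) : Prop := forall k, Ck k U f.

(* No compatibility is assumed here: the continuity of the group law is part of
   [lie_group]. *)
#[short(type="topGroupType")]
HB.structure Definition TopGroup := {G of Group G & Topological G}.

Record chart (R : realType) (n : nat) (G : topologicalType) := Chart {
  chart_dom : set G ;
  chart_to : G -> 'rV[R]_n ;
  chart_of : 'rV[R]_n -> G ;
  chart_dom_open : open chart_dom ;
  chart_im_open : open (chart_to @` chart_dom) ;
  chart_toK : forall g, chart_dom g -> chart_of (chart_to g) = g ;
  chart_to_cont : {within chart_dom, continuous chart_to} ;
  chart_of_cont : {within chart_to @` chart_dom, continuous chart_of} }.

Definition chart_im (R : realType) n (G : topologicalType) (c : chart R n G) :
  set 'rV[R]_n := chart_to c @` chart_dom c.

(* [id_chart] is a chart around the identity; it is used to identify the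
   tangent space at the identity with 'rV[R]_n. *)
Record lie_group (R : realType) (n : nat) (G : topGroupType) := LieGroup {
  lie_hausdorff : hausdorff_space G ;
  lie_second_countable : @second_countable G ;
  mul_cont : continuous (fun p : G * G => (p.1 * p.2)%g) ;
  inv_cont : continuous (fun g : G => (g^-1)%g) ;
  atlas : set (chart R n G) ;
  atlas_cover : forall g : G, exists2 c, atlas c & chart_dom c g ;
  atlas_compat : forall c1 c2, atlas c1 -> atlas c2 ->
    smooth_on (chart_to c1 @` (chart_dom c1 `&` chart_dom c2))
      (fun x => chart_to c2 (chart_of c1 x)) ;
  mul_smooth : forall c1 c2 c3, atlas c1 -> atlas c2 -> atlas c3 ->
    smooth_on
      [set p : 'rV[R]_n * 'rV[R]_n |
        [/\ chart_im c1 p.1, chart_im c2 p.2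
          & chart_dom c3 (chart_of c1 p.1 * chart_of c2 p.2)%g]]
      (fun p => chart_to c3 (chart_of c1 p.1 * chart_of c2 p.2)%g) ;
  inv_smooth : forall c1 c2, atlas c1 -> atlas c2 ->
    smooth_on
      [set x | chart_im c1 x /\ chart_dom c2 ((chart_of c1 x)^-1)%g]
      (fun x => chart_to c2 ((chart_of c1 x)^-1)%g) ;
  id_chart : chart R n G ;
  id_chart_atlas : atlas id_chart ;
  id_chart_dom : chart_dom id_chart (1%g : G) }.

Definition center_set (G : groupType) : set G :=
  [set z | forall g : G, (z * g = g * z)%g].
Arguments center_set : clear implicits.

Section LieAlgebra.
Context (R : realType) (n : nat) (G : topGroupType) (L : lie_group R n G).
Local Notation g_ := 'rV[R]_n.
Local Notation c1 := (id_chart L).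

Definition id_coord : g_ := chart_to c1 (1%g : G).

(* The differential at the identity of the conjugation by g. *)
Definition Ad (g : G) (X : g_) : g_ :=
  'D_X (fun x : g_ => chart_to c1 (g * chart_of c1 x * g^-1)%g) id_coord.

(* The Lie bracket [X, Y] = ad(X) Y, where ad is the differential of Ad at the
   identity. *)
Definition bracket (X Y : g_) : g_ :=
  'D_X (fun x : g_ => Ad (chart_of c1 x) Y) id_coord.

Definition one_parameter (c : R -> G) (X : g_) : Prop :=
  [/\ forall s t, c (s + t) = (c s * c t)%g,
      continuous c
    & is_derive (0 : R) (1 : R) (fun t : R => chart_to c1 (c t)) X].

(* [is_exp X h] is the graph h = exp X of the exponential map; [exp_image S] is
   then the set exp S. *)
Definition is_exp (X : g_) (h : G) : Prop :=
  exists2 c, one_parameter c X & h = c 1.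

Definition exp_image (S : set g_) : set G :=
  [set h | exists2 X, S X & is_exp X h].

Definition killing (X Y : g_) : R :=
  \tr (lin1_mx (fun Z : g_ => bracket X (bracket Y Z))).

Definition lie_ideal (I : {vspace g_}) : Prop :=
  forall X Y : g_, Y \in I -> bracket X Y \in I.

Definition derived_algebra (U : {vspace g_}) : {vspace g_} :=
  <<[seq bracket X Y | X <- vbasis U, Y <- vbasis U]>>%VS.

Definition solvable_algebra (U : {vspace g_}) : Prop :=
  exists k, iter k derived_algebra U = 0%VS.

Definition semisimple : Prop :=
  forall I : {vspace g_}, lie_ideal I -> solvable_algebra I -> I = 0%VS.

Definition cartan_form (theta : 'End(g_)) (X Y : g_) : R :=
  - killing X (theta Y).

Definition cartan_involution (theta : 'End(g_)) : Prop :=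
  [/\ forall X Y, theta (bracket X Y) = bracket (theta X) (theta Y),
      forall X, theta (theta X) = X
    & forall X, X != 0 -> 0 < cartan_form theta X X].

Definition abelian_subspace (a : {vspace g_}) : Prop :=
  forall X Y, X \in a -> Y \in a -> bracket X Y = 0.

(* a is contained in the (-1)-eigenspace s of theta. *)
Definition in_s (theta : 'End(g_)) (a : {vspace g_}) : Prop :=
  forall X, X \in a -> theta X = - X.

Definition maximal_abelian (theta : 'End(g_)) (a : {vspace g_}) : Prop :=
  [/\ in_s theta a, abelian_subspace a
    & forall a' : {vspace g_}, in_s theta a' -> abelian_subspace a' ->
        (a <= a')%VS -> a' = a].

Section Roots.
Variable a : {vspace g_}.
Local Notation dual_a := 'Hom(subvs_of a, R^o).

Definition root_space (al : dual_a) : set g_ :=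
  [set X | forall H : subvs_of a, bracket (vsval H) X = al H *: X].

Definition is_root (al : dual_a) : Prop :=
  al != 0 /\ exists2 X, X != 0 & root_space al X.

Definition regular_set : set g_ :=
  [set vsval H | H in [set H : subvs_of a |
     forall al : dual_a, is_root al -> al H != 0]].

Definition weyl_chamber (C : set g_) : Prop :=
  exists2 H, regular_set H & C = connected_component regular_set H.

Definition root_sum (Phi : set dual_a) : set g_ :=
  [set X | exists2 s : seq (dual_a * g_),
     (forall p, p \in s -> Phi p.1 /\ root_space p.1 p.2)
     & X = \sum_(p <- s) p.2].

(* A root has no zero, hence constant sign, on the chamber C. *)
Definition positive_root (C : set g_) (al : dual_a) : Prop :=
  is_root al /\ forall H : subvs_of a, C (vsval H) -> 0 < al H.

Definition simple_root (C : set g_) (al : dual_a) : Prop :=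
  positive_root C al /\
  forall be ga, positive_root C be -> positive_root C ga -> al <> be + ga.

Definition roots_spanned (Th : set dual_a) (al : dual_a) : Prop :=
  is_root al /\
  exists2 s : seq dual_a, (forall be, be \in s -> Th be) & al \in span s.

End Roots.
End LieAlgebra.

Record cartan_data (R : realType) (n : nat) (G : topGroupType)
    (L : lie_group R n G) := CartanData {
  cartan_inv : 'End('rV[R]_n) ;
  cartan_invP : cartan_involution L cartan_inv ;
  cartan_a : {vspace 'rV[R]_n} ;
  cartan_aP : maximal_abelian L cartan_inv cartan_a ;
  chamber : set 'rV[R]_n ;
  chamberP : weyl_chamber L cartan_a chamber }.

Section KAN.
Context (R : realType) (n : nat) (G : topGroupType) (L : lie_group R n G).
Variable D : cartan_data L.
Local Notation g_ := 'rV[R]_n.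

Definition atype := subvs_of (cartan_a D).
Definition functional := 'Hom(atype, R^o).

Definition posroot : set functional := positive_root L (chamber D).
Definition simroot : set functional := simple_root L (chamber D).

Definition groupK : set G :=
  exp_image L [set X | cartan_inv D X = X].
Definition groupA : set G := exp_image L [set X | X \in cartan_a D].
Definition groupN : set G := exp_image L (root_sum L posroot).

Definition groupM : set G :=
  [set k | groupK k /\ forall h, groupA h -> (k * h = h * k)%g].
Definition groupMstar : set G :=
  [set k | groupK k /\ [set (k * h * k^-1)%g | h in groupA] = groupA].

Definition groupP : set G :=
  [set p | exists m h u,
     [/\ groupM m, groupA h, groupN u & p = (m * h * u)%g]].

Definition stabZ (H : atype) : set G := [set g | Ad L g (vsval H) = vsval H].
Definition stabK (H : atype) : set G := stabZ H `&` groupK.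

End KAN.

Section KernelEquiv.
Context (T : choiceType) (S : Type) (f : T -> S).

Definition ker_rel : rel T := fun x y => `[< f x = f y >].

Lemma ker_rel_refl : reflexive ker_rel.
Proof. by move=> x; apply/asboolP. Qed.

Lemma ker_rel_sym : symmetric ker_rel.
Proof. by move=> x y; apply/asboolP/asboolP. Qed.

Lemma ker_rel_trans : transitive ker_rel.
Proof. by move=> y x z /asboolP xy /asboolP yz; apply/asboolP; rewrite xy. Qed.

Canonical ker_equiv := EquivRel ker_rel ker_rel_refl ker_rel_sym ker_rel_trans.

End KernelEquiv.

Definition ker_quot (T : topologicalType) (S : Type) (f : T -> S) :=
  quotient_topology {eq_quot (ker_equiv f)}.

Definition to_quot (T : topologicalType) (S : Type) (f : T -> S) (x : T) :
  ker_quot f := (\pi_(ker_quot f) x)%qT.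

Section Flag.
Context (R : realType) (n : nat) (G : topGroupType) (L : lie_group R n G).
Variable D : cartan_data L.

Definition left_coset (g : G) : set G := [set (g * p)%g | p in groupP D].

(* The flag manifold G / P: g and h are identified when g P = h P. *)
Definition flag := ker_quot left_coset.
Definition flag_origin : flag := to_quot left_coset 1%g.
Definition flag_act (g : G) (b : flag) : flag :=
  to_quot left_coset (g * repr b)%g.

(* fix(Y, w) = g K_H w b0 for Y = Ad(g) H. *)
Definition fix_set (H : atype D) (Y : 'rV[R]_n) (w : G) : set flag :=
  [set b | exists g k, [/\ Y = Ad L g (vsval H), stabK H k
                         & b = flag_act (g * k * w)%g flag_origin]].

End Flag.

Section Principal.
Context (G : topGroupType) (Q X : topologicalType).
Variables (act : Q -> G -> Q) (proj : Q -> X).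

(* S, with the subspace topology and the action of the subgroup S0 of G, is a
   locally trivial principal S0-bundle over X; [tau] and [kap] give a local
   trivialization U x S0 ~ S `&` proj @^-1` U and its inverse. *)
Definition principal_on (S : set Q) (S0 : set G) : Prop :=
  (forall q g, S q -> S0 g -> S (act q g)) /\
  forall x : X, exists (U : set X) (tau : X * G -> Q) (kap : Q -> G),
    [/\ open U /\ U x,
        {within U `*` S0, continuous tau},
        {within S `&` proj @^-1` U, continuous kap},
        forall u g, U u -> S0 g ->
          [/\ S (tau (u, g)), proj (tau (u, g)) = u & kap (tau (u, g)) = g]
            /\ forall g', S0 g' -> tau (u, (g * g')%g) = act (tau (u, g)) g'
      & forall q, S q -> U (proj q) ->
          S0 (kap q) /\ tau (proj q, kap q) = q].

End Principal.

Record principal_bundle (G : topGroupType) (Q X : topologicalType) :=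
  PrincipalBundle {
  bact : Q -> G -> Q ;
  bproj : Q -> X ;
  bact1 : forall q, bact q 1%g = q ;
  bactM : forall q g h, bact q (g * h)%g = bact (bact q g) h ;
  bact_cont : continuous (fun p : Q * G => bact p.1 p.2) ;
  bproj_cont : continuous bproj ;
  bprincipal : principal_on bact bproj [set: Q] [set: G] }.

Section Bundle.
Context (G : topGroupType) (Q X : topologicalType).
Variable B : principal_bundle G Q X.

Lemma bproj_surj (x : X) : exists q, bproj B q = x.
Proof.
have [_ /(_ x) [U [tau [kap [[_ Ux] _ _ /(_ x 1%g Ux I) [[_ e _] _] _]]]]] :=
  bprincipal B.
by exists (tau (x, 1%g)).
Qed.

Definition lift_point (x : X) : Q := projT1 (cid (bproj_surj x)).

Definition base_flow (T : Type) (phi : T -> Q -> Q) (t : T) (x : X) : X :=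
  bproj B (phi t (lift_point x)).

(* S' is a principal subbundle of S with structure group S0. *)
Definition reduction (S S' : set Q) (S0 : set G) : Prop :=
  S' `<=` S /\ principal_on (bact B) (bproj B) S' S0.

Section Associated.
Variables (S0 : set G) (Y : topologicalType) (actY : G -> Y -> Y).

Definition orbit_of (p : Q * Y) : set (Q * Y) :=
  [set (bact B p.1 g, actY g^-1%g p.2) | g in S0].

(* The quotient of Q * Y by S0; (q, y) and (q g, g^-1 y) have the same class
   q . y. *)
Definition assoc := ker_quot orbit_of.
Definition assoc_pt (q : Q) (y : Y) : assoc := to_quot orbit_of (q, y).
Definition assoc_flow (T : Type) (phi : T -> Q -> Q) (t : T) (z : assoc) :
  assoc := assoc_pt (phi t (repr z).1) (repr z).2.

End Associated.
End Bundle.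

(* The time set T is the set of all reals or the set of integers inside R;
   the values of f at times outside T are irrelevant. *)
Section Flow.
Context (R : realType) (T : set R) (E : topologicalType).
Implicit Types (f : R -> E -> E).

Definition is_flow f : Prop :=
  [/\ forall x, f 0 x = x,
      forall s t x, T s -> T t -> f (s + t) x = f s (f t x)
    & {within T `*` [set: E], continuous (fun p : R * E => f p.1 p.2)}].

Definition open_cover (UU : set (set E)) : Prop :=
  (forall U, UU U -> open U) /\ forall x, exists2 U, UU U & U x.

Definition is_chain f (UU : set (set E)) (T0 : R) (x y : E) : Prop :=
  exists (N : nat) (p : nat -> E) (t : nat -> R),
    [/\ (0 < N)%N, p 0%N = x, p N = y
      & forall i, (i < N)%N -> [/\ T (t i), T0 <= t i
          & exists2 U, UU U & U (f (t i) (p i)) /\ U (p i.+1)]].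

Definition chain_transitive f (Y : set E) : Prop :=
  forall x y, Y x -> Y y -> forall UU T0, open_cover UU -> 0 < T0 ->
    is_chain f UU T0 x y.

Definition chain_component f (Y : set E) : Prop :=
  chain_transitive f Y /\
  forall Y', chain_transitive f Y' -> Y `<=` Y' -> Y' = Y.

Definition omega_limit f (V : set E) : set E :=
  [set y | forall s, T s -> 0 <= s ->
     closure (\bigcup_(t in [set t | T t /\ s <= t]) f t @` V) y].

Definition attractor f (Y : set E) : Prop :=
  exists V : set E, [/\ open V, Y `<=` V & omega_limit f V = Y].

End Flow.

Section Setting.
Context (R : realType) (n : nat) (G : topGroupType) (L : lie_group R n G).
Context (D : cartan_data L) (Q X : topologicalType).
Context (B : principal_bundle G Q X) (T : set R) (phi : R -> Q -> Q).
Local Notation g_ := 'rV[R]_n.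

Definition flag_bundle := assoc B [set: G] (@flag_act _ _ _ _ D).
Definition flag_flow : R -> flag_bundle -> flag_bundle :=
  assoc_flow (B := B) phi.
Definition flag_pt (q : Q) (b : flag D) : flag_bundle :=
  assoc_pt B [set: G] (@flag_act _ _ _ _ D) q b.

Section BlockForm.
Variables (H : atype D) (f : Q -> g_).

(* M(w), with fiber q . fix(f(q), w) over proj q. *)
Definition morse (w : G) : set flag_bundle :=
  [set z | exists q b, fix_set H (f q) w b /\ z = flag_pt q b].

(* The last two fields: the chain components of the flow on the flag bundle are
   exactly the sets M(w), and M(1) is the only attractor among them. *)
Record block_form : Prop := BlockForm {
  block_chamber : closure (chamber D) (vsval H) ;
  block_cont : continuous f ;
  block_orbit : forall q, exists g, f q = Ad L g (vsval H) ;
  block_inv : forall t q, T t -> f (phi t q) = f q ;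
  block_equiv : forall q g, f (bact B q g) = Ad L g^-1%g (f q) ;
  block_components : forall C : set flag_bundle,
    chain_component T flag_flow C <->
    exists2 w, groupMstar D w & C = morse w ;
  block_attractor : forall C : set flag_bundle,
    chain_component T flag_flow C ->
    (attractor T flag_flow C <-> C = morse 1%g) }.

Definition Theta : set (functional D) :=
  [set al | simroot al /\ al H = 0].

Definition outer_root : set (functional D) :=
  [set al | posroot al /\ ~ roots_spanned L Theta al].

Definition block_reduction : set Q := [set q | f q = vsval H].

Definition nminus : set g_ :=
  root_sum L [set al : functional D | outer_root (- al)].

(* The bundle V_Theta consists of the classes of the pairs (q, X) with q in
   the block reduction and X in [nminus]. *)
Definition vect_total := assoc B (stabZ H) (Ad L).
Definition vect_pt (q : Q) (Y : g_) : vect_total :=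
  assoc_pt B (stabZ H) (Ad L) q Y.
Definition vect_flow : R -> vect_total -> vect_total :=
  assoc_flow (B := B) phi.
Definition vect_fiber (x : X) : set vect_total :=
  [set v | exists q Y, [/\ block_reduction q, bproj B q = x, nminus Y
                         & v = vect_pt q Y]].

(* |r . Y|^2 = B_theta(Y, Y) for r in the reduction Rphi. *)
Definition vect_norm (Rphi : set Q) (v : vect_total) : R :=
  let Y := xget 0 [set Y | exists2 r, Rphi r & v = vect_pt r Y] in
  Num.sqrt (cartan_form L (cartan_inv D) Y Y).

Definition fiber_opnorm (Rphi : set Q) (t : R) (x : X) : \bar R :=
  ereal_sup [set (vect_norm Rphi (vect_flow t v))%:E |
    v in [set v | vect_fiber x v /\ vect_norm Rphi v <= 1]].

Definition contraction_exponent (Rphi : set Q) (mu : R) : Prop :=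
  0 < mu /\ exists2 C : R, 0 < C &
    forall t x, T t -> 0 <= t ->
      (fiber_opnorm Rphi t x <= (C * expR (- mu * t))%:E)%E.

End BlockForm.

(* Graph of the map q |-> a(q) = log h, where q = r . h n with r in RK, h in A
   and n in N; the Iwasawa decomposition makes it total and single-valued, so
   this and [a_cocycle] are relations rather than functions. *)
Definition iwasawa_log (RK : set Q) (q : Q) (H : atype D) : Prop :=
  exists r h u, [/\ RK r, is_exp L (vsval H) h, groupN D u
                  & q = bact B r (h * u)%g].

Definition a_cocycle (RK : set Q) (t : R) (xi : flag_bundle) (H : atype D) :
    Prop :=
  exists r, [/\ RK r, xi = flag_pt r (flag_origin D)
              & iwasawa_log RK (phi t r) H].

Definition lyapunov_exponent (RK : set Q) (xi : flag_bundle) (la : atype D) :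
    Prop :=
  exists2 A : R -> atype D, (forall t, T t -> a_cocycle RK t xi (A t)) &
    t^-1 *: (vsval (A t) : g_) @[t --> within T (+oo)%R] --> (vsval la : g_).

Definition lyapunov_spectrum (RK : set Q) (Y : set flag_bundle) :
    set (atype D) :=
  [set la | exists2 xi, Y xi & lyapunov_exponent RK xi la].

End Setting.

(* Main.v *)
(* Let [xi = q b_0] be a point of the attractor, with [q] in the block
   reduction, let [r in RK] be a point over it, [r = q p] with [p in P], and
   write [phi_t r = r' h u] (Iwasawa), [phi_t q = r_t z_t] with [r_t] in
   [Rphi] and [z_t] fixing [H].  Then [d z_t p = h u], where [d] compares the
   two compact reductions over the same base point.  For a positive root [al]
   off [Theta] and [Y in g_al], the Killing form gives
     exp(- al (a(t, xi))) <Y, theta Y> = <Y, Ad(h u) theta Y>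
                                       = <Ad(d^-1) Y, Ad(z_t) X>,
   where [X] is the [n_Theta^-]-part of [Ad p (theta Y)]: the remaining part
   lies in the nonnegative eigenspaces of [ad H], and [Ad(d^-1) Y] in the
   positive ones, so they pair to zero.  [Ad(z_t) X] decays like exp(- mu t) by
   the contraction hypothesis, and [Ad(d^-1)] is bounded because the base is compact
   and the [K]-parts are isometries.  Hence [al (a(t, xi)) >= mu t - const].

   A Lie group is given by charts only, so the action of [Ad] on elements of
   [A], [N] and [K] is read off the differential equation satisfied by
   [Ad (c t)] for a one-parameter subgroup [c], and one-parameter subgroups
   with prescribed velocity [X] are obtained as limits, along an ultrafilter,
   of the powers [g_k ^+ floor (t 2^k)], [g_k] having coordinate [2^-k X]. *)
Require Import Defs.
From HB Require Import structures.
From mathcomp Require Import all_boot all_order all_algebra.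
From mathcomp Require Import all_classical all_reals all_analysis.
From mathcomp Require Import generic_quotient ring lra.
Import Order.TTheory GRing.Theory Num.Theory.
Import numFieldNormedType.Exports.

Set Implicit Arguments.
Unset Strict Implicit.
Unset Printing Implicit Defensive.

Local Open Scope classical_set_scope.
Local Open Scope ring_scope.

(** * Calculus *)
Section Calculus.
Context {R : realType}.

(** Beyond the exponentials, the proof is bookkeeping of eigenvalues of ad H. Subspaces are sets of
    sums of eigenvectors with eigenvalues in an upward closed set: N preserves them, since
    bracketing with positive root vectors does not lower eigenvalues, and two of them are orthogonal
    for the Killing form when no eigenvalue of one is opposite to one of the other. The space
    n_Theta^- is not stable under P, so Ad p (theta Y) is followed inside n_Theta^- plus the
    nonnegative eigenspaces. The two summands are orthogonal for the Cartan form, so the component X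
    is no longer than Ad p (theta Y). What separates them is al(H) > 0 for positive al off Theta,
    which rests on positive roots being sums of simple ones. The point r over xi, and with it p, may
    change with t. It stays in one fiber of RK, so p = g1 k with g1 fixed and k in K, and a single
    constant bounds Ad p (theta Y) for all t. One-parameter subgroups of prescribed velocity serve
    two purposes: they put 1 into K, A and N, and they turn commuting with A into fixing the Lie
    algebra a pointwise. *)

Lemma is_derive_curve (V W : normedModType R) (c : R -> V) (f : V -> W) (t : R) v :
  is_derive t 1 c v -> differentiable f (c t) ->
  is_derive t 1 (f \o c) ('D_v f (c t)).
Proof.
move=> [dc cv] df.
have dc' := (derivable1_diffP _ _).1 dc.
apply: DeriveDef; first exact/derivable1_diffP/differentiable_comp.
rewrite deriveE; last exact: differentiable_comp.
by rewrite diff_comp// !deriveE//= -cv deriveE.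
Qed.

Lemma derive_comp (U V W : normedModType R) (f : U -> V) (g : V -> W) x v :
  differentiable f x -> differentiable g (f x) ->
  'D_v (g \o f) x = 'D_('D_v f x) g (f x).
Proof.
move=> df dg; have dgf := differentiable_comp df dg.
by rewrite (deriveE v dgf) (deriveE v df) (deriveE _ dg) diff_comp.
Qed.

Lemma is_derive_rV (V : normedModType R) n (y : V -> 'rV[R]_n) (t u : V) v :
  is_derive t u y v <->
  forall j, is_derive t u (fun s => y s 0 j : R^o) (v 0 j).
Proof.
split=> [[dy <-] j|h].
  have dj := (derivable_mxP y t u).1 dy 0 j.
  by rewrite derive_mx// mxE; apply: DeriveDef.
have dy : derivable y t u.
  by apply/derivable_mxP => i j; rewrite (ord1 i); have [] := h j.
apply: DeriveDef => //; rewrite derive_mx//; apply/rowP => j.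
by rewrite mxE; have [] := h j.
Qed.

Lemma linear_rV_continuous n (W : normedModType R) (f : {linear 'rV[R]_n -> W}) :
  continuous f.
Proof.
have -> : (f : 'rV[R]_n -> W) = fun x => \sum_j x 0 j *: f (delta_mx 0 j).
  apply/funext => x; rewrite {1}[x]row_sum_delta linear_sum.
  by apply: eq_bigr => j _; rewrite linearZ.
move=> x; apply: differentiable_continuous.
rewrite (_ : (fun _ => _) = \sum_j (fun x : 'rV[R]_n => x 0 j *: f (delta_mx 0 j))); last first.
  by apply/funext => u; rewrite fct_sumE.
apply: differentiable_sum => j; apply: differentiableZl.
exact: differentiable_coord.
Qed.

Lemma linear_rV_differentiable n (W : normedModType R)
  (f : {linear 'rV[R]_n -> W}) x : differentiable f x.
Proof. by apply: linear_differentiable; exact: linear_rV_continuous. Qed.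

Lemma is_derive_linear n (W : normedModType R) (f : {linear 'rV[R]_n -> W})
  (y : R -> 'rV[R]_n) (t : R) v :
  is_derive t 1 y v -> is_derive t 1 (fun s => f (y s)) (f v).
Proof.
move=> dy.
have := is_derive_curve dy (linear_rV_differentiable f (y t)).
rewrite deriveE; last exact: linear_rV_differentiable.
by rewrite diff_lin//; exact: linear_rV_continuous.
Qed.

(** The energy q = |p|^2 (sum of squares) satisfies q' <= K q, so q(s) exp(-K s) does not increase;
    it starts at 0 and q >= 0. All identities below about Ad of an exponential come from this
    uniqueness statement at t = 1. *)
Lemma gronwall_zero n (p : R -> 'rV[R]_n) (N : 'M[R]_n) :
  (forall t : R, is_derive t 1 p (p t *m N)) -> p 0 = 0 -> forall t : R, 0 <= t -> p t = 0.
Proof.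
move=> dp p0 t t0.
pose q := fun s : R => \sum_j (p s 0 j) ^+ 2.
have [nu [nu0 hnu]] : exists nu : R, 0 <= nu /\ forall i j, `|N i j| <= nu.
  exists `|N|; split=> // i j.
  by rewrite [leRHS]/Num.Def.normr/= mx_normrE (le_bigmax _ _ (i, j)).
pose K := 2 * n%:R * nu.
have dq (s : R) : is_derive s 1 q (\sum_j 2 * (p s 0 j) * (p s *m N) 0 j).
  have -> : q = \sum_j (fun s => (p s 0 j : R^o) ^+ 2).
    by apply/funext => u; rewrite fct_sumE.
  apply: is_derive_sum => j.
  have h := ((is_derive_rV _ _ _ _).1 (dp s)) j.
  have h2 := is_deriveM h h.
  rewrite (_ : (fun _ => _) = (fun s : R => p s 0 j : R^o) * (fun s : R => p s 0 j : R^o)); last first.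
    by apply/funext => u; rewrite expr2.
  by apply: (is_derive_eq h2); rewrite /GRing.scale /= -mulrA mulr_natl mulr2n.
have bd (s : R) : \sum_j 2 * (p s 0 j) * (p s *m N) 0 j <= K * q s.
  have -> : K * q s = \sum_j \sum_i nu * ((p s 0 j)^+2 + (p s 0 i)^+2).
    under eq_bigr do rewrite -mulr_sumr big_split /= sumr_const card_ord.
    rewrite -mulr_sumr big_split /= sumrMnl sumr_const card_ord -/(q s).
    by rewrite /K -(mulr_natl (q s) n); ring.
  apply: ler_sum => j _; rewrite mxE mulr_sumr; apply: ler_sum => i _.
  have := hnu i j; rewrite ler_norml => /andP[h1 h2].
  have h3 : 0 <= (p s 0 j + p s 0 i) ^+ 2 by exact: sqr_ge0.
  have h4 : 0 <= (p s 0 j - p s 0 i) ^+ 2 by exact: sqr_ge0.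
  (* Adding the two products gives 2 N_ij p_i p_j <= nu (p_i^2 + p_j^2) for either sign of N_ij;
     summed over all pairs, the right side is 2 n nu q, whence [K]. *)
  have h5 : 0 <= (nu - N i j) * (p s 0 j + p s 0 i) ^+ 2.
    by rewrite mulr_ge0// subr_ge0.
  have h6 : 0 <= (nu + N i j) * (p s 0 j - p s 0 i) ^+ 2.
    by rewrite mulr_ge0// -lerBlDl sub0r.
  lra.
pose h := fun s : R => q s * expR (- K * s).
have dh (s : R) : is_derive s 1 h ((\sum_j 2 * (p s 0 j) * (p s *m N) 0 j) * expR (- K * s) + q s * (- K * expR (- K * s))).
  have de : is_derive s 1 (fun s => expR (- K * s)) (- K * expR (- K * s)).
    have d1 : is_derive s 1 (fun s : R => - K * s) (- K).
      have := @is_deriveZ _ _ _ (id : R -> R^o) (- K) s 1 1 _.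
      by rewrite /GRing.scale /= mulr1; apply.
    have h1 := @is_derive1_comp _ _ _ _ _ _ (is_derive_expR (- K * s)) d1.
    by apply: (is_derive_eq h1); rewrite mulrC.
  have := is_deriveM (dq s) de.
  move=> h1; apply: (is_derive_eq h1); rewrite addrC; congr (_ + _).
  exact: mulrC.
have hle : h t <= h 0.
  apply: (@ler0_derive1_le_cc _ h 0 t) => //.
  - move=> x _; rewrite derive1E (@derive_val _ _ _ _ _ _ _ (dh x)).
    rewrite mulrA -mulrDl pmulr_lle0 ?expR_gt0// mulrN subr_le0 mulrC.
    exact: bd.
  - apply: derivable_within_continuous => x _; exact: (@ex_derive _ _ _ _ _ _ _ (dh x)).
  - by rewrite in_itv /= lexx t0.
  - by rewrite in_itv /= lexx t0.
have q0 : q 0 = 0 by rewrite /q big1// => j _; rewrite p0 mxE expr0n.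
have qt : q t <= 0.
  by move: hle; rewrite /h q0 mul0r pmulr_lle0 ?expR_gt0.
have qt0 : q t == 0 by rewrite eq_le qt sumr_ge0// => j _; exact: sqr_ge0.
move: qt0; rewrite psumr_eq0; last by move=> j _; exact: sqr_ge0.
move=> /allP qz; apply/rowP => j; rewrite mxE.
by apply/eqP; rewrite -sqrf_eq0; apply: qz; rewrite mem_index_enum.
Qed.

(** Write g = f + (g - f): the difference vanishes near x, so it is a little-o perturbation of a
    constant and has differential 0. *)
Lemma near_differentiable (V W : normedModType R) (f g : V -> W) x :
  (\near x, f x = g x) -> differentiable f x -> differentiable g x.
Proof.
move=> fg df.
have -> : g = f + (g - f) by rewrite addrC subrK.
apply: differentiableD => //.
have hx : (g - f) x = 0.
  by rewrite fctE -(nbhs_singleton fg) subrr.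
have c0 : continuous (\0 : {linear V -> W}) by exact: cst_continuous.
have e0 : (g - f) \o shift x = cst ((g - f) x) + (\0 : {linear V -> W}) +o_ 0 id.
  apply/eqaddoP => _/posnumP[e]; near=> y.
  rewrite hx /= !fctE /=.
  have -> : f (y + x) = g (y + x).
    by near: y; have := fg; rewrite (near_shift 0) subr0.
  by rewrite subrr addr0 subr0 normr0 mulr_ge0.
apply/diff_locallyP; rewrite (diff_unique c0 e0); split => //.
Unshelve. all: by end_near. Qed.

Lemma differentiable_rV (V : normedModType R) n (f : V -> 'rV[R]_n) x :
  (forall j, differentiable (fun y => f y 0 j : R^o) x) -> differentiable f x.
Proof.
move=> h; rewrite (_ : f = \sum_j (fun y => (f y 0 j : R) *: delta_mx 0 j)).
  by apply: differentiable_sum => j; exact: differentiableZl.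
by apply/funext => y; rewrite fct_sumE -row_sum_delta.
Qed.

(** In finite dimension b is a combination of products of coordinates, so the scalar product rule
    suffices and continuity of b is automatic. Its use is the Jacobi identity. *)
Lemma is_derive_bilinear (V : normedModType R) n m (b : 'rV[R]_n -> 'rV[R]_n -> 'rV[R]_m)
  (f g : V -> 'rV[R]_n) (x v : V) df dg :
  (forall y, linear (b y)) -> (forall y, linear (b ^~ y)) ->
  is_derive x v f df -> is_derive x v g dg ->
  is_derive x v (fun y => b (f y) (g y)) (b df (g x) + b (f x) dg).
Proof.
move=> bl br Df Dg.
have bE y z : b y z = \sum_i \sum_j (y 0 i * z 0 j) *: b (delta_mx 0 i) (delta_mx 0 j).
  pose bly u := HB.pack_for {linear 'rV[R]_n -> 'rV[R]_m} (b u) (GRing.isLinear.Build _ _ _ _ _ (bl u)).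
  pose bry u := HB.pack_for {linear 'rV[R]_n -> 'rV[R]_m} (b ^~ u) (GRing.isLinear.Build _ _ _ _ _ (br u)).
  rewrite {1}[y]row_sum_delta -[LHS]/(bry z _) linear_sum; apply: eq_bigr => i _.
  rewrite linearZ /= {1}[z]row_sum_delta -[b _ _]/(bly _ _) linear_sum scaler_sumr.
  by apply: eq_bigr => j _; rewrite linearZ /= scalerA.
have -> : (fun y => b (f y) (g y)) = \sum_i \sum_j (fun y => (f y 0 i * g y 0 j) *: b (delta_mx 0 i) (delta_mx 0 j)).
  apply/funext => y; rewrite bE fct_sumE; apply: eq_bigr => i _.
  by rewrite fct_sumE.
rewrite !bE -big_split /=.
apply: is_derive_sum => i; rewrite -big_split /=; apply: is_derive_sum => j.
rewrite -scalerDl.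
have h1 := (is_derive_rV _ _ _ _).1 Df i.
have h2 := (is_derive_rV _ _ _ _).1 Dg j.
have h3 := is_deriveM h1 h2.
apply/is_derive_rV => k.
have := is_deriveZ (b (delta_mx 0 i) (delta_mx 0 j) 0 k) h3.
rewrite (_ : _ \*: _ = (fun s => ((f s 0 i * g s 0 j) *: b (delta_mx 0 i) (delta_mx 0 j)) 0 k : R^o)).
  by move/is_derive_eq; apply; rewrite mxE /GRing.scale /=; ring.
apply/funext => s; rewrite mxE.
by rewrite -[LHS]/(b (delta_mx 0 i) (delta_mx 0 j) 0 k * (f s 0 i * g s 0 j)) mulrC.
Qed.
End Calculus.

(** * The adjoint representation and the bracket *)
Section Lie.
Context {R : realType} {n : nat} {G : topGroupType} (L : lie_group R n G).
Local Notation g_ := 'rV[R]_n.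
Local Notation c0 := (id_chart L).
Local Notation e := (id_coord L).

Lemma chart_ofK (c : chart R n G) x : chart_im c x ->
  chart_dom c (chart_of c x) /\ chart_to c (chart_of c x) = x.
Proof. by move=> [g cg <-]; rewrite chart_toK. Qed.

Lemma chart_to_continuous (c : chart R n G) g :
  chart_dom c g -> {for g, continuous (chart_to c)}.
Proof.
move=> cg; have := @chart_to_cont _ _ _ c.
rewrite (continuous_open_subspace _ (chart_dom_open c)); apply.
exact: mem_set.
Qed.

Lemma chart_of_continuous (c : chart R n G) x :
  chart_im c x -> {for x, continuous (chart_of c)}.
Proof.
move=> cx; have := @chart_of_cont _ _ _ c.
rewrite (continuous_open_subspace _ (@chart_im_open _ _ _ c)); apply.
exact: mem_set.
Qed.

Lemma near_chart_dom (T : topologicalType) (c : chart R n G) (h : T -> G) x :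
  {for x, continuous h} -> chart_dom c (h x) -> \forall y \near x, chart_dom c (h y).
Proof.
move=> ch cx; apply: ch; apply: open_nbhs_nbhs; split => //.
exact: chart_dom_open.
Qed.

Lemma near_chart_im (T : topologicalType) (c : chart R n G) (h : T -> g_) x :
  {for x, continuous h} -> chart_im c (h x) -> \forall y \near x, chart_im c (h y).
Proof.
move=> ch cx; apply: ch; apply: open_nbhs_nbhs; split => //.
exact: chart_im_open.
Qed.

Lemma chart_im_to (c : chart R n G) g : chart_dom c g -> chart_im c (chart_to c g).
Proof. by exists g. Qed.

Lemma chart_im_id : chart_im c0 e.
Proof. exact/chart_im_to/id_chart_dom. Qed.

Lemma id_chart_of_id : chart_of c0 e = 1%g.
Proof. by rewrite /id_coord chart_toK//; exact: id_chart_dom. Qed.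

Lemma mulg_continuous (T : topologicalType) (f h : T -> G) x :
  {for x, continuous f} -> {for x, continuous h} ->
  {for x, continuous (fun y => f y * h y)%g}.
Proof.
move=> cf ch.
apply: (@continuous_comp _ _ _ (fun y => (f y, h y)) (fun p : G * G => (p.1 * p.2)%g)).
  exact: cvg_pair.
exact: (mul_cont L).
Qed.

Lemma mul_chart_differentiable c1 c2 c3 x y :
  atlas L c1 -> atlas L c2 -> atlas L c3 ->
  chart_im c1 x -> chart_im c2 y ->
  chart_dom c3 (chart_of c1 x * chart_of c2 y)%g ->
  differentiable
    (fun p : g_ * g_ => chart_to c3 (chart_of c1 p.1 * chart_of c2 p.2)%g) (x, y).
Proof.
move=> a1 a2 a3 ix iy d3.
by have /(_ 1%N) [+ _] := mul_smooth a1 a2 a3; apply.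
Qed.

(** Smoothness is given only for the product of two chart variables; the constant factor a is fed in
    as a fixed coordinate of a chart around a. *)
Lemma mull_differentiable c2 c3 a y :
  atlas L c2 -> atlas L c3 -> chart_im c2 y -> chart_dom c3 (a * chart_of c2 y)%g ->
  differentiable (fun x => chart_to c3 (a * chart_of c2 x)%g) y.
Proof.
move=> a2 a3 iy d3.
have [c1 a1 d1] := atlas_cover L a.
rewrite (_ : (fun x => _) = (fun p : g_ * g_ => chart_to c3 (chart_of c1 p.1 * chart_of c2 p.2)%g) \o (fun x => (chart_to c1 a, x))).
  apply: differentiable_comp; first exact: differentiable_pair.
  by apply: mul_chart_differentiable => //=; [exact: chart_im_to | rewrite chart_toK].
by apply/funext => x /=; rewrite chart_toK.
Qed.

Lemma mulr_differentiable c1 c3 b x :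
  atlas L c1 -> atlas L c3 -> chart_im c1 x -> chart_dom c3 (chart_of c1 x * b)%g ->
  differentiable (fun x => chart_to c3 (chart_of c1 x * b)%g) x.
Proof.
move=> a1 a3 ix d3.
have [c2 a2 d2] := atlas_cover L b.
rewrite (_ : (fun x => _) = (fun p : g_ * g_ => chart_to c3 (chart_of c1 p.1 * chart_of c2 p.2)%g) \o (fun x => (x, chart_to c2 b))).
  apply: differentiable_comp; first exact: differentiable_pair.
  by apply: mul_chart_differentiable => //=; [exact: chart_im_to | rewrite chart_toK].
by apply/funext => y /=; rewrite chart_toK.
Qed.

Definition chart_conj (g : G) (x : g_) : g_ := chart_to c0 (g * chart_of c0 x * g^-1)%g.

Local Notation conj := chart_conj.

Lemma chart_conj_id g : conj g e = e.
Proof. by rewrite /conj id_chart_of_id mulg1 mulgV. Qed.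

Lemma id_chart_of_continuous : {for e, continuous (chart_of c0)}.
Proof. exact/chart_of_continuous/chart_im_id. Qed.

Lemma near_chart_conj_dom g : \forall x \near e, chart_dom c0 (g * chart_of c0 x * g^-1)%g.
Proof.
apply: near_chart_dom.
  apply: mulg_continuous; last exact: cst_continuous.
  apply: mulg_continuous; first exact: cst_continuous.
  exact: id_chart_of_continuous.
by rewrite id_chart_of_id mulg1 mulgV; exact: id_chart_dom.
Qed.

(** Conjugation factors through a chart around g: left translation by g followed by right
    translation by its inverse. *)
Lemma chart_conj_differentiable g : differentiable (conj g) e.
Proof.
have [c ac dc] := atlas_cover L g.
pose u x := chart_to c (g * chart_of c0 x)%g.
pose w y := chart_to c0 (chart_of c y * g^-1)%g.
apply: (@near_differentiable _ _ _ (w \o u)).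
  have : \forall x \near e, chart_dom c (g * chart_of c0 x)%g.
    apply: near_chart_dom; last by rewrite id_chart_of_id mulg1.
    apply: mulg_continuous; first exact: cst_continuous.
    exact: id_chart_of_continuous.
  by apply: filterS => x dx; rewrite /w /u /= chart_toK.
apply: differentiable_comp.
  apply: mull_differentiable => //; first exact: id_chart_atlas.
    exact: chart_im_id.
  by rewrite id_chart_of_id mulg1.
rewrite /u id_chart_of_id mulg1.
apply: mulr_differentiable => //; first exact: id_chart_atlas.
  exact: chart_im_to.
by rewrite chart_toK// mulgV; exact: id_chart_dom.
Qed.

Lemma Ad_diff g X : Ad L g X = 'd (conj g) e X.
Proof. by rewrite /Ad deriveE//; exact: chart_conj_differentiable. Qed.

Fact Ad_is_linear g : linear (Ad L g).
Proof. by move=> a X Y; rewrite !Ad_diff linearP. Qed.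
HB.instance Definition _ g := GRing.isLinear.Build _ _ _ _ (Ad L g) (Ad_is_linear g).

Lemma AdM g h X : Ad L (g * h)%g X = Ad L g (Ad L h X).
Proof.
rewrite {1}/Ad (@near_eq_derive _ _ _ _ (conj g \o conj h)); last first.
  move: (near_chart_conj_dom h); apply: filterS => x dx.
  by rewrite /conj /= chart_toK// invgM !mulgA.
rewrite derive_comp ?chart_conj_id//; exact: chart_conj_differentiable.
Qed.

Lemma Ad1 X : Ad L 1%g X = X.
Proof.
rewrite /Ad (@near_eq_derive _ _ _ _ id) ?derive_id//.
have : \forall x \near e, chart_im c0 x.
  by apply: near_chart_im => //; exact: chart_im_id.
by apply: filterS => x /chart_ofK[_ h]; rewrite mul1g invg1 mulg1.
Qed.

Lemma AdK g X : Ad L g^-1%g (Ad L g X) = X.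
Proof. by rewrite -AdM mulVg Ad1. Qed.

Definition chart_mul (p : g_ * g_) := chart_to c0 (chart_of c0 p.1 * chart_of c0 p.2)%g.
Local Notation F := chart_mul.

Definition chart_mul_dom := [set p : g_ * g_ | [/\ chart_im c0 p.1, chart_im c0 p.2
          & chart_dom c0 (chart_of c0 p.1 * chart_of c0 p.2)%g]].
Local Notation Om := chart_mul_dom.

Definition chart_inv (x : g_) := chart_to c0 ((chart_of c0 x)^-1)%g.

Local Notation inv := chart_inv.

Lemma chart_mul_dom_near : \forall p \near (e, e), Om p.
Proof.
have c1 : {for (e, e), continuous (fun p : g_ * g_ => p.1)} by exact: cvg_fst.
have c2 : {for (e, e), continuous (fun p : g_ * g_ => p.2)} by exact: cvg_snd.
have h1 := near_chart_im c1 chart_im_id.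
have h2 := near_chart_im c2 chart_im_id.
have h3 : \forall p \near (e, e), chart_dom c0 (chart_of c0 p.1 * chart_of c0 p.2)%g.
  apply: near_chart_dom; last first.
    by rewrite /= id_chart_of_id mulg1; exact: id_chart_dom.
  apply: mulg_continuous.
    by apply: continuous_comp => //; exact: id_chart_of_continuous.
  by apply: continuous_comp => //; exact: id_chart_of_continuous.
by near=> p; split; near: p.
Unshelve. all: by end_near. Qed.

Lemma chart_mul_Ck k : Ck k Om F.
Proof. by have := mul_smooth (id_chart_atlas L) (id_chart_atlas L) (id_chart_atlas L); apply. Qed.

Lemma chart_inv_near : \forall x \near e, chart_im c0 x /\ chart_dom c0 ((chart_of c0 x)^-1)%g.
Proof.
have h1 : \forall x \near e, chart_im c0 x.
  by apply: near_chart_im => //; exact: chart_im_id.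
have h3 : \forall x \near e, chart_dom c0 ((chart_of c0 x)^-1)%g.
  apply: near_chart_dom; last first.
    by rewrite id_chart_of_id invg1; exact: id_chart_dom.
  by apply: continuous_comp; [exact: id_chart_of_continuous | exact: (inv_cont L)].
by near=> x; split; near: x.
Unshelve. all: by end_near. Qed.

Lemma chart_inv_differentiable : differentiable inv e.
Proof.
have /(_ 1%N) [+ _] := inv_smooth (id_chart_atlas L) (id_chart_atlas L).
by apply; exact: nbhs_singleton chart_inv_near.
Qed.

Lemma chart_inv_id : inv e = e.
Proof. by rewrite /inv id_chart_of_id invg1. Qed.

Lemma derive_pairE (U V W : normedModType R) (f : U -> V) (g : U -> W) x v :
  differentiable f x -> differentiable g x ->
  'D_v (fun y => (f y, g y)) x = ('D_v f x, 'D_v g x).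
Proof.
move=> df dg.
by rewrite (deriveE v (differentiable_pair df dg)) diff_pair// (deriveE v df) (deriveE v dg).
Qed.

(** Expanding the direction in basis vectors separates it from the base point; this is needed when
    both vary with x. *)
Lemma derive_row (U : normedModType R) k (f : 'rV[R]_k * U -> g_) p a :
  differentiable f p ->
  'D_(a, 0) f p = \sum_i a 0 i *: 'D_(delta_mx 0 i, 0) f p.
Proof.
move=> df; rewrite deriveE//.
rewrite (_ : (a, 0) = \sum_i a 0 i *: (delta_mx 0 i, 0) :> 'rV[R]_k * U).
  by rewrite linear_sum; apply: eq_bigr => i _; rewrite linearZ /= deriveE.
rewrite {1}(row_sum_delta a) (big_morph (fun x : 'rV[R]_k => (x, 0 : U)) (id1 := 0) (op1 := +%R))//.
  by apply: eq_bigr => i _; congr pair; rewrite scaler0.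
by move=> x y; congr pair; rewrite addr0.
Qed.

(** In the chart, x y x^-1 is F (F (x, y), inv x); differentiating in y at the identity turns Ad
    into two nested directional derivatives of the multiplication. *)
Lemma Ad_chart_near Y : \forall x \near e,
  Ad L (chart_of c0 x) Y = 'D_('D_(0, Y) F (x, e), 0) F (x, inv x).
Proof.
have hc : {for e, continuous (fun x : g_ => (x, e))}.
  by apply: differentiable_continuous; exact: differentiable_pair.
have hi : {for e, continuous (fun x : g_ => (x, inv x))}.
  apply: differentiable_continuous; apply: differentiable_pair => //.
  exact: chart_inv_differentiable.
have h1 : \forall x \near e, Om (x, e) by apply: hc; exact: chart_mul_dom_near.
have h2 : \forall x \near e, Om (x, inv x).
  by apply: hi; rewrite chart_inv_id; exact: chart_mul_dom_near.
near=> x.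
have o1 : Om (x, e) by near: x.
have o2 : Om (x, inv x) by near: x.
have [ix dix] : chart_im c0 x /\ chart_dom c0 ((chart_of c0 x)^-1)%g.
  by near: x; exact: chart_inv_near.
have [xd xK] := chart_ofK ix.
have Fx : F (x, e) = x by rewrite /F /= id_chart_of_id mulg1.
rewrite /Ad (@near_eq_derive _ _ _ _ (F \o (fun y => (F (x, y), inv x)))); last first.
  have : \forall y \near e, chart_dom c0 (chart_of c0 x * chart_of c0 y)%g.
    apply: near_chart_dom; last by rewrite id_chart_of_id mulg1.
    apply: mulg_continuous; first exact: cst_continuous.
    exact: id_chart_of_continuous.
  by apply: filterS => y dy; rewrite /F /inv /= !chart_toK.
have dF2 : differentiable F (x, inv x) by have [+ _] := chart_mul_Ck 1; apply.
have dF1 : differentiable F (x, e) by have [+ _] := chart_mul_Ck 1; apply.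
have dxy : differentiable (fun y : g_ => (x, y)) e by exact: differentiable_pair.
have d1 : differentiable (fun y => F (x, y)) e by exact: (differentiable_comp dxy).
have d2 : differentiable (fun y : g_ => inv x) e by exact: differentiable_cst.
rewrite derive_comp; first last.
- by rewrite Fx.
- exact: differentiable_pair.
have E1 : 'D_Y (fun y => F (x, y)) e = 'D_(0, Y) F (x, e).
  rewrite -[LHS]/('D_Y (F \o (fun y => (x, y))) e) (derive_comp Y dxy dF1).
  congr ('D_ _ F _).
  have did : differentiable (id : g_ -> g_) e by [].
  by rewrite (derive_pairE Y (differentiable_cst x e) did) derive_cst derive_id.
by rewrite Fx (derive_pairE Y d1 d2) E1 derive_cst.
Unshelve. all: by end_near. Qed.

(** The direction of the outer derivative in [Ad_chart_near] moves with x. After [derive_row] each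
    term is a scalar derivative of F times a derivative in a fixed direction, and F being C^2 makes
    both differentiable. This is what makes the bracket an honest differential. *)
Lemma Ad_chart_differentiable Y : differentiable (fun x => Ad L (chart_of c0 x) Y) e.
Proof.
have hc : differentiable (fun x : g_ => (x, e)) e by exact: differentiable_pair.
have hi : differentiable (fun x : g_ => (x, inv x)) e.
  by apply: differentiable_pair => //; exact: chart_inv_differentiable.
have [_ F2] := chart_mul_Ck 2.
have dF v : differentiable (fun p => 'D_v F p) (e, e).
  by have [+ _] := F2 v; apply; exact: nbhs_singleton chart_mul_dom_near.
have d1 : differentiable (fun x => 'D_(0, Y) F (x, e)) e.
  exact: (differentiable_comp hc (dF _)).
have d2 i : differentiable (fun x => 'D_(delta_mx 0 i, 0) F (x, inv x)) e.
  have h : differentiable (fun p => 'D_(delta_mx 0 i, 0) F p) (e, inv e).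
    by rewrite chart_inv_id.
  exact: (differentiable_comp hi h).
have hiN : {for e, continuous (fun x : g_ => (x, inv x))}.
  exact: differentiable_continuous.
apply: (@near_differentiable _ _ _ (fun x => \sum_i ('D_(0, Y) F (x, e)) 0 i *: 'D_(delta_mx 0 i, 0) F (x, inv x))).
  have h2 : \forall x \near e, Om (x, inv x).
    by apply: hiN; rewrite chart_inv_id; exact: chart_mul_dom_near.
  near=> x; rewrite (near (Ad_chart_near Y) x)// derive_row//.
  by have [+ _] := chart_mul_Ck 1; apply; near: x.
apply: differentiable_rV => j.
rewrite (_ : (fun _ => _) = \sum_i ((fun x => 'D_(0, Y) F (x, e) 0 i) * (fun x => 'D_(delta_mx 0 i, 0) F (x, inv x) 0 j))); last first.
  by apply/funext => x; rewrite summxE fct_sumE; apply: eq_bigr => i _; rewrite mxE.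
apply: differentiable_sum => i; apply: differentiableM.
  exact: (differentiable_comp d1 (differentiable_coord _ _ _)).
exact: (differentiable_comp (d2 i) (differentiable_coord _ _ _)).
Unshelve. all: by end_near. Qed.

Lemma bracketE X Y : bracket L X Y = 'd (fun x => Ad L (chart_of c0 x) Y) e X.
Proof. by rewrite /bracket deriveE//; exact: Ad_chart_differentiable. Qed.

Lemma bracket_linearl Y : linear (bracket L ^~ Y).
Proof. by move=> a X Z; rewrite !bracketE linearP. Qed.

Fact bracket_linearr X : linear (bracket L X).
Proof.
move=> a Y Z; rewrite /bracket.
have dA W : derivable (fun x => Ad L (chart_of c0 x) W) e X.
  by apply: diff_derivable; exact: Ad_chart_differentiable.
rewrite (_ : (fun x => Ad L (chart_of c0 x) (a *: Y + Z)) =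
  a \*: (fun x => Ad L (chart_of c0 x) Y) + (fun x => Ad L (chart_of c0 x) Z)); last first.
  by apply/funext => x; rewrite linearP.
by rewrite deriveD ?deriveZ//; exact: derivableZ.
Qed.
HB.instance Definition _ X := GRing.isLinear.Build _ _ _ _ (bracket L X) (bracket_linearr X).

(** Differentiate Ad(g x g^-1) Ad(g) Y = Ad(g) Ad(x) Y in x at the identity, in the direction X. *)
Lemma Ad_bracket g X Y : Ad L g (bracket L X Y) = bracket L (Ad L g X) (Ad L g Y).
Proof.
have dA := Ad_chart_differentiable Y.
have dg : differentiable (fun x => Ad L (chart_of c0 x) (Ad L g Y)) (conj g e).
  by rewrite chart_conj_id; exact: Ad_chart_differentiable.
have dl Z : differentiable (Ad L g) Z by exact: linear_rV_differentiable.
transitivity ('D_X ((fun x => Ad L (chart_of c0 x) (Ad L g Y)) \o conj g) e).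
  rewrite (@near_eq_derive _ _ _ _ (Ad L g \o (fun x => Ad L (chart_of c0 x) Y))).
    rewrite (derive_comp X dA (dl _)) (deriveE _ (dl _)) diff_lin//.
    exact: linear_rV_continuous.
  move: (near_chart_conj_dom g); apply: filterS => x dx.
  by rewrite /= /conj chart_toK// !AdM AdK.
by rewrite (derive_comp X (chart_conj_differentiable g) dg) chart_conj_id.
Qed.

(** The Jacobi identity, obtained by differentiating [Ad_bracket] in g at the identity along Z. *)
Lemma bracket_leibniz Z X Y :
  bracket L Z (bracket L X Y) = bracket L (bracket L Z X) Y + bracket L X (bracket L Z Y).
Proof.
have dA W : is_derive e Z (fun x => Ad L (chart_of c0 x) W) (bracket L Z W).
  by apply: DeriveDef => //; apply: diff_derivable; exact: Ad_chart_differentiable.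
have := is_derive_bilinear bracket_linearr bracket_linearl (dA X) (dA Y).
rewrite id_chart_of_id !Ad1 => -[_ <-].
rewrite -[LHS]/('D_Z (fun x => Ad L (chart_of c0 x) (bracket L X Y)) e).
have -> // : (fun x => Ad L (chart_of c0 x) (bracket L X Y)) =
  (fun x => bracket L (Ad L (chart_of c0 x) X) (Ad L (chart_of c0 x) Y)).
by apply/funext => x; exact: Ad_bracket.
Qed.

Lemma one_parameter0 c X : one_parameter L c X -> c 0 = 1%g.
Proof.
move=> [cD _ _]; have := cD 0 0; rewrite addr0 => h.
by apply: (mulgI (c 0)); rewrite mulg1 -h.
Qed.

(** Since c s = c (s - t) c t, the derivative at t is the derivative at 0 applied to Ad (c t) Y.
    This is the linear differential equation to which [gronwall_zero] applies. *)
Lemma Ad_one_parameter c X Y (t : R) : one_parameter L c X ->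
  is_derive t 1 (fun s => Ad L (c s) Y) (bracket L X (Ad L (c t) Y)).
Proof.
move=> oc; have c0e := one_parameter0 oc; have [cD cc dc] := oc.
have d0 W : is_derive (0 : R) 1 (fun s => Ad L (c s) W) (bracket L X W).
  apply: (@near_eq_is_derive _ _ _ ((fun x => Ad L (chart_of c0 x) W) \o (fun s => chart_to c0 (c s)))).
    have : \forall s \near (0 : R), chart_dom c0 (c s).
      by apply: near_chart_dom; [exact: cc | rewrite c0e; exact: id_chart_dom].
    by apply: filterS => s ds; rewrite /= chart_toK.
  have := is_derive_curve dc; rewrite c0e; apply.
  exact: Ad_chart_differentiable.
have dsh : is_derive t 1 (shift (- t) : R -> R) 1 by exact: is_derive_shift.
have h := d0 (Ad L (c t) Y); rewrite -(subrr t) in h.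
have /derivable1_diffP dh := @ex_derive _ _ _ _ _ _ _ h.
have := is_derive_curve dsh dh; rewrite derive_val.
rewrite (_ : _ \o _ = (fun s => Ad L (c s) Y))//.
by apply/funext => s /=; rewrite -AdM -cD subrK.
Qed.

End Lie.

(** * Existence of one-parameter subgroups *)
Section Exp.
Context {R : realType} {n : nat} {G : topGroupType} (L : lie_group R n G).
Local Notation g_ := 'rV[R]_n.
Local Notation c0 := (id_chart L).
Local Notation e := (id_coord L).
Local Notation F := (chart_mul L).
Local Notation Om := (chart_mul_dom L).
Local Notation inv := (chart_inv L).

Lemma norm_coord_le (x : g_) i : `|x 0 i| <= `|x|.
Proof. by rewrite [leRHS]/Num.Def.normr/= mx_normrE (le_bigmax _ _ (ord0, i)). Qed.

Lemma norm_le_coord (x : g_) (r : R) : 0 <= r -> (forall i, `|x 0 i| <= r) -> `|x| <= r.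
Proof.
move=> r0 h; rewrite [leLHS]/Num.Def.normr/= mx_normrE; apply: bigmax_le => //.
by move=> [i j] _ /=; rewrite (ord1 i).
Qed.

Lemma is_derive_affine (a v : g_) (s : R) : is_derive s 1 (fun s : R => a + s *: v) v.
Proof.
apply/is_derive_rV => j.
have h := is_deriveD (is_derive_cst (a 0 j : R^o) s 1) (is_deriveZ (v 0 j) (is_derive_id s 1)).
rewrite (_ : (fun _ => _) = cst (a 0 j : R^o) + (v 0 j) \*: (id : R -> R^o)).
  by apply: (is_derive_eq h); rewrite add0r /GRing.scale /= mulr1.
by apply/funext => u; rewrite !mxE -[RHS]/(a 0 j + v 0 j * u) mulrC.
Qed.

(** Near the identity the group law is addition up to a small relative error. As F (e, y) = y, the
    differential of F in its second variable is the identity at (e, e), hence nearly so in a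
    neighborhood; the mean value theorem along the segment from e to y concludes. *)
Lemma chart_mul_estimate (eta : R) : 0 < eta -> exists2 d : R, 0 < d &
  forall x y, `|x - e| < d -> `|y - e| < d ->
    Om (x, y) /\ `|F (x, y) - x - (y - e)| <= eta * `|y - e|.
Proof.
move=> eta0.
have [dF dDF] := chart_mul_Ck L 1.
have Fe y : chart_im c0 y -> F (e, y) = y.
  by move=> iy; rewrite /chart_mul /= id_chart_of_id mul1g; have [_ ->] := chart_ofK iy.
have De (j : 'I_n) : 'D_(0, delta_mx 0 j) F (e, e) = delta_mx 0 j.
  have dxy : differentiable (fun y : g_ => (e, y)) e by exact: differentiable_pair.
  have did : differentiable (id : g_ -> g_) e by [].
  have dFe : differentiable F (e, e) by apply: dF; exact: nbhs_singleton (chart_mul_dom_near L).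
  transitivity ('D_(delta_mx 0 j) (F \o (fun y => (e, y))) e).
    rewrite (derive_comp _ dxy dFe); congr ('D_ _ F _).
    by rewrite (derive_pairE _ (differentiable_cst e e) did) derive_cst derive_id.
  rewrite (@near_eq_derive _ _ _ _ id) ?derive_id//.
  have : \forall x \near e, chart_im c0 x.
    by apply: near_chart_im => //; exact: chart_im_id.
  by apply: filterS => y iy /=; rewrite Fe.
(* The final sum has n terms, each at most eps |y - e|; the successor avoids a division by 0 when n
   = 0. *)
pose eps := eta / n.+1%:R.
have eps0 : 0 < eps by rewrite divr_gt0.
have hD : \forall p \near (e, e), Om p /\ forall j : 'I_n, `|delta_mx 0 j - 'D_(0, delta_mx 0 j) F p| <= eps.
  apply: filterI; first exact: chart_mul_dom_near.
  have hj (j : 'I_n) : \forall p \near (e, e), `|delta_mx 0 j - 'D_(0, delta_mx 0 j) F p| <= eps; last first.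
    exact: (@filter_forall _ _ (fun j p => `|delta_mx 0 j - 'D_(0, delta_mx 0 j) F p| <= eps) _ _ hj).
  have := dDF (0, delta_mx 0 j) (e, e) (nbhs_singleton (chart_mul_dom_near L)).
  by move/cvgrPdist_le => /(_ _ eps0); rewrite De.
have /nbhs_ballP[d /= d0 hd] := hD.
exists d => // x y xd yd.
have bxy z : `|z - e| < d -> Om (x, z) /\ forall j : 'I_n, `|delta_mx 0 j - 'D_(0, delta_mx 0 j) F (x, z)| <= eps.
  by move=> zd; apply: hd; split; rewrite -ball_normE /= distrC.
split; first by have [] := bxy y yd.
apply: norm_le_coord => [|i]; first by rewrite mulr_ge0// ltW.
pose seg (s : R) : g_ := e + s *: (y - e).
have segd (s : R) : 0 <= s <= 1 -> `|seg s - e| < d.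
  move=> /andP[s0 s1]; rewrite /seg addrC addKr normrZ ger0_norm//.
  by apply: le_lt_trans yd; rewrite ler_piMl.
(* As F (x, e) = x, the increment of phi over [0, 1] is the i-th coordinate of the error to be
   bounded. *)
pose phi (s : R) : R := (F (x, seg s) - s *: (y - e)) 0 i.
pose dphi (s : R) : R := ('D_(0, y - e) F (x, seg s) - (y - e)) 0 i.
have dseg (s : R) : is_derive s 1 seg (y - e).
  exact: is_derive_affine.
have dphiE (s : R) : 0 <= s <= 1 -> is_derive s 1 phi (dphi s).
  move=> s01; have [os _] := bxy _ (segd s s01).
  have dp : is_derive s 1 (fun s => (x, seg s)) (0, y - e).
    have dd : differentiable seg s.
      by apply/derivable1_diffP; exact: (@ex_derive _ _ _ _ _ _ _ (dseg s)).
    apply: DeriveDef.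
      by apply/derivable1_diffP; exact: differentiable_pair.
    rewrite (derive_pairE _ (differentiable_cst x s) dd) derive_cst.
    by rewrite (@derive_val _ _ _ _ _ _ _ (dseg s)).
  have h1 := is_derive_curve dp (dF _ os).
  have h2 : is_derive s 1 (fun s => s *: (y - e)) (y - e).
    have := is_derive_affine 0 (y - e) s.
    by rewrite (_ : (fun _ => _) = (fun s => s *: (y - e)))//; apply/funext => u; rewrite add0r.
  exact: ((is_derive_rV _ _ _ _).1 (is_deriveB h1 h2)).
have [s s01 phiE] : exists2 s, s \in `]0, 1[ & phi 1 - phi 0 = dphi s * (1 - 0).
  apply: MVT => //.
    by move=> s; rewrite in_itv /= => /andP[s0 s1]; apply: dphiE; rewrite !ltW.
  apply: derivable_within_continuous => s; rewrite in_itv /= => s01.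
  exact: (@ex_derive _ _ _ _ _ _ _ (dphiE s s01)).
move: s01; rewrite in_itv /= => /andP[s0 s1].
have s01 : 0 <= s <= 1 by rewrite !ltW.
have -> : (F (x, y) - x - (y - e)) 0 i = dphi s.
  move: phiE; rewrite subr0 mulr1 => <-.
  rewrite /phi /seg !scale1r !scale0r addr0 subr0.
  rewrite (_ : e + (y - e) = y) ?subrKC//.
  have -> : F (x, e) = x.
    rewrite /chart_mul /= id_chart_of_id mulg1.
    have [[ix _ _] _] := bxy y yd.
    by have [_ ->] := chart_ofK ix.
  by rewrite !mxE; ring.
have [os hs] := bxy _ (segd s s01).
rewrite /dphi deriveE; last exact: dF.
have E : (0, y - e) = \sum_j (y - e) 0 j *: ((0 : g_), (delta_mx 0 j : g_)).
  rewrite {1}(row_sum_delta (y - e)) (big_morph (fun z : g_ => (0 : g_, z)) (id1 := 0) (op1 := +%R))//.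
    by apply: eq_bigr => j _; congr pair; rewrite scaler0.
  by move=> u v; congr pair; rewrite addr0.
rewrite E linear_sum {2}(row_sum_delta (y - e)) -sumrB summxE.
apply: (le_trans (ler_norm_sum _ _ _)).
apply: (@le_trans _ _ (\sum_(j < n) eps * `|y - e|)).
  apply: ler_sum => j _.
  rewrite linearZ /= -scalerBr mxE normrM mulrC; apply: ler_pM => //.
    apply: le_trans (hs j); rewrite distrC; apply: le_trans (norm_coord_le _ i).
    by rewrite deriveE//; exact: dF.
  exact: norm_coord_le.
rewrite sumr_const card_ord -mulrnAl ler_wpM2r// -mulr_natr /eps -mulrA ler_piMr// ?ltW//.
by rewrite mulrC ltr_pdivrMr// mul1r ltr_nat.
Qed.

(** Each further factor g adds an error of at most eta |p|, where p is the displacement of g from e.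
    The assumption keeps the main term and the accumulated error, together (1 + eta) j |p|, inside
    the ball of [chart_mul_estimate]; the successor leaves room for g itself. *)
Lemma chart_pow_estimate (eta : R) : 0 < eta -> exists2 d : R, 0 < d &
  forall g j, chart_dom c0 g -> (1 + eta) * (j.+1%:R * `|chart_to c0 g - e|) < d ->
    chart_dom c0 (g ^+ j)%g /\
    `|chart_to c0 (g ^+ j)%g - e - j%:R *: (chart_to c0 g - e)| <=
      eta * (j%:R * `|chart_to c0 g - e|).
Proof.
move=> eta0; have [d d0 hd] := chart_mul_estimate eta0.
exists d => // g j dg; set p := chart_to c0 g - e.
elim: j => [_|j IH hj].
  by rewrite expg0 scale0r subr0 mul0r mulr0 subrr normr0; split => //; exact: id_chart_dom.
have eta1 : 0 < 1 + eta by rewrite addr_gt0.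
have [dj ej] : chart_dom c0 (g ^+ j)%g /\ `|chart_to c0 (g ^+ j)%g - e - j%:R *: p| <= eta * (j%:R * `|p|).
  apply: IH; apply: le_lt_trans hj; rewrite ler_pM2l// ler_wpM2r// ler_nat.
  by [].
have xd : `|chart_to c0 (g ^+ j)%g - e| < d.
  apply: le_lt_trans hj; rewrite mulrDl mul1r.
  rewrite -[X in `|X|](subrK (j%:R *: p)).
  apply: (le_trans (ler_normD _ _)); rewrite addrC normrZ normr_nat.
  apply: lerD; first by rewrite ler_wpM2r// ler_nat -addn2 leq_addr.
  by apply: (le_trans ej); rewrite ler_pM2l// ler_wpM2r// ler_nat -addn2 leq_addr.
have yd : `|chart_to c0 g - e| < d.
  apply: le_lt_trans hj; rewrite -/p -[leLHS]mul1r mulrA ler_wpM2r//.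
  rewrite -[leLHS]mulr1; apply: ler_pM => //; first by rewrite lerDl ltW.
  by rewrite ler1n.
have [[ix iy dxy] hxy] := hd _ _ xd yd.
move: dxy hxy; rewrite /chart_mul /= !chart_toK// -expgSr => dxy hxy.
split => //.
have -> : chart_to c0 (g ^+ j.+1)%g - e - j.+1%:R *: p =
  (chart_to c0 (g ^+ j.+1)%g - chart_to c0 (g ^+ j)%g - p) + (chart_to c0 (g ^+ j)%g - e - j%:R *: p).
  by rewrite -natr1 scalerDl scale1r; apply/rowP => i; rewrite !mxE; ring.
apply: (le_trans (ler_normD _ _)).
by rewrite -natr1 mulrDl mul1r mulrDr [leRHS]addrC; exact: lerD.
Qed.

Lemma ultra_cluster_cvg (I : Type) (T : topologicalType) (U : set_system I) (f : I -> T) x :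
  UltraFilter U -> cluster (f @ U) x -> f @ U --> x.
Proof.
move=> uU cx V nV; have [//|UV] := in_ultra_setVsetC (f @^-1` V) uU.
by have [y [+ Vy]] := cx (~` V) V UV nV.
Qed.

Lemma mulg_cvg (I : Type) (U : set_system I) (f h : I -> G) a b : Filter U ->
  f @ U --> a -> h @ U --> b -> (f i * h i)%g @[i --> U] --> (a * b)%g.
Proof.
move=> FU fa hb.
apply: (@cvg_comp _ _ _ (fun i => (f i, h i)) (fun p : G * G => (p.1 * p.2)%g) U (nbhs (a, b))).
  exact: cvg_pair.
exact: (@mul_cont _ _ _ L (a, b)).
Qed.

(** * One-parameter subgroups as ultrafilter limits of dyadic powers *)

Section Generator.
Variables (X : g_) (U : set_system nat).
Hypotheses (uU : UltraFilter U) (Uoo : \oo `<=` U).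
Let pU : ProperFilter U := @ultra_proper _ _ uU.
Local Existing Instance pU.

Definition dyadic k : G := chart_of c0 (e + 2^-1 ^+ k *: X).

Lemma half_cvg : (2^-1 : R) ^+ k @[k --> \oo] --> (0 : R).
Proof. by apply: cvg_expr; rewrite ger0_norm// invf_lt1// ltr1n. Qed.

Lemma dyadic_coord_cvg : e + (2^-1 : R) ^+ k *: X @[k --> \oo] --> e.
Proof.
rewrite -[X in _ --> X]addr0 -(scale0r X).
by apply: cvgD; [exact: cvg_cst | apply: cvgZr_tmp; exact: half_cvg].
Qed.

Lemma dyadic_cvg : dyadic k @[k --> U] --> 1%g.
Proof.
move=> V; rewrite -(id_chart_of_id L) => nV; apply: Uoo.
exact: (dyadic_coord_cvg (id_chart_of_continuous nV)).
Qed.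

Lemma near_dyadic_im : \forall k \near \oo, chart_im c0 (e + 2^-1 ^+ k *: X).
Proof.
apply: dyadic_coord_cvg; apply: open_nbhs_nbhs; split; last exact: chart_im_id.
exact: chart_im_open.
Qed.

Definition step (t : R) k : G := (dyadic k ^+ Num.truncn (t * 2 ^+ k))%g.

(** For small t the powers stay in a compact ball of the chart, where the ultrafilter converges to a
    cluster point; this replaces a Cauchy estimate. The bound of [chart_pow_estimate] passes to the
    limit. *)
Lemma step_small (eta : R) : 0 < eta -> exists2 d : R, 0 < d &
  forall t : R, 0 <= t -> t < d -> exists x,
    [/\ chart_im c0 x, step t @ U --> chart_of c0 x & `|x - e - t *: X| <= eta * (t * `|X|)].
Proof.
move=> eta0; have [d d0 hd] := chart_pow_estimate eta0.
have eta1 : 0 < 1 + eta by rewrite addr_gt0.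
have : \forall x \near e, chart_im c0 x.
  by apply: near_chart_im => //; exact: chart_im_id.
move=> /nbhs_ballP[r /= r0 hr].
have X1 : 0 < `|X| + 1 by rewrite ltr_wpDl.
(* The factor 2 keeps the j-th power within d / 2, the other half being reserved for the extra
   factor in [j.+1]; the summand 1 makes M positive when X = 0. *)
pose M := 2 * (1 + eta) * (`|X| + 1).
have M0 : 0 < M by rewrite !mulr_gt0.
exists (Num.min d r / M); first by rewrite divr_gt0// lt_min d0 r0.
move=> t t0; rewrite ltr_pdivlMr// lt_min => /andP[td tr].
have tM (q : R) : t * M < q -> (1 + eta) * (t * `|X|) < q / 2.
  move=> h; rewrite ltr_pdivlMr//; apply: le_lt_trans h.
  rewrite /M [leRHS](_ : _ = (1 + eta) * (t * (`|X| + 1)) * 2); last by ring.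
  by rewrite ler_pM2r// ler_pM2l// ler_wpM2l// lerDl.
have hk : \forall k \near \oo, (1 + eta) * ((2^-1 : R) ^+ k * `|X|) < d / 2.
  have : (1 + eta) * ((2^-1 : R) ^+ k * `|X|) @[k --> \oo] --> (1 + eta) * (0 * `|X|).
    by apply: cvgMr; apply: cvgMl; exact: half_cvg.
  rewrite mul0r mulr0 => /cvgr_lt; apply; exact: divr_gt0.
have main : \forall k \near \oo, [/\ chart_dom c0 (step t k),
    `|chart_to c0 (step t k) - e - t *: X| <= eta * (t * `|X|) + 2^-1 ^+ k * `|X|
  & `|chart_to c0 (step t k) - e| < r / 2].
  near=> k.
  have ik : chart_im c0 (e + 2^-1 ^+ k *: X) by near: k; exact: near_dyadic_im.
  have dk : (1 + eta) * ((2^-1 : R) ^+ k * `|X|) < d / 2 by near: k.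
  have [gd gE] := chart_ofK ik.
  set j := Num.truncn (t * 2 ^+ k).
  have /andP[jl jr] : j%:R <= t * 2 ^+ k < j.+1%:R.
    by apply: truncn_itv; rewrite mulr_ge0// exprn_ge0.
  have p0 : 0 < (2^-1 : R) ^+ k by rewrite exprn_gt0.
  have pK : (2 : R) ^+ k * 2^-1 ^+ k = 1 by rewrite -exprMn divff// expr1n.
  have jl' : j%:R * 2^-1 ^+ k <= t.
    by have := ler_wpM2r (ltW p0) jl; rewrite -mulrA pK mulr1.
  have jr' : t <= j%:R * 2^-1 ^+ k + 2^-1 ^+ k.
    have := ler_wpM2r (ltW p0) (ltW jr); rewrite -mulrA pK mulr1.
    by rewrite -natr1 mulrDl mul1r.
  have gp : chart_to c0 (dyadic k) - e = 2^-1 ^+ k *: X.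
    by rewrite /dyadic gE addrC addKr.
  have np : `|chart_to c0 (dyadic k) - e| = 2^-1 ^+ k * `|X|.
    by rewrite gp normrZ gtr0_norm.
  have jt : j%:R * (2^-1 ^+ k * `|X|) <= t * `|X|.
    by rewrite mulrA ler_wpM2r.
  have hj : (1 + eta) * (j.+1%:R * `|chart_to c0 (dyadic k) - e|) < d.
    rewrite np (_ : _ * (j.+1%:R * _) = (1 + eta) * (j%:R * (2^-1 ^+ k * `|X|)) + (1 + eta) * (2^-1 ^+ k * `|X|)); last first.
      by rewrite -natr1; ring.
    rewrite [ltRHS]splitr.
    apply: ltrD => //; apply: le_lt_trans (tM _ td).
    by rewrite ler_pM2l.
  have [dj ej] := hd _ _ gd hj.
  rewrite np in ej.
  have ej' : `|chart_to c0 (step t k) - e - (j%:R * 2^-1 ^+ k) *: X| <= eta * (t * `|X|).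
    move: ej; rewrite gp scalerA => /le_trans; apply.
    by rewrite ler_pM2l.
  split => //.
    rewrite (_ : _ - t *: X = (chart_to c0 (step t k) - e - (j%:R * 2^-1 ^+ k) *: X) - (t - j%:R * 2^-1 ^+ k) *: X); last first.
      by rewrite scalerBl opprB addrA subrK.
    apply: (le_trans (ler_normB _ _)); apply: lerD => //.
    rewrite normrZ ler_wpM2r// ger0_norm ?subr_ge0//.
    by rewrite lerBlDl.
  apply: le_lt_trans (tM _ tr).
  rewrite -[X in `|X|](subrK ((j%:R * 2^-1 ^+ k) *: X)).
  apply: (le_trans (ler_normD _ _)); rewrite mulrDl mul1r addrC; apply: lerD => //.
  rewrite normrZ ger0_norm; first by rewrite ler_wpM2r.
  by rewrite mulr_ge0// ltW.
(* Radius r / 2, so that this closed ball lies in the open ball of radius r contained in the image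
   of the chart. *)
pose A : set g_ := [set x | `|x - e| <= r / 2].
have cA : compact A.
  apply: bounded_closed_compact.
    exists (`|e| + r); split; first exact: num_real.
    move=> y ry x /= Ax.
    rewrite -(subrK e x); apply: (le_trans (ler_normD _ _)).
    rewrite addrC; apply: le_trans (ltW ry); rewrite lerD2l.
    by apply: (le_trans Ax); rewrite ler_pdivrMr// ler_peMr ?ltW// ltr1n.
  rewrite (_ : A = (fun x : g_ => `|x - e|) @^-1` [set y | y <= r / 2])//.
  apply: closed_comp; last exact: closed_le.
  move=> x _; apply: (@continuous_comp _ _ _ (fun x : g_ => x - e) (fun x : g_ => `|x|)).
    exact: (cvgB (@cvg_id _ (nbhs x)) (cvg_cst e)).
  exact: norm_continuous.
have [x [Ax cx]] : A `&` cluster ((chart_to c0 \o step t) @ U) !=set0.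
  apply: cA; apply: Uoo; move: main; apply: filterS => k [_ _ h].
  exact: ltW.
have cvx : (chart_to c0 \o step t) @ U --> x by exact: ultra_cluster_cvg.
have ix : chart_im c0 x.
  apply: hr; rewrite -ball_normE /= distrC; apply: le_lt_trans Ax _.
  by rewrite ltr_pdivrMr// ltr_pMr// ltr1n.
exists x; split => //.
  have h1 : (chart_of c0 \o (chart_to c0 \o step t)) @ U --> chart_of c0 x.
    exact: (cvg_comp _ _ cvx (chart_of_continuous ix)).
  apply: cvg_trans h1; apply: near_eq_cvg; apply: Uoo.
  by move: main; apply: filterS => k [dk _ _]; rewrite /= chart_toK.
apply/ler_addgt0Pr => eps eps0.
have h1 : \forall k \near U, `|x - chart_to c0 (step t k)| <= eps / 2.
  by move/cvgrPdist_le : cvx; apply; exact: divr_gt0.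
have h2 : \forall k \near U, (2^-1 : R) ^+ k * `|X| < eps / 2.
  apply: Uoo; have : ((2^-1 : R) ^+ k * `|X|) @[k --> \oo] --> (0 * `|X|).
    by apply: cvgMl; exact: half_cvg.
  by rewrite mul0r => /cvgr_lt; apply; exact: divr_gt0.
have [k [[k1 k2] [_ k3 _]]] := filter_ex (filterI (filterI h1 h2) (Uoo main)).
rewrite (_ : x - e - t *: X = (x - chart_to c0 (step t k)) + (chart_to c0 (step t k) - e - t *: X)); last first.
  by rewrite !addrA subrK.
apply: (le_trans (ler_normD _ _)); rewrite [eps]splitr addrC addrA.
apply: lerD => //; apply: (le_trans k3).
by rewrite lerD2l ltW.
Unshelve. all: by end_near. Qed.

(** The integer part of (s + t) 2^k exceeds the sum of the two integer parts by 0 or 1. The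
    correcting factor is thus 1 or [dyadic k], and both tend to 1. *)
Lemma step_add (s t : R) g h : 0 <= s -> 0 <= t ->
  step s @ U --> g -> step t @ U --> h -> step (s + t) @ U --> (g * h)%g.
Proof.
move=> s0 t0 sg th.
pose r k := if Num.truncn ((s + t) * 2 ^+ k) == (Num.truncn (s * 2 ^+ k) + Num.truncn (t * 2 ^+ k))%N
  then 1%g else dyadic k.
have r1 : r @ U --> 1%g.
  move=> V nV; change (U (r @^-1` V)).
  have : U (dyadic @^-1` V) := dyadic_cvg nV.
  apply: filterS => k; rewrite /= /r.
  by case: ifP => // _ _; exact: nbhs_singleton.
have -> : step (s + t) = fun k => (step s k * step t k * r k)%g.
  apply/funext => k; rewrite /step /r -expgnDr; case: eqP => [->|ne]; first by rewrite mulg1.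
  rewrite -expgSr; congr (_ ^+ _)%g.
  have p0 (u : R) : 0 <= u -> 0 <= u * 2 ^+ k by move=> u0; rewrite mulr_ge0// exprn_ge0.
  have /andP[a1 a2] := truncn_itv (p0 _ s0).
  have /andP[b1 b2] := truncn_itv (p0 _ t0).
  apply: truncn_def; move: ne a1 a2 b1 b2.
  set a := Num.truncn (s * _); set b := Num.truncn (t * _) => ne a1 a2 b1 b2.
  rewrite mulrDl; apply/andP; split; last first.
    apply: lt_le_trans (ltrD a2 b2) _.
    by rewrite -natrD ler_nat addSn addnS.
  rewrite leNgt; apply/negP => lt1; apply: ne.
  apply: truncn_def; rewrite mulrDl; apply/andP; split => //.
  by rewrite natrD; exact: lerD.
rewrite -[(g * h)%g]mulg1; apply: mulg_cvg => //; exact: mulg_cvg.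
Qed.

Lemma step0 : step 0 @ U --> 1%g.
Proof.
rewrite (_ : step 0 = cst 1%g); first exact: cvg_cst.
by apply/funext => k; rewrite /step mul0r truncn0 expg0.
Qed.

(** Cut t into N pieces short enough for [step_small] and reassemble them with [step_add]. *)
Lemma step_ex (t : R) : 0 <= t -> exists g : G, step t @ U --> g.
Proof.
move=> t0; have [d d0 hd] := step_small ltr01.
pose N := (Num.truncn (t / d)).+1.
have Nd : t / N%:R < d.
  rewrite ltr_pdivrMr ?ltr0n// -ltr_pdivrMl// mulrC.
  by have /andP[] := @truncn_itv _ (t / d) (divr_ge0 t0 (ltW d0)).
have tN0 : 0 <= t / N%:R by rewrite divr_ge0.
have [x [_ xs _]] := hd _ tN0 Nd.
have h i : exists g : G, step (i%:R * (t / N%:R)) @ U --> g.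
  elim: i => [|i [g hg]]; first by exists 1%g; rewrite mul0r; exact: step0.
  exists (g * chart_of c0 x)%g; rewrite -natr1 mulrDl mul1r.
  by apply: step_add => //; rewrite mulr_ge0.
have [g hg] := h N; exists g.
by rewrite mulrC divfK ?pnatr_eq0// in hg.
Qed.

Definition halfexp (t : R) : G := xget 1%g [set g | step t @ U --> g].

Lemma halfexpP (t : R) : 0 <= t -> step t @ U --> halfexp t.
Proof. by move=> /step_ex h; rewrite /halfexp; exact: (xgetPex 1%g h). Qed.

Lemma halfexp_unique (t : R) g : 0 <= t -> step t @ U --> g -> halfexp t = g.
Proof.
by move=> t0 tg; apply: (cvg_unique (lie_hausdorff L) (halfexpP t0) tg).
Qed.

Lemma halfexpD (s t : R) : 0 <= s -> 0 <= t -> halfexp (s + t) = (halfexp s * halfexp t)%g.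
Proof.
move=> s0 t0; apply: halfexp_unique; first exact: addr_ge0.
by apply: step_add => //; exact: halfexpP.
Qed.

Lemma halfexp0 : halfexp 0 = 1%g.
Proof. by apply: halfexp_unique => //; exact: step0. Qed.

Lemma halfexp_small (eta : R) : 0 < eta -> exists2 d : R, 0 < d &
  forall t : R, 0 <= t -> t < d -> chart_dom c0 (halfexp t) /\
    `|chart_to c0 (halfexp t) - e - t *: X| <= eta * (t * `|X|).
Proof.
move=> /step_small[d d0 hd]; exists d => // t t0 td.
have [x [ix xs hx]] := hd _ t0 td.
by rewrite (halfexp_unique t0 xs); have [xd ->] := chart_ofK ix.
Qed.

Lemma halfexpC (s t : R) : 0 <= s -> 0 <= t -> (halfexp s * halfexp t = halfexp t * halfexp s)%g.
Proof. by move=> s0 t0; rewrite -!halfexpD// addrC. Qed.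

Lemma halfexpVC (s t : R) : 0 <= s -> 0 <= t ->
  ((halfexp s)^-1 * halfexp t = halfexp t * (halfexp s)^-1)%g.
Proof.
move=> s0 t0; apply: (mulgI (halfexp s)); rewrite mulgA mulgV mul1g mulgA.
by rewrite halfexpC// mulgK.
Qed.

Lemma halfexp_quot (a b a' b' : R) : 0 <= a -> 0 <= b -> 0 <= a' -> 0 <= b' ->
  a + b' = a' + b -> (halfexp a * (halfexp b)^-1 = halfexp a' * (halfexp b')^-1)%g.
Proof.
move=> a0 b0 a'0 b'0 E; apply: (mulIg (halfexp b)); rewrite mulgVK.
rewrite -mulgA halfexpVC// mulgA -halfexpD// -E halfexpD//.
by rewrite mulgK.
Qed.

(** A quotient of [halfexp] at two nonnegative times with difference t. One formula then covers both
    signs, and additivity follows from [halfexp_quot] without a case analysis. *)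
Definition expcurve (t : R) : G := (halfexp (`|t| + t) * (halfexp `|t|)^-1)%g.

Let nt0 (t : R) : 0 <= `|t| + t.
Proof. by rewrite -lerBlDr sub0r -normrN ler_norm. Qed.

Lemma expcurveD (s t : R) : expcurve (s + t) = (expcurve s * expcurve t)%g.
Proof.
have [s0 t0] := (nt0 s, nt0 t).
have [s1 t1] : 0 <= `|s| /\ 0 <= `|t| by [].
rewrite /expcurve (@halfexp_quot _ _ ((`|s| + s) + (`|t| + t)) (`|t| + `|s|))//; first last.
- by ring.
- exact: addr_ge0.
rewrite (halfexpD s0 t0) (halfexpD t1 s1) invgM !mulgA; congr (_ * _)%g.
by rewrite -!mulgA halfexpVC.
Qed.

Lemma expcurve_ge0 (t : R) : 0 <= t -> expcurve t = halfexp t.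
Proof.
by move=> t0; rewrite /expcurve ger0_norm// halfexpD// mulgK.
Qed.

Lemma expcurve_lt0 (t : R) : t <= 0 -> expcurve t = (halfexp (- t))^-1%g.
Proof.
by move=> t0; rewrite /expcurve ler0_norm// addNr halfexp0 mul1g.
Qed.

(** For t < 0 the point is the inverse of y = [halfexp] (-t). Applying the product estimate to inv y
    and y, whose product is 1, shows that inv y - e is close to -(y - e). *)
Lemma expcurve_small (eta : R) : 0 < eta -> eta <= 1 -> exists2 d : R, 0 < d &
  forall t : R, `|t| < d -> chart_dom c0 (expcurve t) /\
    `|chart_to c0 (expcurve t) - e - t *: X| <= 3 * eta * (`|t| * `|X|).
Proof.
move=> eta0 eta1.
have [d1 d10 h1] := halfexp_small eta0.
have [d2 d20 h2] := chart_mul_estimate eta0.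
have : \forall y \near e, [/\ chart_im c0 y, chart_dom c0 ((chart_of c0 y)^-1)%g, `|inv y - e| < d2 & `|y - e| < d2].
  have ci : {for e, continuous inv} by exact/differentiable_continuous/chart_inv_differentiable.
  have n1 : \forall y \near e, `|inv y - e| < d2.
    move/cvgrPdist_lt : ci => /(_ _ d20); rewrite chart_inv_id.
    by apply: filterS => y; rewrite distrC.
  have n2 : \forall y \near e, `|y - e| < d2.
    apply/nbhs_ballP; exists d2 => // y; rewrite -ball_normE /= distrC.
    by [].
  near=> y.
  have [? ?] : chart_im c0 y /\ chart_dom c0 ((chart_of c0 y)^-1)%g.
    by near: y; exact: chart_inv_near.
  by split => //; near: y.
move=> /nbhs_ballP[r /= r0 hr].
have X1 : 0 < 2 * (`|X| + 1) by rewrite mulr_gt0// ltr_wpDl.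
exists (Num.min d1 (r / (2 * (`|X| + 1)))); first by rewrite lt_min d10 divr_gt0.
move=> t; rewrite lt_min => /andP[td1]; rewrite ltr_pdivlMr// => tr.
have etaX : eta * (`|t| * `|X|) <= 3 * eta * (`|t| * `|X|).
  by rewrite -mulrA ler_peMl ?ler1n// mulr_ge0 ?mulr_ge0// ltW.
have [t0|t0] := lerP 0 t.
  rewrite expcurve_ge0//; rewrite ger0_norm// in td1 etaX *.
  have [dt ht] := h1 _ t0 td1; split => //; exact: le_trans ht etaX.
rewrite expcurve_lt0; last exact: ltW.
rewrite (ltr0_norm t0) in td1 tr etaX *.
set s := - t in td1 tr etaX *.
have s0 : 0 <= s by rewrite /s oppr_ge0 ltW.
have [ds hs] := h1 _ s0 td1.
set y := chart_to c0 (halfexp s) in hs.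
have ye : `|y - e| <= 2 * (s * `|X|).
  rewrite -[X in `|X|](subrK (s *: X)); apply: (le_trans (ler_normD _ _)).
  rewrite normrZ ger0_norm// mulr2n mulrDl mul1r lerD2r.
  by apply: (le_trans hs); rewrite ler_piMl// mulr_ge0.
have [iy dy xd yd] : [/\ chart_im c0 y, chart_dom c0 ((chart_of c0 y)^-1)%g, `|inv y - e| < d2 & `|y - e| < d2].
  apply: hr; rewrite -ball_normE /= distrC; apply: le_lt_trans ye _.
  apply: le_lt_trans tr; rewrite mulrCA; apply: ler_wpM2l => //.
  by rewrite ler_pM2l// lerDl.
have yK : chart_of c0 y = halfexp s by rewrite /y chart_toK.
rewrite yK in dy; split => //.
have [_] := h2 _ _ xd yd.
rewrite /chart_mul /= /chart_inv yK chart_toK// mulVg -/e => h3.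
have -> : chart_to c0 (halfexp s)^-1%g - e - t *: X =
   - (e - chart_to c0 (halfexp s)^-1%g - (y - e)) - (y - e - s *: X).
  by rewrite /s scaleNr; apply/rowP => i; rewrite !mxE; ring.
apply: (le_trans (ler_normB _ _)); rewrite normrN.
(* The constant 3 is 2 + 1: the product estimate costs eta |y - e|, at most 2 eta s |X| because eta
   <= 1, and [halfexp_small] costs eta s |X|. *)
rewrite (_ : 3 * eta * (s * `|X|) = eta * (2 * (s * `|X|)) + eta * (s * `|X|)); last by ring.
apply: lerD => //; apply: (le_trans h3).
by rewrite ler_pM2l.
Unshelve. all: by end_near. Qed.

(** The velocity at 0 is read off [expcurve_small] with eta of order eps / |X|. Continuity at 0
    follows through the chart and is carried to every t by the group law. *)
Lemma expcurve_one_parameter : one_parameter L expcurve X.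
Proof.
have c00 : expcurve 0 = 1%g by rewrite expcurve_ge0// halfexp0.
have dc : is_derive (0 : R) 1 (fun t => chart_to c0 (expcurve t)) X.
  suff h : (fun h : R => h^-1 *: (((fun t => chart_to c0 (expcurve t)) \o shift 0) (h *: 1) - chart_to c0 (expcurve 0))) @ 0^' --> X.
    by apply: DeriveDef; [apply/cvg_ex; exists X | exact: cvg_lim h].
  apply/cvgrPdist_le => eps eps0.
  have X1 : 0 < 3 * (`|X| + 1) by rewrite mulr_gt0// ltr_wpDl.
  pose eta := Num.min 1 (eps / (3 * (`|X| + 1))).
  have eta0 : 0 < eta by rewrite lt_min ltr01 divr_gt0.
  have eta1 : eta <= 1 by rewrite ge_min lexx.
  have [d d0 hd] := expcurve_small eta0 eta1.
  near=> h.
  have h0 : h != 0 by near: h; exact: nbhs_dnbhs_neq.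
  have hd' : `|h| < d by near: h; exact: dnbhs0_lt.
  have [_ hh] := hd _ hd'.
  rewrite c00 /= addr0 [h *: 1]mulr1 -/e -[X in X - _](scalerK h0) -scalerBr normrZ normfV.
  rewrite ler_pdivrMl ?normr_gt0// distrC.
  apply: (le_trans hh); rewrite mulrCA ler_wpM2l//.
  have : eta <= eps / (3 * (`|X| + 1)) by rewrite ge_min lexx orbT.
  rewrite ler_pdivlMr// => /(le_trans _); apply.
  rewrite mulrC mulrA mulrC ler_wpM2l ?ltW//.
  by rewrite mulrC ltr_pM2l// ltrDl.
split => //; first exact: expcurveD.
have cont0 : expcurve @ (0 : R) --> 1%g.
  have cf : {for (0 : R), continuous (fun t => chart_to c0 (expcurve t))}.
    apply: differentiable_continuous; apply/derivable1_diffP.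
    exact: (@ex_derive _ _ _ _ _ _ _ dc).
  have h1 : (chart_of c0 \o (fun t => chart_to c0 (expcurve t))) @ (0 : R) --> (1%g : G).
    have cf' : (fun t => chart_to c0 (expcurve t)) @ (0 : R) --> e.
      by move: cf; rewrite /prop_for /continuous_at c00.
    rewrite -(id_chart_of_id L).
    have h : {for e, continuous (chart_of c0)} by exact: id_chart_of_continuous.
    exact: (@cvg_comp _ _ _ (fun t => chart_to c0 (expcurve t)) (chart_of c0) _ (nbhs e) _ cf' h).
  have [d d0 hd] := expcurve_small ltr01 (lexx _).
  have nb : \forall t \near (0 : R), chart_dom c0 (expcurve t).
    apply/nbhs_ballP; exists d => // t; rewrite /ball /= sub0r normrN => td.
    by have [] := hd _ td.
  apply: cvg_trans h1; apply: near_eq_cvg; move: nb; apply: filterS => t dt.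
  by rewrite /= chart_toK.
move=> t.
have -> : expcurve = fun s => (expcurve t * expcurve (s - t))%g.
  by apply/funext => s; rewrite -expcurveD addrC subrK.
rewrite /continuous_at subrr c00.
apply: mulg_cvg; first exact: cvg_cst.
have ct : (fun s : R => s - t) @ (t : R) --> (0 : R).
  rewrite -[X in _ --> X](subrr t).
  exact: (cvgB (@cvg_id _ (nbhs (t : R))) (cvg_cst t)).
exact: (cvg_comp _ _ ct cont0).
Unshelve. all: by end_near. Qed.

End Generator.

Lemma one_parameter_exists X : exists c, one_parameter L c X.
Proof.
have [U [uU Uoo]] := ultraFilterLemma eventually_filter.
exists (expcurve X U); exact: expcurve_one_parameter.
Qed.

End Exp.

(** * Exponentials, the Killing form and the Cartan norm *)
Definition lin_closed (R : realType) n (W : set 'rV[R]_n) :=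
  W 0 /\ forall a x y, W x -> W y -> W (a *: x + y).

Section LinClosed.
Context {R : realType} {n : nat}.
Local Notation g_ := 'rV[R]_n.
Implicit Type W : set g_.

Lemma lin_closedD W x y : lin_closed W -> W x -> W y -> W (x + y).
Proof. by move=> [_ h] Wx Wy; rewrite -[x]scale1r; exact: h. Qed.

Lemma lin_closedZ W a x : lin_closed W -> W x -> W (a *: x).
Proof. by move=> [h0 h] Wx; rewrite -[_ *: _]addr0; exact: h. Qed.

(** A subspace of maximal dimension inside W exhausts W, since adjoining a missing vector of W would
    enlarge it. This lets sets such as [root_sum] be projected along. *)
Lemma lin_closed_vspace W : lin_closed W -> exists V : {vspace g_}, forall x, x \in V <-> W x.
Proof.
move=> lW; pose P k := `[< exists2 V : {vspace g_}, \dim V = k & forall x, x \in V -> W x >].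
have exP : exists k, P k.
  exists 0%N; apply/asboolP; exists 0%VS; first by rewrite dimv0.
  by move=> x; rewrite memv0 => /eqP ->; case: lW.
have ubP k : P k -> (k <= \dim {:g_})%N.
  by move=> /asboolP[V <- _]; exact/dimvS/subvf.
have [k /asboolP[V dV VW] kmax] := ex_maxnP exP ubP.
exists V => x; split; first exact: VW.
move=> Wx; apply/negP => /negP xV.
have /kmax : P (\dim (V + <[x]>)).
  apply/asboolP; exists (V + <[x]>)%VS => // y /memv_addP[u uV [v /vlineP[a ->] ->]].
  by rewrite addrC; case: lW => _; apply => //; exact: VW.
rewrite -dV => h; case/negP: xV.
have /eqP -> : V == (V + <[x]>)%VS.
  by rewrite eqEdim addvSl.
by rewrite memvE addvSr.
Qed.

(** The sums carry no coefficients; closure under scaling has to come from S. *)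
Definition span_set (S : set g_) : set g_ :=
  [set X | exists2 s : seq g_, (forall x, x \in s -> S x) & X = \sum_(x <- s) x].

Lemma span_set_incl S x : S x -> span_set S x.
Proof.
move=> Sx; exists [:: x]; last by rewrite big_seq1.
by move=> y; rewrite inE => /eqP ->.
Qed.

Lemma span_set_min S W : lin_closed W -> (forall x, S x -> W x) -> forall x, span_set S x -> W x.
Proof.
move=> lW SW x [s ss ->]; rewrite big_seq; apply: big_ind => [|y z|y ys].
- by case: lW.
- exact: lin_closedD.
- exact/SW/ss.
Qed.

Lemma span_set_closed S : (forall a x, S x -> S (a *: x)) -> lin_closed (span_set S).
Proof.
move=> SZ; split; first by exists [::]; rewrite ?big_nil.
move=> a x y [s ss ->] [u us ->].
exists ([seq a *: z | z <- s] ++ u).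
  by move=> z; rewrite mem_cat => /orP[/mapP[w /ss Sw ->]|/us//]; exact: SZ.
by rewrite big_cat /= big_map scaler_sumr.
Qed.

Lemma lin_closed_preim W m (f : {linear 'rV[R]_m -> g_}) : lin_closed W ->
  lin_closed [set x | W (f x)].
Proof.
move=> [W0 Wl]; split => [|a x y /= Wx Wy] /=; first by rewrite linear0.
by rewrite linearP; exact: Wl.
Qed.

Lemma span_set_map S W (f : {linear g_ -> g_}) : lin_closed W ->
  (forall x, S x -> W (f x)) -> forall x, span_set S x -> W (f x).
Proof. by move=> lW h; exact: (@span_set_min S [set x | W (f x)] (lin_closed_preim f lW) h). Qed.

End LinClosed.

Section OneParameter.
Context {R : realType} {n : nat} {G : topGroupType} (L : lie_group R n G).
Local Notation g_ := 'rV[R]_n.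
Local Notation c0 := (id_chart L).
Local Notation e := (id_coord L).

Lemma one_parameter_scale c X (k : R) : one_parameter L c X ->
  one_parameter L (fun s => c (k * s)) (k *: X).
Proof.
move=> [cD cc dc]; split.
- by move=> s t; rewrite mulrDr cD.
- by move=> t; apply: continuous_comp; [exact: mulrl_continuous | exact: cc].
have dk : is_derive (0 : R) (1 : R) (fun s : R => k * s : R^o) k.
  have h := is_deriveZ k (is_derive_id (0 : R) 1).
  by apply: (is_derive_eq h); rewrite /GRing.scale /= mulr1.
have df : differentiable (fun t : R => chart_to c0 (c t)) (k * 0).
  rewrite mulr0; apply/derivable1_diffP.
  exact: (@ex_derive _ _ _ _ _ _ _ dc).
have := is_derive_curve dk df; rewrite mulr0 => h.
apply: (is_derive_eq h); rewrite mulr0 in df.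
rewrite deriveE// -{1}[k]mulr1 -[k * 1]/(k *: (1 : R^o)) linearZ /= -deriveE//.
by rewrite (@derive_val _ _ _ _ _ _ _ dc).
Qed.

Lemma is_exp_curve c X (k : R) : one_parameter L c X -> is_exp L (k *: X) (c k).
Proof.
move=> oc; exists (fun s => c (k * s)); first exact: one_parameter_scale.
by rewrite mulr1.
Qed.

Lemma is_exp0 : is_exp L 0 1%g.
Proof.
have [c oc] := one_parameter_exists L 0.
by have := is_exp_curve 0 oc; rewrite scale0r (one_parameter0 oc).
Qed.

Lemma is_expN X h : is_exp L X h -> is_exp L (- X) h^-1%g.
Proof.
move=> [c oc ->]; have := is_exp_curve (-1) oc; rewrite scaleN1r.
have [cD _ _] := oc.
rewrite (_ : c (-1) = (c 1%R)^-1%g)//.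
by apply: (mulgI (c 1)); rewrite -cD subrr mulgV (one_parameter0 oc).
Qed.

(** Conjugation by m fixes the curve c pointwise, so its differential fixes the velocity of c at
    0. *)
Lemma Ad_commutant m c X : one_parameter L c X ->
  (forall t, (m * c t = c t * m)%g) -> Ad L m X = X.
Proof.
move=> oc cm; have [cD cc dc] := oc.
have c0e := one_parameter0 oc.
have df : differentiable (chart_conj L m) (chart_to c0 (c 0)).
  by rewrite c0e; exact: chart_conj_differentiable.
have h1 := is_derive_curve dc df.
have h2 : is_derive (0 : R) 1 (fun t => chart_to c0 (c t)) ('D_X (chart_conj L m) (chart_to c0 (c 0))).
  apply: near_eq_is_derive h1.
  have : \forall s \near (0 : R), chart_dom c0 (c s).
    by apply: near_chart_dom; [exact: cc | rewrite c0e; exact: id_chart_dom].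
  apply: filterS => s ds; rewrite /= /chart_conj chart_toK//.
  by rewrite cm mulgK.
have := @derive_val _ _ _ _ _ _ _ h2; rewrite (@derive_val _ _ _ _ _ _ _ dc) c0e.
by move=> {2}->.
Qed.

(** At the identity this is differentiability in the chart; at g, write Ad h as Ad g applied to Ad
    (g^-1 h). *)
Lemma Ad_continuous Y : continuous (fun g => Ad L g Y).
Proof.
move=> g.
have -> : (fun h => Ad L h Y) = (fun h => Ad L g (Ad L (g^-1 * h)%g Y)).
  by apply/funext => h; rewrite -AdM mulgA mulgV mul1g.
have c1 : {for (1%g : G), continuous (fun h => Ad L h Y)}.
  have cc : {for (1%g : G), continuous (chart_to c0)}.
    exact/chart_to_continuous/id_chart_dom.
  have ca : {for chart_to c0 (1%g : G), continuous (fun x => Ad L (chart_of c0 x) Y)}.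
    exact/differentiable_continuous/Ad_chart_differentiable.
  have h1 := @continuous_comp _ _ _ (chart_to c0) (fun x => Ad L (chart_of c0 x) Y) _ cc ca.
  have h2 : (fun x => Ad L (chart_of c0 x) Y) \o chart_to c0 @ (1%g : G) --> Ad L (chart_of c0 (chart_to c0 (1%g : G))) Y by exact: h1.
  rewrite chart_toK in h2; last exact: id_chart_dom.
  rewrite /prop_for /continuous_at; apply: cvg_trans h2; apply: near_eq_cvg.
  have : \forall h \near (1%g : G), chart_dom c0 h.
    by apply: open_nbhs_nbhs; split; [exact: chart_dom_open | exact: id_chart_dom].
  by apply: filterS => h dh; rewrite /= chart_toK.
apply: (@continuous_comp _ _ _ (fun h => Ad L (g^-1 * h)%g Y) (Ad L g)); last first.
  exact: linear_rV_continuous.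
apply: (@continuous_comp _ _ _ (fun h => (g^-1 * h)%g) (fun h => Ad L h Y)); last first.
  by rewrite mulVg.
by apply: (mulg_continuous L); [exact: cst_continuous | exact: cvg_id].
Qed.

End OneParameter.

(* [brk] and [adj] are [bracket] and [Ad] behind an opaque equality: the
   unifier must never unfold these limits. *)
Section Seal.
Context {R : realType} {n : nat} {G : topGroupType} (L : lie_group R n G).
Local Notation g_ := 'rV[R]_n.

Lemma bracket_seal : {f : g_ -> g_ -> g_ | bracket L = f}.
Proof. by exists (bracket L). Qed.

Definition brk : g_ -> g_ -> g_ := proj1_sig bracket_seal.

Lemma brkE : bracket L = brk.
Proof. exact: (proj2_sig bracket_seal). Qed.

Lemma Ad_seal : {f : G -> g_ -> g_ | Ad L = f}.
Proof. by exists (Ad L). Qed.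

Definition adj : G -> g_ -> g_ := proj1_sig Ad_seal.

Lemma adjE : Ad L = adj.
Proof. exact: (proj2_sig Ad_seal). Qed.

Lemma killing_seal : {f : g_ -> g_ -> R | killing L = f}.
Proof. by exists (killing L). Qed.

Definition kil : g_ -> g_ -> R := proj1_sig killing_seal.

Lemma kilE : killing L = kil.
Proof. exact: (proj2_sig killing_seal). Qed.

Fact adj_is_linear g : linear (adj g).
Proof. by rewrite -adjE; exact: Ad_is_linear. Qed.
HB.instance Definition _ g := GRing.isLinear.Build _ _ _ _ (adj g) (adj_is_linear g).

Fact brk_is_linear X : linear (brk X).
Proof. by rewrite -brkE; exact: bracket_linearr. Qed.
HB.instance Definition _ X := GRing.isLinear.Build _ _ _ _ (brk X) (brk_is_linear X).

Lemma brk_linearl Y : linear (brk ^~ Y).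
Proof. by rewrite -brkE; exact: bracket_linearl. Qed.

Lemma adjM g h X : adj (g * h)%g X = adj g (adj h X).
Proof. by rewrite -adjE AdM. Qed.

Lemma adj1 X : adj 1%g X = X.
Proof. by rewrite -adjE Ad1. Qed.

Lemma adjK g X : adj g^-1%g (adj g X) = X.
Proof. by rewrite -adjM mulVg adj1. Qed.

Lemma adjVK g X : adj g (adj g^-1%g X) = X.
Proof. by rewrite -adjM mulgV adj1. Qed.

Lemma adj_brk g X Y : adj g (brk X Y) = brk (adj g X) (adj g Y).
Proof. by rewrite -adjE -brkE Ad_bracket. Qed.

Lemma brk_leibniz Z X Y : brk Z (brk X Y) = brk (brk Z X) Y + brk X (brk Z Y).
Proof. by rewrite -brkE bracket_leibniz. Qed.

Lemma adj_one_parameter c X Y (t : R) : one_parameter L c X ->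
  is_derive t 1 (fun s => adj (c s) Y) (brk X (adj (c t) Y)).
Proof. by rewrite -adjE -brkE; exact: Ad_one_parameter. Qed.

Lemma adj_commutant m c X : one_parameter L c X ->
  (forall t, (m * c t = c t * m)%g) -> adj m X = X.
Proof. by rewrite -adjE; exact: Ad_commutant. Qed.

Lemma adj_continuous Y : continuous (fun g => adj g Y).
Proof. by rewrite -adjE; exact: Ad_continuous. Qed.

Lemma kilE_trace X Y : kil X Y = \tr (lin1_mx (fun Z => brk X (brk Y Z))).
Proof. by rewrite -kilE -brkE. Qed.

End Seal.

Section AdExp.
Context {R : realType} {n : nat} {G : topGroupType} (L : lie_group R n G).
Local Notation g_ := 'rV[R]_n.
Local Notation c0 := (id_chart L).
Local Notation e := (id_coord L).

Lemma bracket0l Y : brk L 0 Y = 0.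
Proof. by have := brk_linearl L Y 1 0 0; rewrite scaler0 addr0 scale1r => /(congr1 (fun z => z - brk L 0 Y)); rewrite subrr addrK. Qed.

Lemma bracketDl Y X Z : brk L (X + Z) Y = brk L X Y + brk L Z Y.
Proof. by have := brk_linearl L Y 1 X Z; rewrite !scale1r. Qed.

Lemma bracketZl Y a X : brk L (a *: X) Y = a *: brk L X Y.
Proof. by have := brk_linearl L Y a X 0; rewrite !addr0 bracket0l addr0. Qed.

Lemma bracketNl Y X : brk L (- X) Y = - brk L X Y.
Proof. by have := bracketZl Y (-1) X; rewrite !scaleN1r. Qed.

Lemma bracketBr X Y Z : brk L X (Y - Z) = brk L X Y - brk L X Z.
Proof. exact: linearB. Qed.

Lemma is_derive_sub_cst (f : R -> g_) (t : R) a df :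
  is_derive t 1 f df -> is_derive t 1 (fun s => f s - a) df.
Proof.
move=> h; have := is_deriveB h (is_derive_cst a t 1); rewrite subr0.
by [].
Qed.

(* Modulo [W] the curve [Ad (exp tX) Y - Y] solves a homogeneous linear
   differential equation with zero initial value. *)
Lemma Ad_exp_sub (W : set g_) X Y h : is_exp L X h -> lin_closed W ->
  (forall Z, W Z -> W (brk L X Z)) -> W (brk L X Y) -> W (adj L h Y - Y).
Proof.
move=> [c oc ->] /lin_closed_vspace[V VW] WX WY.
(* The map q has kernel exactly V, so working modulo W means applying q; as ad X preserves V, it
   descends through q, which is the content of [qb]. *)
have [q [r [qE rV qV]]] : exists (q : {linear g_ -> g_}) (r : g_ -> g_),
    [/\ forall x, q x = x - r x, forall x, r x \in V & forall x, x \in V -> q x = 0].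
  pose q : 'End(g_) := (\1%VF - projv V)%VF.
  have qE x : q x = x - projv V x by rewrite /q add_lfunE opp_lfunE id_lfunE.
  exists q, (projv V); split => // x; first exact: memv_proj.
  by move=> xV; have := qE x; rewrite projv_id// subrr.
have q0 x : q x = 0 -> x \in V by rewrite qE => /subr0_eq ->.
have qB u v : q (u - v) = q u - q v by exact: linearB.
have qb x : q (brk L X x) = q (brk L X (q x)).
  have qr : q (brk L X (r x)) = 0 by exact/qV/VW/WX/VW.
  by rewrite (qE x) bracketBr qB qr subr0.
apply/VW/q0.
pose N := lin1_mx (q \o brk L X).
pose p := fun t : R => q (adj L (c t) Y - Y).
rewrite -[LHS]/(p 1); apply: (@gronwall_zero _ _ p N) => //; last first.
  by rewrite /p (one_parameter0 oc) adj1 subrr linear0.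
move=> t; have dA := is_derive_sub_cst Y (adj_one_parameter Y t oc).
have dp := is_derive_linear q dA.
apply: (is_derive_eq dp); rewrite /N mul_rV_lin1 /= /p -qb linearB /= [RHS]linearB /=.
by rewrite [q (brk L X Y)]qV ?subr0//; exact/VW.
Qed.

Lemma Ad_exp_stable (W : set g_) X Y h : is_exp L X h -> lin_closed W ->
  (forall Z, W Z -> W (brk L X Z)) -> W Y -> W (adj L h Y).
Proof.
move=> eX lW WX WY; rewrite -(subrK Y (adj L h Y)); apply: lin_closedD => //.
by apply: (Ad_exp_sub eX) => //; exact: WX.
Qed.

Lemma Ad_exp_fix X Y h : is_exp L X h -> brk L X Y = 0 -> adj L h Y = Y.
Proof.
move=> eX XY; have := @Ad_exp_sub [set 0] X Y h eX; move=> h1.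
have lc : lin_closed [set (0 : g_)].
  by split => // a x y /= -> ->; rewrite scaler0 addr0.
have st Z : [set 0] Z -> [set 0] (brk L X Z) by move=> /= ->; rewrite linear0.
exact/subr0_eq/(h1 lc st XY).
Qed.

(** Ad (c t) Y and exp(t a) Y solve the same linear equation with the same initial value. *)
Lemma Ad_exp_eigen X Y h (a : R) : is_exp L X h -> brk L X Y = a *: Y ->
  adj L h Y = expR a *: Y.
Proof.
move=> [c oc ->] XY; apply/subr0_eq.
pose p := fun t : R => adj L (c t) Y - expR (t * a) *: Y.
have : p 1 = 0; last by rewrite /p mul1r.
apply: (@gronwall_zero _ _ p (lin1_mx (brk L X))) => //; last first.
  by rewrite /p (one_parameter0 oc) adj1 mul0r expR0 scale1r subrr.
move=> t; rewrite mul_rV_lin1 /p linearB /= linearZ /= XY.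
have dE : is_derive t 1 (fun t : R => expR (t * a) *: Y) ((expR (t * a) * a) *: Y).
  apply/is_derive_rV => j.
  have d1 : is_derive t 1 (fun t : R => t * a : R^o) a.
    have h1 := is_deriveZ a (is_derive_id (t : R) 1).
    rewrite (_ : (fun _ => _) = a \*: (id : R -> R^o)).
      by apply: (is_derive_eq h1); rewrite /GRing.scale /= mulr1.
    by apply/funext => u; rewrite mulrC.
  have h2 := @is_derive1_comp _ expR (fun t : R => t * a) t _ _ (is_derive_expR (t * a)) d1.
  have h3 := is_deriveZ (Y 0 j) h2.
  rewrite (_ : (fun _ => _) = (Y 0 j) \*: (expR \o (fun t : R => t * a)) :> (R -> R^o)).
    apply: (is_derive_eq h3); rewrite [RHS]mxE.
    by rewrite -[LHS]/(Y 0 j * (expR (t * a) * a)) mulrC.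
  by apply/funext => u; rewrite [LHS]mxE mulrC.
have h1 := is_deriveB (adj_one_parameter Y t oc) dE.
by apply: (is_derive_eq h1); rewrite scalerA.
Qed.

(** With theta for [th] this makes Ad of K commute with theta, hence preserve the Cartan form. Both
    sides solve the equation of ad X because X is fixed by [th]. *)
Lemma Ad_exp_commute X h (th : {linear g_ -> g_}) :
  (forall Y Z, th (brk L Y Z) = brk L (th Y) (th Z)) -> th X = X ->
  is_exp L X h -> forall Y, adj L h (th Y) = th (adj L h Y).
Proof.
move=> thb thX [c oc ->] Y; apply/subr0_eq.
pose p := fun t : R => adj L (c t) (th Y) - th (adj L (c t) Y).
rewrite -[LHS]/(p 1).
apply: (@gronwall_zero _ _ p (lin1_mx (brk L X))) => //; last first.
  by rewrite /p (one_parameter0 oc) !adj1 subrr.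
move=> t; rewrite mul_rV_lin1 /p linearB /=.
have h2 := is_derive_linear th (adj_one_parameter Y t oc).
have h1 := is_deriveB (adj_one_parameter (th Y) t oc) h2.
by apply: (is_derive_eq h1); rewrite thb thX.
Qed.

Lemma mulrow_inj (A B : 'M[R]_n) : (forall v : g_, v *m A = v *m B) -> A = B.
Proof. by move=> h; apply/row_matrixP => i; rewrite !rowE h. Qed.

Lemma adm_exists : exists f : g_ -> 'M[R]_n, forall X Y, Y *m f X = brk L X Y.
Proof. by exists (fun X => lin1_mx (brk L X)) => X Y; rewrite mul_rV_lin1. Qed.

(** Matrices act on row vectors from the right, so ad X after ad Y is [adm Y *m adm X]. *)
Definition adm : g_ -> 'M[R]_n := projT1 (cid adm_exists).

Lemma mul_adm X Y : Y *m adm X = brk L X Y.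
Proof. exact: (projT2 (cid adm_exists)). Qed.

Lemma admP a X Y : adm (a *: X + Y) = a *: adm X + adm Y.
Proof.
apply: mulrow_inj => v.
rewrite mulmxDr -scalemxAr.
rewrite (mul_adm X v).
rewrite (mul_adm Y v).
rewrite mul_adm.
by rewrite bracketDl bracketZl.
Qed.

Lemma killing_adm X Y : kil L X Y = \tr (adm Y *m adm X).
Proof.
rewrite kilE_trace; congr mxtrace; apply: mulrow_inj => v.
rewrite mulmxA !mul_adm.
by rewrite -[lin1_mx _]/(lin1_mx (brk L X \o brk L Y)) mul_rV_lin1.
Qed.

Lemma killingC X Y : kil L X Y = kil L Y X.
Proof.
rewrite (killing_adm X Y).
rewrite (killing_adm Y X).
exact: mxtrace_mulC.
Qed.

Lemma killing_linearr X a Y Z : kil L X (a *: Y + Z) = a * kil L X Y + kil L X Z.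
Proof. by rewrite !killing_adm admP mulmxDl -scalemxAl mxtraceD mxtraceZ. Qed.

Lemma killingNr X Y : kil L X (- Y) = - kil L X Y.
Proof.
have k0 : kil L X 0 = 0.
  by have := killing_linearr X (-1) 0 0; rewrite scaler0 addr0 mulN1r addNr.
by have := killing_linearr X (-1) Y 0; rewrite addr0 scaleN1r k0 addr0 mulN1r.
Qed.

Lemma killing_linearl X a Y Z : kil L (a *: Y + Z) X = a * kil L Y X + kil L Z X.
Proof. by rewrite !(killingC _ X) killing_linearr. Qed.

(** An automorphism f conjugates ad Z into ad (f Z), and the trace is invariant under conjugation.
    Applied to Ad g and to theta. *)
Lemma killing_automorphism (f h : {linear g_ -> g_}) X Y : cancel f h -> cancel h f ->
  (forall Y Z, f (brk L Y Z) = brk L (f Y) (f Z)) ->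
  kil L (f X) (f Y) = kil L X Y.
Proof.
move=> fK hK fb.
have E Z : adm (f Z) = lin1_mx h *m adm Z *m lin1_mx f.
  apply: mulrow_inj => v.
  by rewrite !mulmxA mul_adm mul_rV_lin1 mul_adm mul_rV_lin1 fb hK.
have fh : lin1_mx f *m lin1_mx h = 1%:M.
  by apply: mulrow_inj => v; rewrite mulmxA !mul_rV_lin1 mulmx1 fK.
rewrite !killing_adm !E !mulmxA mxtrace_mulC !mulmxA fh mul1mx.
by rewrite -(mulmxA _ (lin1_mx f)) fh mulmx1.
Qed.

Lemma killing_Ad g X Y : kil L (adj L g X) (adj L g Y) = kil L X Y.
Proof.
apply: (@killing_automorphism (adj L g) (adj L g^-1%g)).
- by move=> Z; exact: adjK.
- by move=> Z; exact: adjVK.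
- by move=> U V; exact: adj_brk.
Qed.

Lemma killing_ad Z X Y : kil L (brk L Z X) Y = - kil L X (brk L Z Y).
Proof.
have E U V : adm (brk L U V) = adm V *m adm U - adm U *m adm V.
  apply: mulrow_inj => v; rewrite mulmxBr !mulmxA !mul_adm.
  by rewrite brk_leibniz addrK.
rewrite (killing_adm _ Y) (killing_adm X) !E.
move: (adm X) (adm Y) (adm Z) => A B C; rewrite mulmxBr mulmxBl !raddfB /=.
by rewrite opprK [RHS]addrC !mulmxA (mxtrace_mulC (B *m A)) mulmxA.
Qed.

(** * The inner product B_theta and its norm *)

Section CartanForm.
Variables (theta : 'End(g_)) (thetaP : cartan_involution L theta).
Definition cform (X Y : g_) : R := - kil L X (theta Y).
Local Notation b := cform.

Lemma cformE : cartan_form L theta = cform.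
Proof. by apply/funext => X; apply/funext => Y; rewrite /cform -kilE. Qed.

Lemma theta_bracket X Y : theta (brk L X Y) = brk L (theta X) (theta Y).
Proof. by rewrite -brkE; case: thetaP. Qed.

Lemma thetaK X : theta (theta X) = X.
Proof. by case: thetaP. Qed.

Lemma killing_theta X Y : kil L (theta X) (theta Y) = kil L X Y.
Proof.
apply: (@killing_automorphism theta theta) => //; first exact: thetaK.
- exact: thetaK.
- exact: theta_bracket.
Qed.

Lemma cformC X Y : b X Y = b Y X.
Proof. by rewrite /cform -(killing_theta X) thetaK killingC. Qed.

Lemma cform_linearl Y a X Z : b (a *: X + Z) Y = a * b X Y + b Z Y.
Proof. by rewrite /cform killing_linearl opprD mulrN. Qed.

Lemma cform_linearr Y a X Z : b Y (a *: X + Z) = a * b Y X + b Y Z.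
Proof. by rewrite !(cformC Y) cform_linearl. Qed.

Lemma cform0l Y : b 0 Y = 0.
Proof. by have := cform_linearl Y (-1) 0 0; rewrite scaler0 addr0 mulN1r addNr. Qed.

Lemma cform0r Y : b Y 0 = 0.
Proof. by rewrite cformC cform0l. Qed.

Lemma cformDl Y X Z : b (X + Z) Y = b X Y + b Z Y.
Proof. by have := cform_linearl Y 1 X Z; rewrite scale1r mul1r. Qed.

Lemma cformDr Y X Z : b Y (X + Z) = b Y X + b Y Z.
Proof. by rewrite !(cformC Y) cformDl. Qed.

Lemma cformZl Y a X : b (a *: X) Y = a * b X Y.
Proof. by have := cform_linearl Y a X 0; rewrite addr0 cform0l addr0. Qed.

Lemma cformZr Y a X : b Y (a *: X) = a * b Y X.
Proof. by rewrite !(cformC Y) cformZl. Qed.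

Lemma cform_gt0 X : X != 0 -> 0 < b X X.
Proof. by rewrite -cformE; case: thetaP => _ _; apply. Qed.

Lemma cform_ge0 X : 0 <= b X X.
Proof. by have [->|/cform_gt0/ltW//] := eqVneq X 0; rewrite cform0l. Qed.

Lemma killing_cform X Y : kil L X Y = - b X (theta Y).
Proof. by rewrite /cform thetaK opprK. Qed.

(** Elements of s act by symmetric operators; this gives the orthogonality of eigenvectors of ad H
    in [cform_eig]. *)
Lemma cform_ad Z X Y : theta Z = - Z -> b (brk L Z X) Y = b X (brk L Z Y).
Proof.
move=> tZ; rewrite /cform killing_ad theta_bracket tZ.
by rewrite bracketNl killingNr.
Qed.

Lemma cform_Ad_exp X h Y Z : theta X = X -> is_exp L X h -> b (adj L h Y) (adj L h Z) = b Y Z.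
Proof.
move=> tX eX; rewrite /cform -(Ad_exp_commute theta_bracket tX eX).
by rewrite killing_Ad.
Qed.

Definition cnorm X := Num.sqrt (b X X).

Lemma cnorm_ge0 X : 0 <= cnorm X.
Proof. exact: sqrtr_ge0. Qed.

Lemma cnorm_sqr X : cnorm X ^+ 2 = b X X.
Proof. by rewrite sqr_sqrtr// cform_ge0. Qed.

Lemma cnormZ a X : cnorm (a *: X) = `|a| * cnorm X.
Proof.
by rewrite /cnorm cformZl cformZr mulrA -expr2 sqrtrM ?sqr_ge0// sqrtr_sqr.
Qed.

Lemma cform_cauchy X Y : `|b X Y| <= cnorm X * cnorm Y.
Proof.
have [->|Y0] := eqVneq Y 0.
  by rewrite cform0r normr0 mulr_ge0// cnorm_ge0.
have bY := cform_gt0 Y0.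
(* This vector is b(Y, Y) times the component of X orthogonal to Y. *)
have := cform_ge0 (b Y Y *: X + (- b X Y) *: Y).
rewrite cformDl !cformZl !cformDr !cformZr (cformC Y X) => h.
have {}h : 0 <= b Y Y * (b X X * b Y Y - b X Y ^+ 2).
  move: h; move: (b Y Y) (b X X) (b X Y) => p q r.
  by congr (_ <= _); ring.
rewrite pmulr_rge0// subr_ge0 in h.
rewrite -(ler_pXn2r (ltn0Sn 1)) ?nnegrE ?mulr_ge0 ?cnorm_ge0//.
by rewrite exprMn !cnorm_sqr real_normK// num_real.
Qed.

Lemma cnormD X Y : cnorm (X + Y) <= cnorm X + cnorm Y.
Proof.
rewrite -(ler_pXn2r (ltn0Sn 1)) ?nnegrE ?addr_ge0 ?cnorm_ge0//.
have E : b (X + Y) (X + Y) = b X X + b X Y *+ 2 + b Y Y.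
  by rewrite cformDl !(cformDr _ X Y) (cformC Y X) mulr2n !addrA.
rewrite sqrrD (cnorm_sqr (X + Y)) (cnorm_sqr X) (cnorm_sqr Y) E lerD2r lerD2l.
by rewrite ler_pMn2r//; exact: le_trans (ler_norm _) (cform_cauchy X Y).
Qed.

Lemma cnorm_theta X : cnorm (theta X) = cnorm X.
Proof. by rewrite /cnorm /cform killing_theta. Qed.

(** The Gram matrix M is invertible by positivity, so the coordinates of X are recovered from its
    products with the basis vectors, and these obey Cauchy-Schwarz. *)
Lemma coord_cnorm : exists2 k : R, 0 <= k & forall (X : g_) j, `|X 0 j| <= k * cnorm X.
Proof.
pose M := \matrix_(i, j) b (delta_mx 0 i) (delta_mx 0 j).
have XM (X : g_) j : (X *m M) 0 j = b X (delta_mx 0 j).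
  rewrite mxE {2}(row_sum_delta X).
  rewrite (big_morph (fun Z => b Z (delta_mx 0 j)) (id1 := 0) (op1 := +%R)) ?cform0l//; last first.
    by move=> u v; rewrite cformDl.
  by apply: eq_bigr => i _; rewrite cformZl mxE.
have uM : M \in unitmx.
  rewrite -row_free_unit; apply: inj_row_free => v vM.
  apply/eqP; apply: contraT => /cform_gt0.
  rewrite {2}(row_sum_delta v).
  rewrite (big_morph (fun Z => b v Z) (id1 := 0) (op1 := +%R)) ?cform0r//; last first.
    by move=> u w; rewrite cformDr.
  by rewrite big1 ?ltxx// => i _; rewrite cformZr -XM vM mxE mulr0.
(* Summing over all j gives one constant for every coordinate. *)
exists (\sum_j \sum_i cnorm (delta_mx 0 i) * `|invmx M i j|).
  by apply: sumr_ge0 => j _; apply: sumr_ge0 => i _; rewrite mulr_ge0// cnorm_ge0.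
move=> X j; rewrite -{1}(mulmxK uM X) mxE.
apply: (le_trans (ler_norm_sum _ _ _)).
rewrite [X in _ <= X * _](bigD1 j)//= mulrDl -[leLHS]addr0; apply: lerD.
  rewrite mulr_suml; apply: ler_sum => i _.
  rewrite normrM XM mulrAC ler_wpM2r// mulrC; exact: cform_cauchy.
by rewrite mulr_ge0// ?cnorm_ge0//; apply: sumr_ge0 => k _; apply: sumr_ge0 => i _; rewrite mulr_ge0// cnorm_ge0.
Qed.

Lemma cnorm_le_coord (X : g_) : cnorm X <= \sum_j `|X 0 j| * cnorm (delta_mx 0 j).
Proof.
rewrite {1}(row_sum_delta X); elim/big_rec2 : _ => [|j y Z _ h].
  by rewrite /cnorm cform0l sqrtr0.
by apply: (le_trans (cnormD _ _)); rewrite cnormZ lerD2l.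
Qed.

(** Up to a constant independent of g this dominates the operator norm of Ad g; as a finite sum of
    coordinates it is continuous in g. *)
Definition Ad_size g := \sum_j \sum_i `|adj L g (delta_mx 0 j) 0 i| * cnorm (delta_mx 0 i).

Lemma cnorm_Ad : exists2 k : R, 0 <= k &
  forall g X, cnorm (adj L g X) <= k * Ad_size g * cnorm X.
Proof.
have [k k0 hk] := coord_cnorm; exists k => // g X.
rewrite {1}(row_sum_delta X) linear_sum /=.
rewrite mulrAC mulr_sumr.
elim/big_rec2 : _ => [|j y Z _ h]; first by rewrite /cnorm cform0l sqrtr0.
apply: (le_trans (cnormD _ _)); apply: lerD => //.
rewrite linearZ /= cnormZ; apply: ler_pM => //; first exact: cnorm_ge0.
exact: cnorm_le_coord.
Qed.

Lemma cnorm_Ad_bound g : exists2 k : R, 0 <= k &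
  forall X, cnorm (adj L g X) <= k * cnorm X.
Proof.
have [k k0 hk] := cnorm_Ad; exists (k * Ad_size g) => //.
rewrite mulr_ge0// /Ad_size; apply: sumr_ge0 => j _; apply: sumr_ge0 => i _.
by rewrite mulr_ge0// cnorm_ge0.
Qed.

End CartanForm.

Lemma cvg_sum_seq (T I : Type) (F : set_system T) (FF : Filter F) (r : seq I)
    (f : I -> T -> R) (l : I -> R) :
  (forall i, f i @ F --> l i) ->
  (fun x => \sum_(i <- r) f i x) @ F --> \sum_(i <- r) l i.
Proof.
move=> h; elim: r => [|i r IH].
  rewrite big_nil (_ : (fun x => _) = cst 0); first exact: cvg_cst.
  by apply/funext => x; rewrite big_nil.
rewrite big_cons (_ : (fun x => _) = (fun x => f i x + \sum_(j <- r) f j x)).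
  exact: (cvgD (h i) IH).
by apply/funext => x; rewrite big_cons.
Qed.

Lemma Ad_size_continuous theta : continuous (Ad_size theta).
Proof.
move=> g; rewrite /continuous_at /Ad_size.
apply: cvg_sum_seq => j; apply: cvg_sum_seq => i.
apply: cvgMl; apply: cvg_norm.
have h := @adj_continuous _ _ _ L (delta_mx 0 j) g.
exact: (@cvg_comp _ _ _ (fun x => adj L x (delta_mx 0 j)) (fun z : g_ => z 0 i) _ _ _ h (@coord_continuous _ _ _ _ _ _)).
Qed.

End AdExp.

(** * Roots *)
Section Roots.
Context {R : realType} {n : nat} {G : topGroupType} {L : lie_group R n G}.
Variable D : cartan_data L.
Local Notation g_ := 'rV[R]_n.
Local Notation theta := (cartan_inv D).
Local Notation thetaP := (cartan_invP D).

Lemma root_spaceP (al : functional D) X :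
  root_space L al X <-> forall H : atype D, brk L (vsval H) X = al H *: X.
Proof. by rewrite /root_space /= brkE. Qed.

Lemma theta_a (H : atype D) : theta (vsval H) = - vsval H.
Proof. by case: (cartan_aP D) => + _ _; apply; exact: subvsP. Qed.

Lemma brk_a (H H' : atype D) : brk L (vsval H) (vsval H') = 0.
Proof. by case: (cartan_aP D) => _ + _; rewrite -brkE; apply; exact: subvsP. Qed.

Lemma root_spaceZ (al : functional D) a X : root_space L al X -> root_space L al (a *: X).
Proof.
move=> /root_spaceP h; apply/root_spaceP => H.
by rewrite linearZ /= h !scalerA mulrC.
Qed.

Lemma root_space_brk (al be : functional D) X Y :
  root_space L al X -> root_space L be Y -> root_space L (al + be) (brk L X Y).
Proof.
move=> /root_spaceP hX /root_spaceP hY; apply/root_spaceP => H.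
by rewrite brk_leibniz hX hY bracketZl linearZ /= -scalerDl add_lfunE.
Qed.

Lemma root_space_theta (al : functional D) X :
  root_space L al X -> root_space L (- al) (theta X).
Proof.
move=> /root_spaceP hX; apply/root_spaceP => H.
rewrite -[vsval H]opprK -theta_a -linearN /= -(theta_bracket thetaP) bracketNl hX.
by rewrite linearN /= linearZ /= opp_lfunE scaleNr.
Qed.

Lemma is_root_opp (al : functional D) : is_root L al -> is_root L (- al).
Proof.
move=> [al0 [X X0 hX]]; split; first by rewrite oppr_eq0.
exists (theta X); last exact: root_space_theta.
by apply: contraNneq X0 => tX; rewrite -(thetaK thetaP X) tX linear0.
Qed.

Section RootSum.
Variable Phi : set (functional D).

Lemma root_sum_incl al X : Phi al -> root_space L al X -> root_sum L Phi X.
Proof.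
move=> Pal hX; exists [:: (al, X)]; last by rewrite big_seq1.
by move=> p; rewrite inE => /eqP ->.
Qed.

Lemma root_sum_closed : lin_closed (root_sum L Phi).
Proof.
split; first by exists [::]; rewrite ?big_nil.
move=> a x y [s ss ->] [u us ->].
exists ([seq (p.1, a *: p.2) | p <- s] ++ u).
  move=> p; rewrite mem_cat => /orP[/mapP[q /ss[Pq hq] ->]|/us//].
  by split => //; exact: root_spaceZ.
by rewrite big_cat /= big_map scaler_sumr.
Qed.

Lemma root_sum_min W : lin_closed W ->
  (forall al X, Phi al -> root_space L al X -> W X) -> forall X, root_sum L Phi X -> W X.
Proof.
move=> lW h X [s ss ->]; rewrite big_seq; apply: big_ind => [|x y|p /ss[]].
- by case: lW.
- exact: lin_closedD.
- exact: h.
Qed.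

End RootSum.

Definition eig_sum (H : g_) (P : R -> Prop) : set g_ :=
  span_set [set X | exists2 c, P c & brk L H X = c *: X].

Lemma eig_sum_incl H (P : R -> Prop) c X : P c -> brk L H X = c *: X -> eig_sum H P X.
Proof. by move=> Pc hX; apply: span_set_incl; exists c. Qed.

Lemma eig_sum_closed H P : lin_closed (eig_sum H P).
Proof.
apply: span_set_closed => a X [c Pc hX]; exists c => //.
by rewrite linearZ /= hX !scalerA mulrC.
Qed.

Lemma eig_sum_min H (P : R -> Prop) W : lin_closed W ->
  (forall c X, P c -> brk L H X = c *: X -> W X) -> forall X, eig_sum H P X -> W X.
Proof. by move=> lW h; apply: span_set_min => // X [c Pc hX]; exact: h hX. Qed.

Lemma brk_eig H c d Z X : brk L H Z = c *: Z -> brk L H X = d *: X ->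
  brk L H (brk L Z X) = (c + d) *: brk L Z X.
Proof. by move=> hZ hX; rewrite brk_leibniz hZ hX bracketZl linearZ /= scalerDl. Qed.

Lemma kilZl a X Y : kil L (a *: X) Y = a * kil L X Y.
Proof.
have k0 : kil L 0 Y = 0.
  by have := killing_linearl L Y (-1) 0 0; rewrite scaler0 addr0 mulN1r addNr.
by have := killing_linearl L Y a X 0; rewrite addr0 k0 addr0.
Qed.

Lemma kilZr a X Y : kil L X (a *: Y) = a * kil L X Y.
Proof. by rewrite killingC kilZl killingC. Qed.

Lemma kilDr X Y Z : kil L X (Y + Z) = kil L X Y + kil L X Z.
Proof. by have := killing_linearr L X 1 Y Z; rewrite scale1r mul1r. Qed.

(** Invariance of the Killing form under ad H gives (c + d) <X, Y> = 0. *)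
Lemma kil_eig H c d X Y : brk L H X = c *: X -> brk L H Y = d *: Y ->
  c + d != 0 -> kil L X Y = 0.
Proof.
move=> hX hY cd; have := killing_ad L H X Y.
rewrite hX hY kilZl kilZr => /eqP; rewrite -addr_eq0 -mulrDl mulf_eq0 (negPf cd) /=.
by move=> /eqP.
Qed.

Lemma kil_closed X : lin_closed [set Y | kil L X Y = 0].
Proof.
split => [|a Y Z /= hY hZ] /=; last by rewrite killing_linearr hY hZ mulr0 addr0.
by rewrite -(scale0r 0) kilZr mul0r.
Qed.

Lemma kil_eig_sum H c (P : R -> Prop) X : brk L H X = c *: X ->
  (forall d, P d -> c + d != 0) -> forall Y, eig_sum H P Y -> kil L X Y = 0.
Proof.
move=> hX cd; apply: (@eig_sum_min _ _ [set Y | kil L X Y = 0]).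
  exact: kil_closed.
by move=> d Y Pd hY; apply: (kil_eig hX hY); exact: cd.
Qed.

Lemma kil_eig_sums H (P Q : R -> Prop) X Y : (forall c d, P c -> Q d -> c + d != 0) ->
  eig_sum H P X -> eig_sum H Q Y -> kil L X Y = 0.
Proof.
move=> cd PX QY; rewrite killingC.
apply: (@eig_sum_min _ P [set X | kil L Y X = 0]) PX; first exact: kil_closed.
move=> c {}X Pc hX /=; rewrite killingC.
by apply: (kil_eig_sum hX _ QY) => d; exact: cd.
Qed.

Lemma cform_eig (H : atype D) c d X Y :
  brk L (vsval H) X = c *: X -> brk L (vsval H) Y = d *: Y -> c != d ->
  cform L theta X Y = 0.
Proof.
move=> hX hY cd; have := cform_ad thetaP X Y (theta_a H).
rewrite hX hY cformZl (cformZr thetaP) => /eqP.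
by rewrite -subr_eq0 -mulrBl mulf_eq0 subr_eq0 (negPf cd) => /eqP.
Qed.

Lemma adj_eig_sum H P g X : adj L g H = H -> eig_sum H P X -> eig_sum H P (adj L g X).
Proof.
move=> gH; move: X; apply: span_set_map; first exact: eig_sum_closed.
move=> X [c Pc hX]; apply: (eig_sum_incl Pc).
by rewrite -{1}gH -adj_brk hX linearZ.
Qed.

Lemma adj_root_space g (al : functional D) X :
  (forall H : atype D, adj L g (vsval H) = vsval H) ->
  root_space L al X -> root_space L al (adj L g X).
Proof.
move=> gH /root_spaceP hX; apply/root_spaceP => H.
by rewrite -{1}gH -adj_brk hX linearZ.
Qed.

Lemma brkl_closed X W : lin_closed W -> lin_closed [set Z | W (brk L Z X)].
Proof.
move=> [W0 Wl]; split => [|a x y /= Wx Wy] /=; first by rewrite bracket0l.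
by rewrite bracketDl bracketZl; exact: Wl.
Qed.

Lemma brk_eig_sum (H : atype D) (P : R -> Prop) Z :
  (forall be : functional D, posroot be -> 0 <= be H) ->
  (forall c d : R, P c -> c <= d -> P d) ->
  root_sum L (@posroot _ _ _ _ D) Z ->
  forall X, eig_sum (vsval H) P X -> eig_sum (vsval H) P (brk L Z X).
Proof.
move=> pH Pup nZ; apply: span_set_map; first exact: eig_sum_closed.
move=> X [c Pc hX].
apply: (root_sum_min (brkl_closed X (eig_sum_closed (vsval H) P))) nZ => be Z' pbe /root_spaceP hZ' /=.
apply: (@eig_sum_incl _ _ (be H + c)); last exact: brk_eig.
by apply: Pup Pc _; rewrite lerDr; exact: pH.
Qed.

Lemma adj_exp_eig_sum (H : atype D) (P : R -> Prop) u :
  (forall be : functional D, posroot be -> 0 <= be H) ->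
  (forall c d : R, P c -> c <= d -> P d) -> groupN D u ->
  forall X, eig_sum (vsval H) P X -> eig_sum (vsval H) P (adj L u X).
Proof.
move=> pH Pup [Z nZ eZ] X; apply: (Ad_exp_stable eZ); first exact: eig_sum_closed.
exact: brk_eig_sum.
Qed.

(** Unipotence of N: bracketing with a positive root vector strictly raises eigenvalues when H is in
    the open chamber. *)
Lemma adj_exp_sub (H : atype D) c u Y :
  (forall be : functional D, posroot be -> 0 < be H) -> groupN D u ->
  brk L (vsval H) Y = c *: Y -> eig_sum (vsval H) (fun d => c < d) (adj L u Y - Y).
Proof.
move=> pH [Z nZ eZ] hY; apply: (Ad_exp_sub eZ); first exact: eig_sum_closed.
  apply: brk_eig_sum => //; first by move=> be /pH /ltW.
  by move=> d d' cd /(lt_le_trans cd).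
apply: (root_sum_min (brkl_closed Y (eig_sum_closed (vsval H) _))) nZ => be Z' pbe /root_spaceP hZ' /=.
apply: (@eig_sum_incl _ _ (be H + c)); last exact: brk_eig.
by rewrite ltrDr; exact: pH.
Qed.

Lemma groupNV u : groupN D u -> groupN D u^-1%g.
Proof.
move=> [Z nZ eZ]; exists (- Z); last exact: is_expN.
by rewrite -scaleN1r; apply: lin_closedZ => //; exact: root_sum_closed.
Qed.

Lemma groupA_fix h : groupA D h -> forall H : atype D, adj L h (vsval H) = vsval H.
Proof.
move=> [X Xa eX] H; apply: (Ad_exp_fix eX).
by rewrite -(vsprojK Xa) brk_a.
Qed.

(** M is defined by commuting with A; the curve exp(tH) lies in A, so m commutes with it and
    [adj_commutant] applies. *)
Lemma groupM_fix m : groupM D m -> forall H : atype D, adj L m (vsval H) = vsval H.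
Proof.
move=> [_ mA] H; have [c oc] := one_parameter_exists L (vsval H).
apply: (adj_commutant oc) => t; apply: mA.
exists (t *: vsval H); last exact: is_exp_curve.
by apply: memvZ; exact: subvsP.
Qed.

Lemma groupK1 : groupK D 1%g.
Proof. by exists 0; [rewrite /= linear0 | exact: is_exp0]. Qed.

Lemma groupA1 : groupA D 1%g.
Proof. by exists 0; [exact: mem0v | exact: is_exp0]. Qed.

Lemma groupN1 : groupN D 1%g.
Proof. by exists 0; [case: (root_sum_closed (@posroot _ _ _ _ D)) | exact: is_exp0]. Qed.

Lemma groupP1 : groupP D 1%g.
Proof.
exists 1%g, 1%g, 1%g; split; rewrite ?mulg1//.
- by split; [exact: groupK1 | move=> h _; rewrite mul1g mulg1].
- exact: groupA1.
- exact: groupN1.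
Qed.

Lemma groupK_cform k Y Z : groupK D k -> cform L theta (adj L k Y) (adj L k Z) = cform L theta Y Z.
Proof. by move=> [X tX eX]; exact: (cform_Ad_exp thetaP Y Z tX eX). Qed.

Lemma groupK_cnorm k Y : groupK D k -> cnorm L theta (adj L k Y) = cnorm L theta Y.
Proof. by move=> kK; rewrite /cnorm groupK_cform. Qed.

(** Extends al to g through the projection onto a, so that it can be evaluated along closures and
    limits taken in g. *)
Definition ext_functional (al : functional D) : {linear g_ -> R^o} :=
  (al \o vsproj (cartan_a D)).

Lemma ext_functionalE (al : functional D) (H : atype D) : ext_functional al (vsval H) = al H.
Proof. by rewrite /ext_functional /= vsvalK. Qed.

Lemma ext_functional_continuous (al : functional D) : continuous (ext_functional al).
Proof. exact: linear_rV_continuous. Qed.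

Lemma chamber_regular x : chamber D x -> regular_set L (cartan_a D) x.
Proof.
case: (chamberP D) => H0 rH0 ->.
exact: connected_component_sub.
Qed.

Lemma chamber_ex : exists H0 : atype D, chamber D (vsval H0).
Proof.
case: (chamberP D) => x rx CE; have : chamber D x.
  by rewrite CE; exact: connected_component_refl.
by case: rx => H0 _ <-; exists H0.
Qed.

Lemma chamber_closure_ge0 (be : functional D) (H : atype D) :
  (forall H', chamber D (vsval H') -> 0 < be H') ->
  closure (chamber D) (vsval H) -> 0 <= be H.
Proof.
move=> pbe clH; rewrite -ext_functionalE.
have cl : closed [set x : g_ | 0 <= ext_functional be x].
  apply: (@closed_comp _ _ (ext_functional be) [set y : R | 0 <= y]).
    by move=> x _; exact: ext_functional_continuous.
  exact: closed_ge.
move/closure_id : cl => cl.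
have : closure [set x : g_ | 0 <= ext_functional be x] (vsval H).
  apply: closure_subset clH => x Cx /=.
  have [H' _ xE] := chamber_regular Cx.
  by rewrite -xE vsvalK ltW// pbe// xE.
by rewrite -cl.
Qed.

(** The part of the chamber where be > 0 is open and, since be has no zero on regular elements, also
    closed; the chamber is connected. *)
Lemma chamber_sign (be : functional D) (H1 H2 : atype D) : is_root L be ->
  chamber D (vsval H1) -> chamber D (vsval H2) -> 0 < be H1 -> 0 < be H2.
Proof.
move=> rbe C1 C2 be1.
have cC : connected (chamber D).
  by case: (chamberP D) => H0 _ ->; exact: component_connected.
pose B := chamber D `&` [set x : g_ | 0 < ext_functional be x].
have BE : B = chamber D.
  apply: cC.
  - by exists (vsval H1); split => //=; rewrite vsvalK.
  - exists [set x : g_ | 0 < ext_functional be x] => //.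
    apply: (@open_comp _ _ (ext_functional be) [set y : R | 0 < y]).
      by move=> x _; exact: ext_functional_continuous.
    exact: open_gt.
  - exists [set x : g_ | 0 <= ext_functional be x].
      apply: (@closed_comp _ _ (ext_functional be) [set y : R | 0 <= y]).
        by move=> x _; exact: ext_functional_continuous.
      exact: closed_ge.
    apply/seteqP; split => x [Cx /=].
      by move=> /ltW.
    have [H' rH' H'E] := chamber_regular Cx.
    rewrite -H'E vsvalK => be0; split; first by rewrite H'E.
    by rewrite /= vsvalK lt_neqAle be0 andbT eq_sym; exact: rH'.
have : B (vsval H2) by rewrite BE.
by move=> [_ /=]; rewrite vsvalK.
Qed.

Lemma posroot_opp (de : functional D) (H : atype D) : is_root L de ->
  closure (chamber D) (vsval H) -> de H < 0 -> posroot (- de).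
Proof.
move=> rde clH deH; split; first exact: is_root_opp.
move=> H1 C1; rewrite opp_lfunE oppr_gt0 ltNge; apply/negP => de1.
have de1' : 0 < de H1.
  have [H' rH' H'E] := chamber_regular C1.
  have -> : H1 = H' by apply: (can_inj (@vsvalK _ _ _)).
  rewrite lt_neqAle eq_sym rH'//= -(ext_functionalE de H') H'E ext_functionalE//.
have : 0 <= de H.
  apply: chamber_closure_ge0 clH => H2 C2; exact: chamber_sign C1 C2 de1'.
by rewrite leNgt deH.
Qed.

(** * Roots off Theta and the pairing identity *)

Section Block.
Variables (H : atype D) (clH : closure (chamber D) (vsval H)).

Lemma posroot_ge0 (be : functional D) : posroot be -> 0 <= be H.
Proof. by move=> [_ pbe]; exact: chamber_closure_ge0. Qed.

Lemma roots_spanned_eq0 (al : functional D) : roots_spanned L (Theta H) al -> al H = 0.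
Proof.
move=> [_ [s sT als]]; have := coord_span (X := in_tuple s) als => ->.
rewrite sum_lfunE big1// => i _; rewrite scale_lfunE.
have : s`_i \in s by rewrite mem_nth.
by move=> /sT[_ ->]; rewrite scaler0.
Qed.

(* Decomposing non-simple roots forever would give infinitely many heights
   [al H0], all of them eigenvalues of [ad H0]. *)
Lemma posroot_spanned (al : functional D) :
  posroot al -> al H = 0 -> roots_spanned L (Theta H) al.
Proof.
move=> pal alH; apply: contrapT => nal.
have [H0 C0] := chamber_ex.
pose bad (al : functional D) := [/\ posroot al, al H = 0 & ~ roots_spanned L (Theta H) al].
pose p := char_poly (adm L (vsval H0)).
have p0 : p != 0 by exact/monic_neq0/char_poly_monic.
have badp be : bad be -> root p (be H0).
  move=> [[[_ [X X0 hX]] _] _ _]; rewrite -eigenvalue_root_char.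
  apply/eigenvalueP; exists X => //.
  by rewrite mul_adm; move/root_spaceP : hX; apply.
have step be : bad be -> exists2 ga, bad ga & ga H0 < be H0.
  move=> [pbe beH nbe].
  have ns : ~ simroot be.
    move=> sbe; apply: nbe; split; first by case: pbe.
    exists [:: be]; last by rewrite memv_span// inE.
    by move=> de; rewrite inE => /eqP ->.
  have [b1 [b2 [p1 p2 bE]]] : exists b1 b2, [/\ posroot b1, posroot b2 & be = b1 + b2].
    apply: contrapT => h; apply: ns; split => // b1 b2 p1 p2 bE.
    by apply: h; exists b1, b2.
  (* Both terms are nonnegative because H is in the closed chamber, so both summands vanish at H,
     and at least one of them is again bad. *)
  have : b1 H + b2 H == 0 by rewrite -beH bE add_lfunE.
  rewrite paddr_eq0 ?posroot_ge0// => /andP[/eqP b1H /eqP b2H].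
  have h1 : b1 H0 < be H0 by rewrite bE add_lfunE ltrDl; case: p2 => _; apply.
  have h2 : b2 H0 < be H0 by rewrite bE add_lfunE ltrDr; case: p1 => _; apply.
  have [s1|n1] := pselect (roots_spanned L (Theta H) b1); last by exists b1.
  have [s2|n2] := pselect (roots_spanned L (Theta H) b2); last by exists b2.
  exfalso; apply: nbe; split; first by case: pbe.
  case: s1 => _ [l1 L1 m1]; case: s2 => _ [l2 L2 m2].
  exists (l1 ++ l2); first by move=> de; rewrite mem_cat => /orP[/L1|/L2].
  by rewrite bE span_cat memv_add.
have chain k : exists be s, [/\ bad be, size s = k, uniq s, all (root p) s & all (fun x => be H0 < x) s].
  elim: k => [|k [be [s [bbe sk us rs ls]]]]; first by exists al, [::].
  have [ga bga gabe] := step be bbe.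
  exists ga, (be H0 :: s); split => //=; first by rewrite sk.
  - rewrite us andbT; apply/negP => /(allP ls) /=; by rewrite ltxx.
  - by rewrite rs badp.
  - by rewrite gabe; apply/allP => x /(allP ls); exact: lt_trans.
(* A nonzero polynomial cannot have as many distinct roots as its size, which is its degree plus
   one. *)
have [be [s [_ sk us rs _]]] := chain (size p).
by have := max_poly_roots p0 rs us; rewrite sk ltnn.
Qed.

Lemma outer_root_gt0 (al : functional D) : posroot al ->
  ~ roots_spanned L (Theta H) al -> 0 < al H.
Proof.
move=> pal nal; rewrite lt_neqAle posroot_ge0// andbT eq_sym.
by apply/eqP => alH; apply: nal; exact: posroot_spanned.
Qed.

(** Enlarging n_Theta^- by the nonnegative eigenspaces of ad H restores stability under P. *)
Definition nminus_nonneg : set g_ :=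
  [set X | exists X1 X2, [/\ nminus H X1, eig_sum (vsval H) (fun c => 0 <= c) X2 & X = X1 + X2]].

Lemma nminus_closed : lin_closed (nminus H).
Proof. exact: root_sum_closed. Qed.

Lemma nminus_nonneg_closed : lin_closed nminus_nonneg.
Proof.
have [n0 nl] := nminus_closed.
have [e0 el] := eig_sum_closed (vsval H) (fun c => 0 <= c).
split; first by exists 0, 0; rewrite addr0.
move=> a x y [x1 [x2 [nx ex ->]]] [y1 [y2 [ny ey ->]]].
exists (a *: x1 + y1), (a *: x2 + y2); split; [exact: nl | exact: el |].
by rewrite scalerDr addrACA.
Qed.

Lemma nminus_nonnegl X : nminus H X -> nminus_nonneg X.
Proof.
move=> nX; exists X, 0; split => //; last by rewrite addr0.
by case: (eig_sum_closed (vsval H) (fun c => 0 <= c)).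
Qed.

Lemma nminus_nonnegr X : eig_sum (vsval H) (fun c => 0 <= c) X -> nminus_nonneg X.
Proof.
move=> eX; exists 0, X; split => //; last by rewrite add0r.
by case: nminus_closed.
Qed.

Lemma nminus_nonneg_min (f : {linear g_ -> g_}) :
  (forall (de : functional D) X, outer_root H (- de) -> root_space L de X -> nminus_nonneg (f X)) ->
  (forall X, eig_sum (vsval H) (fun c => 0 <= c) X -> nminus_nonneg (f X)) ->
  forall X, nminus_nonneg X -> nminus_nonneg (f X).
Proof.
move=> h1 h2 X [X1 [X2 [nX eX ->]]]; rewrite linearD.
apply: lin_closedD; first exact: nminus_nonneg_closed.
  have := lin_closed_preim f nminus_nonneg_closed.
  by move/root_sum_min; apply; first exact: h1.
exact: h2.
Qed.

Lemma brk_nminus_nonneg Z : root_sum L (@posroot _ _ _ _ D) Z ->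
  forall X, nminus_nonneg X -> nminus_nonneg (brk L Z X).
Proof.
move=> nZ; apply: nminus_nonneg_min; last first.
  move=> X eX; apply: nminus_nonnegr; apply: brk_eig_sum eX => //.
    exact: posroot_ge0.
  by move=> c d /le_trans; apply.
move=> de X ode hX.
apply: (root_sum_min (brkl_closed X nminus_nonneg_closed)) nZ => ga Z' pga hZ' /=.
have hb := root_space_brk hZ' hX.
(* A bracket with nonnegative eigenvalue falls into the second summand. Otherwise, if nonzero, it is
   a root vector for the opposite of a positive root, and that root is off the span of Theta because
   roots in the span vanish at H. *)
have [ge0|lt0] := lerP 0 ((ga + de) H).
  by apply/nminus_nonnegr/(eig_sum_incl ge0); move/root_spaceP : hb; apply.
have [->|b0] := eqVneq (brk L Z' X) 0; first by case: nminus_nonneg_closed.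
apply: nminus_nonnegl; apply: (root_sum_incl _ hb); split.
  apply: (posroot_opp _ clH lt0); split; last by exists (brk L Z' X).
  by apply: contraTneq lt0 => ->; rewrite zero_lfunE ltxx.
by move=> /roots_spanned_eq0 /eqP; rewrite opp_lfunE oppr_eq0 lt_eqF.
Qed.

Lemma adj_fix_nminus_nonneg g : (forall H' : atype D, adj L g (vsval H') = vsval H') ->
  forall X, nminus_nonneg X -> nminus_nonneg (adj L g X).
Proof.
move=> gH; apply: nminus_nonneg_min.
  move=> de X ode hX; apply: nminus_nonnegl; apply: (root_sum_incl (Phi := [set al | outer_root H (- al)]) ode).
  exact: adj_root_space.
by move=> X eX; apply: nminus_nonnegr; exact: adj_eig_sum.
Qed.

Lemma adj_groupP_nminus_nonneg p : groupP D p ->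
  forall X, nminus_nonneg X -> nminus_nonneg (adj L p X).
Proof.
move=> [m [h [u [mM hA [Z nZ eZ] ->]]]] X VX; rewrite !adjM.
apply/(adj_fix_nminus_nonneg (groupM_fix mM))/(adj_fix_nminus_nonneg (groupA_fix hA)).
apply: (Ad_exp_stable eZ) => //; first exact: nminus_nonneg_closed.
exact: brk_nminus_nonneg.
Qed.

Lemma adj_groupP_pos p : groupP D p -> forall X,
  eig_sum (vsval H) (fun c => 0 < c) X -> eig_sum (vsval H) (fun c => 0 < c) (adj L p X).
Proof.
move=> [m [h [u [mM hA uN ->]]]] X VX; rewrite !adjM.
apply: adj_eig_sum; first exact: groupM_fix.
apply: adj_eig_sum; first exact: groupA_fix.
apply: adj_exp_eig_sum => //; first exact: posroot_ge0.
by move=> c d /lt_le_trans; apply.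
Qed.

(** Eigenvalues of ad H are strictly negative on n_Theta^- by [outer_root_gt0], and ad H is
    symmetric for the Cartan form. *)
Lemma nminus_nonneg_orth X1 X2 : nminus H X1 -> eig_sum (vsval H) (fun c => 0 <= c) X2 ->
  cform L theta X1 X2 = 0.
Proof.
have cl X : lin_closed [set Y | cform L theta X Y = 0].
  split => [|a Y Z /= hY hZ] /=; first by rewrite (cform0r thetaP).
  by rewrite (cform_linearr thetaP) hY hZ mulr0 addr0.
move=> nX eX; rewrite (cformC thetaP).
apply: (root_sum_min (cl X2)) nX => de {}X1 [pde nde] /root_spaceP hX1 /=.
rewrite (cformC thetaP).
apply: (eig_sum_min (cl X1)) eX => c {}X2 c0 hX2 /=.
apply: (cform_eig (hX1 H) hX2); rewrite lt_eqF//; apply: lt_le_trans c0.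
by have := outer_root_gt0 pde nde; rewrite opp_lfunE oppr_gt0.
Qed.

Lemma nminus_nonneg_cnorm X1 X2 : nminus H X1 -> eig_sum (vsval H) (fun c => 0 <= c) X2 ->
  cnorm L theta X1 <= cnorm L theta (X1 + X2).
Proof.
move=> nX eX; rewrite /cnorm ler_wsqrtr//.
have E : cform L theta (X1 + X2) (X1 + X2) = cform L theta X1 X1 + cform L theta X2 X2.
  rewrite cformDl !(cformDr thetaP) (cformC thetaP X2 X1).
  by rewrite (nminus_nonneg_orth nX eX) addr0 add0r.
by rewrite E lerDl; exact: (cform_ge0 thetaP).
Qed.

Lemma expansion_pairing (al : functional D) Y (A : atype D) h u p z c :
  posroot al -> ~ roots_spanned L (Theta H) al -> root_space L al Y ->
  is_exp L (vsval A) h -> groupN D u -> groupP D p -> stabZ H z ->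
  (c * z * p = h * u)%g ->
  exists X, [/\ nminus H X, cnorm L theta X <= cnorm L theta (adj L p (theta Y))
    & expR (- al A) * kil L Y (theta Y) = kil L (adj L c^-1%g Y) (adj L z X)].
Proof.
move=> pal nal hY eh uN pP zZ czp.
have alH := outer_root_gt0 pal nal.
have hY' := root_space_theta hY.
have zH : adj L z (vsval H) = vsval H by rewrite -adjE.
have [X [Z [nX eZ pE]]] : nminus_nonneg (adj L p (theta Y)).
  apply: adj_groupP_nminus_nonneg => //; apply: nminus_nonnegl.
  by apply: root_sum_incl hY'; rewrite /= opprK.
exists X; split => //; first by rewrite pE; exact: nminus_nonneg_cnorm.
(* H may lie on a wall, where some positive roots vanish. At H0 in the open chamber, Ad u (theta Y)
   - theta Y has eigenvalues strictly above -al(H0), so it pairs to zero with Y. *)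
have [H0 C0] := chamber_ex.
have hVY : adj L h^-1%g Y = expR (- al A) *: Y.
  apply: (Ad_exp_eigen (is_expN eh)).
  by rewrite bracketNl; move/root_spaceP : hY => ->; rewrite scaleNr.
have E1 : kil L Y (adj L (h * u)%g (theta Y)) = expR (- al A) * kil L Y (theta Y).
  rewrite adjM -{1}(adjVK L h Y) killing_Ad hVY kilZl; congr (_ * _).
  rewrite -{1}(subrK (theta Y) (adj L u (theta Y))) kilDr.
  rewrite (@kil_eig_sum (vsval H0) (al H0) (fun d => (- al) H0 < d)) ?add0r//.
  - by move/root_spaceP : hY; apply.
  - by move=> d; rewrite opp_lfunE => ad; rewrite gt_eqF// -(subrr (al H0)) ltrD2l.
  - apply: adj_exp_sub => //; first by move=> be [_]; apply.
    by move/root_spaceP : hY'; apply.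
have E2 : kil L Y (adj L (c * z * p)%g (theta Y)) = kil L (adj L c^-1%g Y) (adj L z (X + Z)).
  by rewrite !adjM -{1}(adjVK L c Y) killing_Ad pE.
rewrite -E1 -czp E2 linearD kilDr.
rewrite (@kil_eig_sums (vsval H) (fun c => 0 < c) (fun c => 0 <= c) _ (adj L z Z)) ?addr0//.
- by move=> a b a0 b0; rewrite gt_eqF// ltr_wpDr.
(* Solving the hypothesis for c^-1 writes it as a product of elements of Z_H, P, N and A, each of
   which preserves the positive eigenspaces of ad H. *)
- have -> : (c^-1 = z * p * (u^-1 * h^-1))%g.
    rewrite -invgM; apply: (mulIg (h * u)%g).
    by rewrite mulgVK -czp -mulgA mulKg.
  rewrite !adjM hVY; apply: adj_eig_sum => //; apply: adj_groupP_pos => //.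
  apply: adj_exp_eig_sum.
  + exact: posroot_ge0.
  + by move=> a b /lt_le_trans; apply.
  + exact: groupNV.
  apply: lin_closedZ; first exact: eig_sum_closed.
  by apply: (eig_sum_incl alH); move/root_spaceP : hY; apply.
- exact: adj_eig_sum.
Qed.

End Block.
End Roots.

(** * Principal bundles and their associated bundles *)
Lemma to_quot_eqP (T : topologicalType) (S : Type) (f : T -> S) (x y : T) :
  to_quot f x = to_quot f y <-> f x = f y.
Proof.
split => [h|h].
  by have /eqmodP/asboolP : (\pi_({eq_quot (ker_equiv f)}) x = \pi_({eq_quot (ker_equiv f)}) y)%qT := h.
by apply/eqmodP/asboolP.
Qed.

Lemma to_quot_repr (T : topologicalType) (S : Type) (f : T -> S) (z : ker_quot f) :
  to_quot f (repr z) = z.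
Proof. exact: reprK. Qed.

Lemma repr_to_quot (T : topologicalType) (S : Type) (f : T -> S) (x : T) :
  f (repr (to_quot f x)) = f x.
Proof. by apply/to_quot_eqP; exact: to_quot_repr. Qed.

Section Principal.
Context {G : topGroupType} {Q X : topologicalType}.
Variable B : principal_bundle G Q X.

Lemma bproj_act q g : bproj B (bact B q g) = bproj B q.
Proof.
have [_ /(_ (bproj B q))[U [tau [kap [[_ Uq] _ _ h1 h2]]]]] := bprincipal B.
have [_ {1}<-] := h2 q I Uq.
have [[_ _ _] /(_ g I) <-] := h1 _ (kap q) Uq I.
by have [[_ -> _] _] := h1 _ (kap q * g)%g Uq I.
Qed.

Lemma bact_inj q g h : bact B q g = bact B q h -> g = h.
Proof.
have [_ /(_ (bproj B q))[U [tau [kap [[_ Uq] _ _ h1 h2]]]]] := bprincipal B.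
have [_ <-] := h2 q I Uq.
have [[_ _ _] h3] := h1 _ (kap q) Uq I; rewrite -!h3// => E.
have [[_ _ Eg] _] := h1 _ (kap q * g)%g Uq I.
have [[_ _ Eh] _] := h1 _ (kap q * h)%g Uq I.
by apply: (mulgI (kap q)); rewrite -Eg -Eh E.
Qed.

Lemma bact_trans q r : bproj B q = bproj B r -> exists g, r = bact B q g.
Proof.
have [_ /(_ (bproj B q))[U [tau [kap [[_ Uq] _ _ h1 h2]]]]] := bprincipal B.
move=> qr; exists ((kap q)^-1 * kap r)%g.
have [_ {1}<-] := h2 q I Uq.
have [[_ _ _] <-//] := h1 _ (kap q) Uq I.
rewrite mulVKg qr; have [|_ ->//] := h2 r I.
by rewrite -qr.
Qed.

(** The section y |-> tau (y, 1) of a local trivialization; every point of S over U differs from it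
    by an element of S0. *)
Lemma reduction_section S S0 : S0 1%g -> principal_on (bact B) (bproj B) S S0 ->
  forall x, exists U s, [/\ open U, U x, {for x, continuous s}
    & forall y, U y -> [/\ S (s y), bproj B (s y) = y
      & forall q, S q -> bproj B q = y -> exists2 k, S0 k & q = bact B (s y) k]].
Proof.
move=> S01 [_ hS] x.
have [U [tau [kap [[oU Ux] ct _ h1 h2]]]] := hS x.
exists U, (fun y => tau (y, 1%g)); split => //; last first.
  move=> y Uy; have [[Sy py _] h3] := h1 y 1%g Uy S01; split => // q Sq qy.
  have [|Sk kE] := h2 q Sq; first by rewrite qy.
  by exists (kap q) => //; rewrite -h3// mul1g -{1}kE qy.
move=> V nV.
have /subspace_continuousP/(_ (x, 1%g)) := ct.
move=> /(_ (conj Ux S01)) /(_ V nV) /= h.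
have cx : (fun y : X => (y, 1%g : G)) @ x --> (x, 1%g : G).
  by apply: cvg_pair; [exact: cvg_id | exact: cvg_cst].
have h' := cx _ h.
change (\forall y \near x, V (tau (y, 1%g))); near=> y.
have Uy : U y by near: y; exact: open_nbhs_nbhs.
have hy : U y /\ S0 1%g -> V (tau (y, 1%g)) by near: y; exact: h'.
exact: hy.
Unshelve. all: by end_near. Qed.

Lemma trivialization x : exists U kap, [/\ open U, U x,
  forall q, U (bproj B q) -> {for q, continuous kap}
  & forall q g, U (bproj B q) -> kap (bact B q g) = (kap q * g)%g].
Proof.
have [_ /(_ x)[U [tau [kap [[oU Ux] _ ck h1 h2]]]]] := bprincipal B.
exists U, kap; split => // [q Uq|q g Uq].
  have oP : open (bproj B @^-1` U).
    by apply: open_comp => // y _; exact: bproj_cont.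
  rewrite setTI in ck.
  have := ck; rewrite (continuous_open_subspace _ oP); apply.
  exact: mem_set.
have [_ {1}<-] := h2 q I Uq.
have [[_ _ _] /(_ g I) <-] := h1 _ (kap q) Uq I.
by have [[_ _ ->] _] := h1 _ (kap q * g)%g Uq I.
Qed.

(* Comparison of two compact reductions over a compact base *)
End Principal.

Section TransitionBound.
Context {R : realType} {n : nat} {G : topGroupType} {L : lie_group R n G}.
Variable D : cartan_data L.
Context {Q X : topologicalType}.
Variable B : principal_bundle G Q X.
Local Notation theta := (cartan_inv D).
Local Notation thetaP := (cartan_invP D).
Local Notation nrm := (cnorm L theta).

Lemma groupKV_cnorm k Y : groupK D k -> nrm (adj L k^-1%g Y) = nrm Y.
Proof. by move=> kK; rewrite -(groupK_cnorm _ kK) adjVK. Qed.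

Lemma transition_bounded (S1 S2 : set Q) (S01 S02 : set G) :
  compact [set: X] -> S01 1%g -> S02 1%g -> S01 `<=` groupK D -> S02 `<=` groupK D ->
  principal_on (bact B) (bproj B) S1 S01 -> principal_on (bact B) (bproj B) S2 S02 ->
  exists2 C : R, 0 <= C & forall r r' c Y, S1 r -> S2 r' -> r = bact B r' c ->
    nrm (adj L c^-1%g Y) <= C * nrm Y.
Proof.
move=> cX o1 o2 K1 K2 pS1 pS2.
have [kk kk0 hkk] := cnorm_Ad thetaP.
pose P (C : R) (y : X) := forall r r' c Y, S1 r -> S2 r' -> bproj B r = y ->
  r = bact B r' c -> nrm (adj L c^-1%g Y) <= C * nrm Y.
(* Compactness is used with the filter at +oo on the constant C: a bound valid near each x for all
   large C is valid everywhere for all large C. *)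
have /compact_near_coveringP/(_ R (pinfty_nbhs R) P _) := cX.
case.
  move=> x _.
  have [U1 [s1 [oU1 U1x cs1 hs1]]] := reduction_section o1 pS1 x.
  have [U2 [s2 [oU2 U2x cs2 hs2]]] := reduction_section o2 pS2 x.
  have [U3 [kap [oU3 U3x ck hk]]] := trivialization B x.
  (* The element carrying s1 y to s2 y. With r = s1 k1, r' = s2 k2 and r = r' c one gets c^-1 =
     k1^-1 d k2, so only the continuous factor d contributes. *)
  pose d y := ((kap (s1 y))^-1 * kap (s2 y))%g.
  have ps1 : bproj B (s1 x) = x by have [] := hs1 x U1x.
  have ps2 : bproj B (s2 x) = x by have [] := hs2 x U2x.
  have cd : {for x, continuous d}.
    apply: (mulg_continuous L).
      apply: (@continuous_comp _ _ _ (fun y => kap (s1 y)) (fun g : G => g^-1%g)).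
        by apply: (@continuous_comp _ _ _ s1 kap) => //; apply: ck; rewrite ps1.
      exact: (inv_cont L).
    by apply: (@continuous_comp _ _ _ s2 kap) => //; apply: ck; rewrite ps2.
  have cA : {for x, continuous (fun y => Ad_size L theta (d y))}.
    apply: (@continuous_comp _ _ _ d (Ad_size L theta)) => //.
    exact: Ad_size_continuous.
  pose M := Ad_size L theta (d x) + 1.
  have nM : \forall y \near x, Ad_size L theta (d y) < M.
    by move/cvgr_lt : cA; apply; rewrite ltrDl.
  have nU : \forall y \near x, [/\ U1 y, U2 y & U3 y].
    have [n1 n2 n3] := And3 (open_nbhs_nbhs (conj oU1 U1x)) (open_nbhs_nbhs (conj oU2 U2x))
      (open_nbhs_nbhs (conj oU3 U3x)).
    by near=> y; split; near: y.
  exists ([set y | Ad_size L theta (d y) < M /\ [/\ U1 y, U2 y & U3 y]], [set C : R | kk * M < C]).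
    split; first exact: filterI nM nU.
    by exists (kk * M); split => //; exact: num_real.
  move=> [y C] /= [[yM [y1 y2 y3]] MC] r r' c Y Sr Sr' ry rE.
  have r'y : bproj B r' = y by rewrite -ry rE bproj_act.
  have [_ p1 /(_ r Sr ry)[k1 k1S r1]] := hs1 y y1.
  have [_ p2 /(_ r' Sr' r'y)[k2 k2S r2]] := hs2 y y2.
  have cE : (c^-1 = k1^-1 * (d y * k2))%g.
    have : kap r = (kap r' * c)%g by rewrite rE hk// r'y.
    rewrite r1 hk ?p1// r2 hk ?p2// => E.
    apply: (mulIg c); rewrite mulVg /d -!mulgA [(kap (s2 y) * _)%g]mulgA -E.
    by rewrite mulKg mulVg.
  rewrite cE adjM groupKV_cnorm; last exact: K1.
  rewrite [adj L (d y * k2)%g Y]adjM; apply: (le_trans (hkk _ _)).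
  rewrite (groupK_cnorm _ (K2 _ k2S)).
  rewrite ler_wpM2r ?cnorm_ge0//; apply: le_trans (ltW MC).
  by rewrite ler_wpM2l// ltW.
move=> M [Mr hM].
exists (Num.max 0 (M + 1)); first by rewrite le_max lexx.
move=> r r' c Y Sr Sr' rE.
have := hM (Num.max 0 (M + 1)) _ (bproj B r) I r r' c Y Sr Sr' erefl rE; apply.
by rewrite lt_max ltrDl ltr01 orbT.
Unshelve. all: by end_near. Qed.

End TransitionBound.

Section VectorBundle.
Context {R : realType} {n : nat} {G : topGroupType} {L : lie_group R n G}.
Variable D : cartan_data L.
Context {Q X : topologicalType}.
Variable B : principal_bundle G Q X.
Variables (H : atype D) (f : Q -> 'rV[R]_n).
Local Notation theta := (cartan_inv D).
Local Notation thetaP := (cartan_invP D).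
Local Notation nrm := (cnorm L theta).

Lemma stabZP g : stabZ H g <-> adj L g (vsval H) = vsval H.
Proof. by rewrite /stabZ /= adjE. Qed.

Lemma stabZ1 : stabZ H 1%g.
Proof. by apply/stabZP; rewrite adj1. Qed.

Lemma stabZM g h : stabZ H g -> stabZ H h -> stabZ H (g * h)%g.
Proof. by move=> /stabZP hg /stabZP hh; apply/stabZP; rewrite adjM hh hg. Qed.

Lemma stabZV g : stabZ H g -> stabZ H g^-1%g.
Proof. by move=> /stabZP hg; apply/stabZP; rewrite -{1}hg adjK. Qed.

Lemma stabK1 : stabK H 1%g.
Proof. by split; [exact: stabZ1 | exact: groupK1]. Qed.

Lemma vect_pt_act q z Y : stabZ H z ->
  vect_pt B H (bact B q z) Y = vect_pt B H q (adj L z Y).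
Proof.
move=> zZ; apply/to_quot_eqP; apply/seteqP; split => p [g gZ <-] /=.
  exists (z * g)%g; first exact: stabZM.
  by rewrite /= bactM adjE invgM adjM adjK.
exists (z^-1 * g)%g; first by apply: stabZM => //; exact: stabZV.
by rewrite /= -bactM mulVKg adjE invgM invgK !adjM.
Qed.

Lemma vect_ptP q r Y Z : vect_pt B H q Y = vect_pt B H r Z ->
  exists g, [/\ stabZ H g, r = bact B q g & Z = adj L g^-1%g Y].
Proof.
move=> /to_quot_eqP E.
have : orbit_of B (stabZ H) (Ad L) (r, Z) (r, Z).
  by exists 1%g; [exact: stabZ1 | rewrite /= bact1 adjE invg1 adj1].
by rewrite -E => -[g gZ [<- <-]]; exists g; rewrite -adjE.
Qed.

(** [vect_norm] chooses a representative; two points of Rphi in one fiber differ by an element of K,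
    which acts isometrically, so the choice does not matter. *)
Lemma vect_norm_pt Rphi r Y : principal_on (bact B) (bproj B) Rphi (stabK H) ->
  Rphi r -> vect_norm (B := B) (H := H) Rphi (vect_pt B H r Y) = nrm Y.
Proof.
move=> pR Rr; rewrite /vect_norm.
set S := [set Y' | _]; have : S (xget 0 S).
  by apply: xgetPex; exists Y; exists r.
move: (xget 0 S) => Y' [r' Rr' /vect_ptP[g [gZ r'E ->]]].
rewrite cformE -/(cnorm L theta _).
have [U [s [_ Ux _ /(_ _ Ux)[_ _ h]]]] := reduction_section stabK1 pR (bproj B r).
have [k [_ kK] kE] := h r Rr erefl.
have [|k' [_ k'K] k'E] := h r' Rr'; first by rewrite r'E bproj_act.
have -> : (g^-1 = k'^-1 * k)%g.
  have /bact_inj -> : bact B (s (bproj B r)) k' = bact B (s (bproj B r)) (k * g)%g.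
    by rewrite bactM -kE -r'E.
  by rewrite invgM mulgVK.
by rewrite adjM groupKV_cnorm// groupK_cnorm.
Qed.

Lemma vect_flow_pt (phi : R -> Q -> Q) t q Y :
  (forall q g, phi t (bact B q g) = bact B (phi t q) g) ->
  vect_flow (B := B) (H := H) phi t (vect_pt B H q Y) = vect_pt B H (phi t q) Y.
Proof.
move=> aut; rewrite /vect_flow /assoc_flow.
have : vect_pt B H q Y = vect_pt B H (repr (vect_pt B H q Y)).1 (repr (vect_pt B H q Y)).2.
  symmetry; rewrite /vect_pt /assoc_pt -surjective_pairing; exact: to_quot_repr.
move=> /vect_ptP[g [gZ -> ->]].
by rewrite aut -/(vect_pt B H _ _) vect_pt_act// adjVK.
Qed.

(** The operator norm only sees the unit ball; rescaling by 1 / |Ad z0 Y| gives the estimate for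
    each vector. The elements z0 and z translate q and phi_t q into Rphi, where the norm is
    explicit. *)
Lemma contraction_nminus (T : set R) (phi : R -> Q -> Q) Rphi C mu :
  (forall t q g, T t -> phi t (bact B q g) = bact B (phi t q) g) ->
  principal_on (bact B) (bproj B) Rphi (stabK H) ->
  (forall t x, T t -> 0 <= t ->
      (fiber_opnorm B phi H f Rphi t x <= (C * expR (- mu * t))%:E)%E) ->
  forall q r0 z0 t r z Y, block_reduction H f q -> nminus H Y -> T t -> 0 <= t ->
    Rphi r0 -> stabZ H z0 -> q = bact B r0 z0 ->
    Rphi r -> stabZ H z -> phi t q = bact B r z ->
    nrm (adj L z Y) <= C * expR (- mu * t) * nrm (adj L z0 Y).
Proof.
move=> aut pR hC q r0 z0 t r z Y fq nY Tt t0 Rr0 z0Z qE Rr zZ pE.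
have v0 (s : R) : vect_norm (B := B) (H := H) Rphi (vect_pt B H q (s *: Y)) = `|s| * nrm (adj L z0 Y).
  by rewrite qE vect_pt_act// vect_norm_pt// linearZ /= (cnormZ thetaP).
have vt (s : R) : vect_norm (B := B) (H := H) Rphi (vect_flow (B := B) (H := H) phi t (vect_pt B H q (s *: Y))) = `|s| * nrm (adj L z Y).
  rewrite vect_flow_pt; last by move=> q' g; exact: aut.
  by rewrite pE vect_pt_act// vect_norm_pt// linearZ /= (cnormZ thetaP).
have key (s : R) : `|s| * nrm (adj L z0 Y) <= 1 -> `|s| * nrm (adj L z Y) <= C * expR (- mu * t).
  move=> s1; rewrite -vt -lee_fin; apply: le_trans (hC t (bproj B q) Tt t0).
  apply: ereal_sup_ubound; exists (vect_pt B H q (s *: Y)) => //.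
  split; last by rewrite v0.
  exists q, (s *: Y); split => //.
  by apply: lin_closedZ => //; exact: nminus_closed.
have [N0|N0] := eqVneq (nrm (adj L z0 Y)) 0.
  have Y0 : adj L z0 Y = 0.
    apply/eqP; apply: contraT => /(cform_gt0 thetaP).
    by rewrite -(cnorm_sqr thetaP) N0 expr0n ltxx.
  have -> : Y = 0 by rewrite -(adjK L z0 Y) Y0 linear0.
  by rewrite !linear0 -(scale0r 0) (cnormZ thetaP) normr0 mul0r mulr0.
have Np : 0 < nrm (adj L z0 Y) by rewrite lt_neqAle eq_sym N0 cnorm_ge0.
have := key (nrm (adj L z0 Y))^-1; rewrite normfV gtr0_norm// mulVf// => /(_ (lexx _)).
by rewrite ler_pdivrMl// mulrC.
Qed.

End VectorBundle.

Section FlagBundle.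
Context {R : realType} {n : nat} {G : topGroupType} {L : lie_group R n G}.
Variable D : cartan_data L.
Context {Q X : topologicalType}.
Variable B : principal_bundle G Q X.

Lemma left_cosetM g h : left_coset D (g * h)%g = [set (g * x)%g | x in left_coset D h].
Proof.
apply/seteqP; split => [_ [p pP <-]|_ [_ [p pP <-] <-]] /=.
  by exists (h * p)%g; [exists p | rewrite mulgA].
by exists p => //; rewrite mulgA.
Qed.

Lemma left_coset_mem g h : left_coset D g = left_coset D h -> exists2 p, groupP D p & h = (g * p)%g.
Proof.
move=> E; have : left_coset D h h by exists 1%g; [exact: groupP1 | rewrite mulg1].
by rewrite -E => -[p pP <-]; exists p.
Qed.

Lemma left_coset_repr_act g (b : flag D) :
  left_coset D (repr (flag_act g b)) = left_coset D (g * repr b)%g.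
Proof. exact: repr_to_quot. Qed.

Lemma left_coset_repr_origin : left_coset D (repr (flag_origin D)) = left_coset D 1%g.
Proof. exact: repr_to_quot. Qed.

(** The classes q . g b0 and r . b0 agree only if r = q g' with g' P = g P. The action goes through
    representatives, so the comparison is made on cosets. *)
Lemma flag_pt_origin q g r :
  flag_pt (D := D) B q (flag_act g (flag_origin D)) = flag_pt B r (flag_origin D) ->
  exists2 p, groupP D p & r = bact B (bact B q g) p.
Proof.
move=> /to_quot_eqP E.
have : orbit_of B [set: G] (@flag_act _ _ _ _ D) (r, flag_origin D) (r, flag_origin D).
  exists 1%g => //=; rewrite bact1 invg1 /flag_act mul1g; congr pair.
  exact: to_quot_repr.
rewrite -E => -[g' _ [<- bE]].
have : left_coset D g = left_coset D g'.
  have := congr1 (fun b => left_coset D (repr b)) bE.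
  rewrite left_coset_repr_act left_coset_repr_origin left_cosetM left_coset_repr_act.
  rewrite left_cosetM left_coset_repr_origin -left_cosetM mulg1 => E'.
  have := congr1 (fun S => [set (g' * x)%g | x in S]) E'.
  by rewrite -!left_cosetM mulVKg mulg1.
move=> /left_coset_mem[p pP ->]; exists p => //.
by rewrite bactM.
Qed.

End FlagBundle.

(** If f(q) = Ad(g) H then q g lies in the block reduction, and so does q g k since k fixes H; for w
    = 1 this point lies over b0 in the class of xi. *)
Lemma flag_pt_morse (R : realType) (n : nat) (G : topGroupType) (L : lie_group R n G)
    (D : cartan_data L) (Q X : topologicalType) (B : principal_bundle G Q X)
    (H : atype D) (f : Q -> 'rV[R]_n) (xi : flag_bundle D B) :
  (forall q g, f (bact B q g) = Ad L g^-1%g (f q)) -> morse H f 1%g xi ->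
  exists2 q, block_reduction H f q & forall r, xi = flag_pt B r (flag_origin D) ->
    exists2 p, groupP D p & r = bact B q p.
Proof.
move=> fE [q [b [[g [k [fq [kZ _] ->]]] ->]]].
exists (bact B q (g * k)%g).
  rewrite /block_reduction /= fE fq adjE invgM adjM adjK.
  by have /stabZP : stabZ H k^-1%g by exact: stabZV.
by move=> r; rewrite mulg1 => /flag_pt_origin.
Qed.

Lemma time_unbounded (R : realType) (T : set R) (M : R) :
  T = [set: R] \/ T = range (intr : int -> R) -> exists2 t, T t & M < t.
Proof.
move=> [->|->]; first by exists (M + 1); rewrite ?ltrDl.
pose k := (Num.truncn `|M|).+1.
exists (k%:Z%:~R); first by exists k%:Z.
have /andP[_ h] := @truncn_itv R `|M| (normr_ge0 _).
apply: le_lt_trans (ler_norm M) _.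
by rewrite -pmulrn.
Qed.

Theorem theorem7p2 (R : realType) (n : nat) (G : topGroupType)
    (L : lie_group R n G)
    (G_connected : connected [set: G])
    (G_noncompact : ~ compact [set: G])
    (G_semisimple : semisimple L)
    (G_finite_center : finite_set (center_set G))
    (D : cartan_data L)
    (Q X : topologicalType)
    (X_compact : compact [set: X])
    (X_hausdorff : hausdorff_space X)
    (B : principal_bundle G Q X)
    (T : set R)
    (T_time : T = [set: R] \/ T = range (intr : int -> R))
    (phi : R -> Q -> Q)
    (phi_flow : is_flow T phi)
    (phi_aut : forall t q g, T t -> phi t (bact B q g) = bact B (phi t q) g)
    (X_chain_transitive : chain_transitive T (base_flow B phi) [set: X])
    (RK : set Q)
    (RK_reduction : reduction B [set: Q] RK (groupK D))
    (H : atype D) (f : Q -> 'rV[R]_n)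
    (f_block : block_form B T phi H f)
    (Rphi : set Q)
    (Rphi_reduction : reduction B (block_reduction H f) Rphi (stabK H))
    (Mplus : set (flag_bundle D B))
    (Mplus_component : chain_component T (flag_flow phi) Mplus)
    (Mplus_attractor : attractor T (flag_flow phi) Mplus)
    (mu : R)
    (mu_contraction : contraction_exponent B T phi H f Rphi mu)
    (la : atype D)
    (la_spectrum : lyapunov_spectrum T phi RK Mplus la)
    (al : functional D)
    (al_positive : posroot al)
    (al_outside : ~ roots_spanned L (Theta H) al) :
  mu <= al la.
Proof.
have [mu0 [C C0 hC]] := mu_contraction.
have clH := block_chamber f_block.
have MplusE : Mplus = morse H f 1%g by apply/(block_attractor f_block Mplus_component).
case: la_spectrum => xi Mxi [A hA Ala].
have {Mxi} mxi : morse H f 1%g xi by rewrite -MplusE.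
have [q fq hq] := flag_pt_morse (block_equiv f_block) mxi.
have [_ pK] := RK_reduction; have [Rphi_sub pR] := Rphi_reduction.
have thetaP := cartan_invP D.
pose nrm := cnorm L (cartan_inv D).
have [[al0 [Y Y0 hY]] pal] := al_positive.
have b0 := cform_gt0 thetaP Y0.
have N0 : 0 <= nrm Y by exact: cnorm_ge0.
have [C1 C10 h1] := transition_bounded X_compact (@stabK1 _ _ _ _ D H) (groupK1 D)
  (fun k kK => kK.2) (fun k kK => kK) pR pK.
(* The two points have the same image H under f, so the element relating them fixes H. *)
have red0 q' : block_reduction H f q' -> exists r z, [/\ Rphi r, stabZ H z & q' = bact B r z].
  move=> fq'; have [U [s [_ Ux _ /(_ _ Ux)[Rs ps _]]]] := reduction_section (@stabK1 _ _ _ _ D H) pR (bproj B q').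
  have [z zE] := bact_trans ps; exists (s (bproj B q')), z; split => //.
  have fs : f (s (bproj B q')) = vsval H by exact: Rphi_sub.
  have : f q' = vsval H by exact: fq'.
  rewrite zE (block_equiv f_block) fs adjE => zH.
  by apply/stabZP; rewrite -{1}zH adjVK.
have [r0 [z0 [Rr0 z0Z qE]]] := red0 q fq.
have [k0 k00 hk0] := cnorm_Ad_bound thetaP z0.
(* The section at the base point of q is a reference in RK chosen before t; [g1] compares it with
   q. *)
have [U [s [_ Ux _ /(_ _ Ux)[Ks ps hs]]]] := reduction_section (groupK1 D) pK (bproj B q).
have [g1 sE] := bact_trans (esym ps).
have [k1 k10 hk1] := cnorm_Ad_bound thetaP g1.
(* C1 |Y| bounds Ad(c^-1) Y. In the other factor, k1 |Y| bounds X', k0 accounts for the initial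
   translation z0, and C comes from the contraction. *)
pose C2 := C1 * nrm Y * (C * (k0 * (k1 * nrm Y))).
have C20 : 0 <= C2 by rewrite !mulr_ge0// ltW.
have bound t : T t -> 0 <= t ->
    expR (- al (A t)) * cform L (cartan_inv D) Y Y <= C2 * expR (- mu * t).
  move=> Tt t0.
  have [r [Kr xiE [r' [h [u [Kr' eh uN pE]]]]]] := hA t Tt.
  have [p pP rE] := hq r xiE.
  have fpq : block_reduction H f (phi t q).
    by rewrite /block_reduction /= (block_inv f_block).
  have [rt [zt [Rrt ztZ ptE]]] := red0 _ fpq.
  have pr : bproj B r' = bproj B rt.
    rewrite -(bproj_act B r' (h * u)%g) -pE rE phi_aut// bproj_act ptE.
    by rewrite bproj_act.
  have [c cE] := bact_trans pr.
  have czp : (c * zt * p = h * u)%g.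
    apply: (@bact_inj _ _ _ B r').
    by rewrite !bactM -cE -ptE -phi_aut// -rE pE bactM.
  have [X' [nX X'le Epair]] := expansion_pairing clH al_positive al_outside hY eh uN pP ztZ czp.
  have [kk kkK kE] := hs r Kr (etrans (congr1 _ rE) (bproj_act _ _ _)).
  have pg : p = (g1 * kk)%g.
    by apply: (@bact_inj _ _ _ B q); rewrite -rE bactM -sE.
  have X'b : nrm X' <= k1 * nrm Y.
    apply: (le_trans X'le); rewrite pg adjM; apply: (le_trans (hk1 _)).
    by rewrite groupK_cnorm// cnorm_theta.
  have ctr := contraction_nminus phi_aut pR hC fq nX Tt t0 Rr0 z0Z qE Rrt ztZ ptE.
  have bY : cform L (cartan_inv D) Y Y = - kil L Y (cartan_inv D Y) by [].
  rewrite bY mulrN Epair.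
  apply: (le_trans (ler_norm _)); rewrite normrN (killing_cform thetaP) normrN.
  apply: (le_trans (cform_cauchy thetaP _ _)); rewrite (cnorm_theta thetaP).
  have -> : C2 * expR (- mu * t) = (C1 * nrm Y) * (C * expR (- mu * t) * (k0 * (k1 * nrm Y))).
    by rewrite /C2; ring.
  apply: ler_pM; [exact: cnorm_ge0 | exact: cnorm_ge0 | exact: h1 cE |].
  apply: (le_trans ctr); rewrite ler_wpM2l ?mulr_ge0 ?expR_ge0 ?(ltW C0)//.
  by apply: (le_trans (hk0 _)); rewrite ler_wpM2l.
(* The added 1 makes C3 positive, so that its logarithm can be used. *)
pose C3 := C2 / cform L (cartan_inv D) Y Y + 1.
have C30 : 0 < C3 by rewrite ltr_wpDl// divr_ge0// ltW.
have bound2 t : T t -> 0 <= t -> mu * t - ln C3 <= al (A t).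
  move=> Tt t0; have := bound t Tt t0.
  rewrite -ler_pdivlMr// mulrAC => h.
  have {}h : expR (- al (A t)) <= expR (ln C3 - mu * t).
    rewrite expRD lnK ?posrE// -mulNr; apply: (le_trans h).
    by rewrite ler_wpM2r ?expR_ge0// lerDl.
  by rewrite ler_expR in h; rewrite -lerN2 opprB.
rewrite leNgt; apply/negP => lamu.
pose eps := (mu - al la) / 2.
have eps0 : 0 < eps by rewrite divr_gt0// subr_gt0.
have cal : ext_functional al (t^-1 *: (vsval (A t) : 'rV[R]_n)) @[t --> within T (+oo)%R] --> ext_functional al (vsval la).
  apply: (@cvg_comp _ _ _ (fun t => t^-1 *: (vsval (A t) : 'rV[R]_n)) (ext_functional al) _ _ _ Ala).
  exact: ext_functional_continuous.
have : \forall t \near within T (+oo)%R, `|ext_functional al (vsval la) - ext_functional al (t^-1 *: (vsval (A t) : 'rV[R]_n))| <= eps.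
  by move/cvgrPdist_le : cal; apply.
move=> [M [_ hM]].
(* At such a time mu t - ln C3 <= al(A t) <= t (al(la) + eps), where mu = al(la) + 2 eps. This
   yields t eps <= ln C3, against t eps > |ln C3| + 1. *)
have [t Tt Mt] := time_unbounded (Num.max M (Num.max 1 ((`|ln C3| + 1) / eps))) T_time.
move: Mt; rewrite !gt_max => /andP[Mt /andP[t1 te]].
have t0 : 0 < t by exact: lt_trans t1.
have := hM t Mt Tt; rewrite linearZ /= !vsvalK distrC => h.
have {}h : t^-1 * al (A t) <= al la + eps.
  by have := le_trans (ler_norm _) h; rewrite lerBlDl.
have h2 := bound2 t Tt (ltW t0).
rewrite ler_pdivrMl// in h.
have h3 := le_trans h2 h.
rewrite ltr_pdivrMr// in te.
have h4 := ler_norm (ln C3).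
have h5 : mu = al la + 2 * eps by rewrite /eps; field.
rewrite h5 in h3.
have : t * eps <= ln C3 by move: h3; rewrite !(mulrDl, mulrDr); lra.
lra.
Qed.
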